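(* There are a positive constant $\bar C$ and, for each $K\ge1$, a positive constant $\underline C(K)$ such that for all $t>0$, \[\sup_x\bigl(V^\infty(t,x)-V^\lambda(t,x)\bigr)\le \bar C\,t^{-\frac12-\lambda_0}\lambda^{-(2\lambda_0-1)}\quad\forall\lambda>0,\] and \[\underline C(K)\,t^{-\frac12-\lambda_0}\lambda^{-(2\lambda_0-1)}\le\inf_{|x|\le K\sqrt t}\bigl(V^\infty(t,x)-V^\lambda(t,x)\bigr)\quad\forall\lambda\ge t^{-1/2}.\]
   Context: For $\lambda>0$, $V^\lambda(t,x)$ is the unique solution, $C^{1,2}$ on $[0,\infty)\times\mathbb{R}\setminus\{(0,0)\}$, of $\partial_tV=\frac12\partial_x^2V-\frac12V^2$ with $V(0,\cdot)=\lambda\delta_0$. $V^\lambda$ is nondecreasing in $\lambda$ and $V^\infty(t,x)=\lim_{\lambda\to\infty}V^\lambda(t,x)$ (finite, with $V^\infty(t,x)\le2/t$). Let $F(x)=V^\infty(1,x)$, a positive symmetric $C^2$ function vanishing at infinity. Let $m$ be the standard normal law and $Lh=\frac12h''-\frac x2h'$. The operator $L^Fh=Lh-Fh$ (the $L^2(m)$-generator of the Ornstein–Uhlenbeck semigroup killed at rate $F$) has a complete orthonormal system in $L^2(m)$ of $C^2$ eigenfunctions $\psi_n$ with $L^F\psi_n=-\lambda_n\psi_n$, $0\le\lambda_0\le\lambda_1\le\dots\to\infty$, $\lambda_0$ simple with positive eigenfunction; $\lambda_0$ denotes this lowest value (it satisfies $1/2<\lambda_0<1$). *)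

(* Defs.v *)
From Stdlib Require Import Reals Lra.
From Coquelicot Require Import Coquelicot.
Open Scope R_scope.

Definition jcont (f : R -> R -> R) (t x : R) : Prop :=
  filterlim (fun p : R * R => f (fst p) (snd p)) (locally (t, x)) (locally (f t x)).

Definition dt (V : R -> R -> R) (t x : R) : R := Derive (fun s => V s x) t.
Definition dx (V : R -> R -> R) (t x : R) : R := Derive (fun y => V t y) x.
Definition dxx (V : R -> R -> R) (t x : R) : R := Derive (fun y => dx V t y) x.

Definition classical_solution (V : R -> R -> R) : Prop :=
  forall t x, 0 < t ->
    0 <= V t x /\
    ex_derive (fun s => V s x) t /\
    ex_derive (fun y => V t y) x /\
    ex_derive (fun y => dx V t y) x /\
    jcont V t x /\ jcont (dt V) t x /\ jcont (dx V) t x /\ jcont (dxx V) t x /\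
    dt V t x = / 2 * dxx V t x - / 2 * (V t x) ^ 2.

(* Initial trace V(0,.) = lam * delta_0, tested against continuous compactly
   supported test functions: int V(t,x) phi(x) dx -> lam * phi(0) as t -> 0+. *)
Definition initial_trace_delta (V : R -> R -> R) (lam : R) : Prop :=
  forall (phi : R -> R) (Rs : R),
    (forall x, continuous phi x) ->
    (forall x, Rs < Rabs x -> phi x = 0) ->
    filterlim (fun t => RInt (fun x => V t x * phi x) (- Rs) Rs) (at_right 0)
      (locally (lam * phi 0)).

Definition is_V_lambda (V : R -> R -> R) (lam : R) : Prop :=
  classical_solution V /\ initial_trace_delta V lam.

Definition gauss (x : R) : R := exp (- x ^ 2 / 2) / sqrt (2 * PI).

Definition in_L2m (h : R -> R) : Prop :=
  ex_RInt_gen (fun x => h x ^ 2 * gauss x) (Rbar_locally m_infty) (Rbar_locally p_infty).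

Definition C2 (h : R -> R) : Prop :=
  forall x, ex_derive h x /\ ex_derive (Derive h) x /\ continuous (Derive_n h 2) x.

Definition LF (F h : R -> R) (x : R) : R :=
  / 2 * Derive_n h 2 x - x / 2 * Derive h x - F x * h x.

Definition is_eigenvalue_LF (F : R -> R) (mu : R) : Prop :=
  exists h : R -> R, C2 h /\ in_L2m h /\ (exists x, h x <> 0) /\
    forall x, LF F h x = - mu * h x.

Definition lowest_eigenvalue_LF (F : R -> R) (lam0 : R) : Prop :=
  is_eigenvalue_LF F lam0 /\ (forall mu, is_eigenvalue_LF F mu -> lam0 <= mu).

(* Main.v *)
Require Import Defs.
From Stdlib Require Import Reals Lra Psatz Lia IndefiniteDescription.
From Coquelicot Require Import Coquelicot.
Open Scope R_scope.

(** The gap [W = Vinf - V lam] solves [W_t = W_xx/2 - Vinf W + W^2/2].  Since [Vinf] is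
    self-similar with profile [F], a positive eigenfunction [h] of [L^F] for [lam0] gives the
    self-similar solution [H = t^(-1/2-lam0) psi (x/sqrt t)], [psi = exp(-y^2/2) h], of the
    linearised equation [U_t = U_xx/2 - Vinf U], and by scaling only the mass [1] matters.

    Upper bound: if [U > 0] is a supersolution of the linearised equation, then
    [Vinf^2/(Vinf+U)] is a subsolution of the nonlinear one; it lies below [V 1] at time [1] as
    soon as [U] has fat enough tails, which a perturbation [N] of [H], Gaussian with a smaller
    rate and decaying faster in time, provides.  Lower bound: a small multiple of [H - th N] is a
    subsolution of the linearised equation that lies below the gap at a small time.

    Comparison needs no growth condition: the absorption term [-V^2/2] beats the error of a
    polynomial cut-off, uniformly as the cut-off is removed.  At time [0] it works because
    [0 <= lam heat - V] turns weak convergence of the traces into convergence in [L^1].  This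
    yields uniqueness, hence scaling and evenness, and monotonicity and concavity in [lam]; the
    last two control the [lam]-derivative and make [F] a [C^2] solution of the profile equation.

    The positive eigenfunction comes from shooting: the supremum of the parameters for which the
    even solution stays positive is an eigenvalue, and no positive solution exists above
    [lam0]. *)

(** Both barriers must be ordered in the Gaussian tails, and this fixes the rates. [V 1] is only
    known to stay above a multiple of [exp (- y^2/2)], and the profile [F] to stay below rate 7/16;
    so [F^2/U] fits under [V 1] when [U] has rate 3/8 = 2 * 7/16 - 1/2. For the lower bound the gap
    at a small time dominates rate 1/2, while [h] is only bounded by [exp (y^2/16)], hence [psi] by
    rate 7/16; subtracting a term of rate 3/8 = 1/2 - 2 * 1/16 restores the order, by completing a
    square in [exp (y^2/16)]. Any rate in (0, 1/2) gives [N] a positive quadratic coefficient, and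
    its extra factor [1/t] turns [- M psi] into a gain where that coefficient is too small. [lam0]
    is given only as a least eigenvalue, without sign or parity of an eigenfunction; shooting
    supplies both. [Vinf] is only a pointwise limit, and no parabolic regularity theory is used:
    self-similarity exchanges the time derivative for a derivative in the mass, which reduces
    smoothness to an ODE for the profile. *)

Ltac Req := match goal with |- @eq _ ?a ?b => change (@eq R a b) end.

(** * Calculus on the real line *)

Lemma cont_plus (f g : R -> R) x :
  continuous f x -> continuous g x -> continuous (fun y => f y + g y) x.
Proof. intros; apply (continuous_plus (V := R_NormedModule) f g x); assumption. Qed.

Lemma cont_minus (f g : R -> R) x :
  continuous f x -> continuous g x -> continuous (fun y => f y - g y) x.
Proof. intros; apply (continuous_minus (V := R_NormedModule) f g x); assumption. Qed.

Lemma cont_mult (f g : R -> R) x :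
  continuous f x -> continuous g x -> continuous (fun y => f y * g y) x.
Proof. intros; apply (continuous_mult (K := R_AbsRing) f g x); assumption. Qed.

Lemma cont_comp (f g : R -> R) x :
  continuous f x -> continuous g (f x) -> continuous (fun y => g (f y)) x.
Proof. intros; apply (continuous_comp f g x); assumption. Qed.

Lemma cont_const (c x : R) : continuous (fun _ : R => c) x.
Proof. apply continuous_const. Qed.

Lemma cont_id (x : R) : continuous (fun y : R => y) x.
Proof. apply continuous_id. Qed.

Lemma cont_ex_derive (f : R -> R) x : ex_derive f x -> continuous f x.
Proof. apply (ex_derive_continuous (K := R_AbsRing) (V := R_NormedModule)). Qed.

Lemma cont_is_derive (f : R -> R) x l : is_derive f x l -> continuous f x.
Proof. intros H; apply cont_ex_derive; exists l; exact H. Qed.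

Lemma cont_pow (f : R -> R) n x : continuous f x -> continuous (fun y => f y ^ n) x.
Proof.
  intros H; apply (cont_comp f (fun z => z ^ n)); [exact H|].
  apply cont_ex_derive; auto_derive; exact I.
Qed.

Lemma cont_exp (f : R -> R) x : continuous f x -> continuous (fun y => exp (f y)) x.
Proof.
  intros H; apply (cont_comp f exp); [exact H|].
  apply cont_ex_derive; auto_derive; exact I.
Qed.

Lemma continuity_2d_snd (f : R -> R -> R) t x :
  continuity_2d_pt f t x -> continuous (fun y => f t y) x.
Proof.
  intros H; apply continuity_pt_filterlim.
  intros e He; destruct (H (mkposreal e He)) as [d Hd].
  exists d; split; [apply cond_pos|].
  intros y [_ Hy]; apply (Hd t y); [|exact Hy].
  rewrite Rminus_diag; rewrite Rabs_R0; apply cond_pos.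
Qed.

Lemma continuity_2d_comp (f : R -> R) (g : R -> R -> R) t x :
  continuous f (g t x) -> continuity_2d_pt g t x ->
  continuity_2d_pt (fun s y => f (g s y)) t x.
Proof.
  intros H1 H2; apply continuity_1d_2d_pt_comp; [|exact H2].
  apply continuity_pt_filterlim; exact H1.
Qed.

Lemma RInt_lin_minus (f g : R -> R) (k a b : R) : ex_RInt f a b -> ex_RInt g a b ->
  RInt (fun x => f x - k * g x) a b = RInt f a b - k * RInt g a b.
Proof.
  intros Hf Hg.
  apply is_RInt_unique.
  apply (is_RInt_minus (V := R_NormedModule) f (fun x => k * g x)).
  - apply (RInt_correct (V := R_CompleteNormedModule)); exact Hf.
  - apply (is_RInt_scal (V := R_NormedModule) g).
    apply (RInt_correct (V := R_CompleteNormedModule)); exact Hg.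
Qed.

Lemma RInt_scal_R (f : R -> R) (k a b : R) : ex_RInt f a b ->
  RInt (fun x => k * f x) a b = k * RInt f a b.
Proof. intros; apply (RInt_scal (V := R_CompleteNormedModule) f a b k); assumption. Qed.

Lemma ex_RInt_cont (f : R -> R) a b : (forall x, continuous f x) -> ex_RInt f a b.
Proof. intros H; apply (ex_RInt_continuous (V := R_CompleteNormedModule)); intros; apply H. Qed.

Lemma RInt_const_R (c a b : R) : RInt (fun _ => c) a b = c * (b - a).
Proof. rewrite RInt_const; unfold scal; simpl; unfold mult; simpl; ring. Qed.

(** The integrand is the derivative of [a1 * q - a * q1], which vanishes at both ends because [q]
    and [q1] do. *)
Lemma RInt_green (a a1 a2 q q1 q2 : R -> R) (l r : R) :
  (forall x, is_derive a x (a1 x)) -> (forall x, is_derive a1 x (a2 x)) ->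
  (forall x, is_derive q x (q1 x)) -> (forall x, is_derive q1 x (q2 x)) ->
  (forall x, continuous a2 x) -> (forall x, continuous q2 x) ->
  q l = 0 -> q r = 0 -> q1 l = 0 -> q1 r = 0 ->
  RInt (fun x => a2 x * q x - a x * q2 x) l r = 0.
Proof.
  intros Ha Ha1 Hq Hq1 Ca Cq e1 e2 e3 e4.
  apply is_RInt_unique.
  evar_last.
  apply (is_RInt_derive (V := R_CompleteNormedModule) (fun x => a1 x * q x - a x * q1 x)
           (fun x => a2 x * q x - a x * q2 x)).
  3: rewrite e1, e2, e3, e4; unfold minus, plus, opp; simpl; ring.
  - intros x _.
    evar_last.
    apply (is_derive_minus (V := R_NormedModule) (fun x => a1 x * q x) (fun x => a x * q1 x)).
    apply (is_derive_mult (K := R_AbsRing)); [apply Ha1|apply Hq|intros; apply Rmult_comm].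
    apply (is_derive_mult (K := R_AbsRing)); [apply Ha|apply Hq1|intros; apply Rmult_comm].
    unfold minus, plus, opp, mult; simpl; unfold mult; simpl; ring.
  - intros x _; apply cont_minus; apply cont_mult; auto.
    apply (cont_is_derive _ _ _ (Hq x)).
    apply (cont_is_derive _ _ _ (Ha x)).
Qed.

Lemma mvt_le (f f' : R -> R) (a b K : R) : a <= b ->
  (forall x, a <= x <= b -> is_derive f x (f' x)) ->
  (forall x, a <= x <= b -> f' x <= K) ->
  f b <= f a + K * (b - a).
Proof.
  intros Hab Hd HK.
  destruct (MVT_gen f a b f') as [c [Hc E]].
  - intros x Hx; rewrite Rmin_left, Rmax_right in Hx by lra; apply Hd; lra.
  - intros x Hx; rewrite Rmin_left, Rmax_right in Hx by lra.
    apply continuity_pt_filterlim; eapply cont_is_derive; apply Hd; lra.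
  - rewrite Rmin_left, Rmax_right in Hc by lra.
    assert (f' c * (b - a) <= K * (b - a)) by (apply Rmult_le_compat_r; [lra|apply HK; lra]).
    lra.
Qed.

Lemma mvt_incr (f f' : R -> R) (a b : R) : a <= b ->
  (forall x, a <= x <= b -> is_derive f x (f' x)) ->
  (forall x, a <= x <= b -> 0 <= f' x) -> f a <= f b.
Proof.
  intros Hab Hd H0.
  enough (- f b <= - f a + 0 * (b - a)) by lra.
  apply (mvt_le (fun x => - f x) (fun x => - f' x)); auto.
  - intros x Hx; apply (is_derive_opp (V := R_NormedModule) f); auto.
  - intros x Hx; specialize (H0 x Hx); lra.
Qed.

(** * The truncation [J] and the cut-off [cutoff] *)

Lemma is_derive_glue (f g : R -> R) (l : R) :
  f 0 = g 0 -> is_derive f 0 l -> is_derive g 0 l ->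
  is_derive (fun r => if Rle_dec r 0 then f r else g r) 0 l.
Proof.
  intros e Hf Hg.
  apply is_derive_Reals in Hf; apply is_derive_Reals in Hg; apply is_derive_Reals.
  intros eps Heps.
  destruct (Hf eps Heps) as [d1 H1]; destruct (Hg eps Heps) as [d2 H2].
  assert (Hd : 0 < Rmin d1 d2) by (apply Rmin_glb_lt; apply cond_pos).
  exists (mkposreal _ Hd); simpl.
  intros h h0 Hh.
  pose proof (Rmin_l d1 d2); pose proof (Rmin_r d1 d2).
  destruct (Rle_dec 0 0); [|lra].
  destruct (Rle_dec (0 + h) 0).
  - apply H1; lra.
  - rewrite e; apply H2; lra.
Qed.

Lemma is_derive_piecewise (f f' g g' : R -> R) :
  (forall r, r <= 0 -> is_derive f r (f' r)) -> (forall r, 0 <= r -> is_derive g r (g' r)) ->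
  f 0 = g 0 -> f' 0 = g' 0 ->
  forall r, is_derive (fun r => if Rle_dec r 0 then f r else g r) r
                      (if Rle_dec r 0 then f' r else g' r).
Proof.
  intros Hf Hg e e' r.
  destruct (Rtotal_order r 0) as [Hr|[Hr|Hr]].
  - destruct (Rle_dec r 0); [|lra].
    apply (is_derive_ext_loc f); [|apply Hf; lra].
    assert (Hp : 0 < - r) by lra.
    exists (mkposreal _ Hp); intros y Hy.
    unfold ball in Hy; simpl in Hy; unfold AbsRing_ball, abs, minus, plus, opp in Hy; simpl in Hy.
    apply Rabs_def2 in Hy; destruct (Rle_dec y 0); [reflexivity|lra].
  - subst r; destruct (Rle_dec 0 0); [|lra].
    apply is_derive_glue; auto with real.
    rewrite e'; apply Hg; lra.
  - destruct (Rle_dec r 0); [lra|].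
    apply (is_derive_ext_loc g); [|apply Hg; lra].
    exists (mkposreal _ Hr); intros y Hy.
    unfold ball in Hy; simpl in Hy; unfold AbsRing_ball, abs, minus, plus, opp in Hy; simpl in Hy.
    apply Rabs_def2 in Hy; destruct (Rle_dec y 0); [lra|reflexivity].
Qed.

(** A convex [C^2] substitute for the positive part, of linear growth. The exponents give a second
    derivative continuous at 0 together with [J^2 <= J' r^2]. *)
Definition J (r : R) : R := if Rle_dec r 0 then 0 else r ^ 3 / (1 + r) ^ 2.
Definition J1 (r : R) : R := if Rle_dec r 0 then 0 else r ^ 2 * (r + 3) / (1 + r) ^ 3.
Definition J2 (r : R) : R := if Rle_dec r 0 then 0 else 6 * r / (1 + r) ^ 4.

Lemma is_derive_J r : is_derive J r (J1 r).
Proof.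
  apply (is_derive_piecewise (fun _ => 0) (fun _ => 0)
    (fun r => r ^ 3 / (1 + r) ^ 2) (fun r => r ^ 2 * (r + 3) / (1 + r) ^ 3)).
  - intros; apply (is_derive_const (V := R_NormedModule)).
  - intros s Hs; auto_derive; [nra|field; lra].
  - field.
  - field.
Qed.

Lemma is_derive_J1 r : is_derive J1 r (J2 r).
Proof.
  apply (is_derive_piecewise (fun _ => 0) (fun _ => 0)
    (fun r => r ^ 2 * (r + 3) / (1 + r) ^ 3) (fun r => 6 * r / (1 + r) ^ 4)).
  - intros; apply (is_derive_const (V := R_NormedModule)).
  - intros s Hs; auto_derive; [assert (0 < (1 + s) ^ 3) by (apply pow_lt; lra); simpl in *; lra|field; lra].
  - field.
  - field.
Qed.

Lemma continuous_J2 r : continuous J2 r.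
Proof.
  apply (continuous_ext (fun r => 6 * Rmax 0 r / (1 + Rmax 0 r) ^ 4)).
  - intros x; unfold J2; destruct (Rle_dec x 0).
    + rewrite Rmax_left by lra; Req; field.
    + rewrite Rmax_right by lra; reflexivity.
  - apply (cont_comp (Rmax 0) (fun z => 6 * z / (1 + z) ^ 4)).
    + apply continuity_pt_filterlim.
      apply (continuity_pt_ext (fun x => (x + Rabs x) * / 2)).
      * intros x; unfold Rmax; destruct (Rle_dec 0 x).
        rewrite Rabs_pos_eq; lra. rewrite Rabs_left; lra.
      * apply continuity_pt_mult; [apply continuity_pt_plus|].
        apply continuity_pt_id. apply Rcontinuity_abs. apply continuity_pt_const; intros ? ?; reflexivity.
    + pose proof (Rmax_l 0 r); apply cont_ex_derive; auto_derive.
      assert (0 < (1 + Rmax 0 r) ^ 4) by (apply pow_lt; lra); simpl in *; lra.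
Qed.

Lemma J_nonpos r : r <= 0 -> J r = 0.
Proof. intros; unfold J; destruct (Rle_dec r 0); lra. Qed.

Lemma J_pos r : 0 < r -> 0 < J r.
Proof.
  intros; unfold J; destruct (Rle_dec r 0); [lra|].
  apply Rdiv_lt_0_compat; apply pow_lt; lra.
Qed.

Lemma J_ge0 r : 0 <= J r.
Proof.
  destruct (Rle_dec r 0); [rewrite J_nonpos; lra|].
  apply Rlt_le, J_pos; lra.
Qed.

Lemma J_le r d : 0 <= d -> r <= d -> J r <= d.
Proof.
  intros Hd H; unfold J; destruct (Rle_dec r 0); [lra|].
  apply Rle_trans with r; [|lra].
  apply Rmult_le_reg_r with ((1 + r) ^ 2); [nra|].
  unfold Rdiv; rewrite Rmult_assoc, Rinv_l by nra; nra.
Qed.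

Lemma J1_nonpos r : r <= 0 -> J1 r = 0.
Proof. intros; unfold J1; destruct (Rle_dec r 0); lra. Qed.

Lemma J1_ge0 r : 0 <= J1 r.
Proof.
  unfold J1; destruct (Rle_dec r 0); [lra|].
  apply Rlt_le, Rdiv_lt_0_compat; [nra|apply pow_lt; lra].
Qed.

Lemma J2_ge0 r : 0 <= J2 r.
Proof.
  unfold J2; destruct (Rle_dec r 0); [lra|].
  apply Rlt_le, Rdiv_lt_0_compat; [nra|apply pow_lt; lra].
Qed.

(** Trades the absorption [J'(D) D^2] for [J(D)^2], the square that [cutoff_young] spends. *)
Lemma J_sqr_le r : J r ^ 2 <= J1 r * r ^ 2.
Proof.
  unfold J, J1; destruct (Rle_dec r 0); [nra|].
  apply Rminus_le_0.
  replace (_ - _) with (r ^ 4 * (4 * r + 3) / (1 + r) ^ 4) by (field; lra).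
  apply Rlt_le, Rdiv_lt_0_compat; [|apply pow_lt; lra].
  apply Rmult_lt_0_compat; [apply pow_lt; lra|lra].
Qed.

(** With the fourth power, the second derivative keeps a factor [(1 - z)^2], the square root of the
    cut-off itself; so [cutoff2^2 / cutoff] is bounded by a multiple of [R0^-4]. It acts as a
    cut-off on [[-R0, R0]] only, beyond which it grows. *)
Definition cutoff (R0 x : R) : R := (1 - (x / R0) ^ 2) ^ 4.
Definition cutoff1 (R0 x : R) : R := - 8 * (x / R0 ^ 2) * (1 - (x / R0) ^ 2) ^ 3.
Definition cutoff2 (R0 x : R) : R :=
  (1 - (x / R0) ^ 2) ^ 2 * (48 * (x / R0) ^ 2 - 8 * (1 - (x / R0) ^ 2)) / R0 ^ 2.

Lemma is_derive_cutoff R0 x : 0 < R0 -> is_derive (cutoff R0) x (cutoff1 R0 x).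
Proof. intros; unfold cutoff, cutoff1; auto_derive; [lra|field; lra]. Qed.

Lemma is_derive_cutoff1 R0 x : 0 < R0 -> is_derive (cutoff1 R0) x (cutoff2 R0 x).
Proof. intros; unfold cutoff1, cutoff2; auto_derive; [lra|field; lra]. Qed.

Lemma continuous_cutoff2 R0 x : 0 < R0 -> continuous (cutoff2 R0) x.
Proof. intros; apply cont_ex_derive; unfold cutoff2; auto_derive; nra. Qed.

Lemma cutoff_arg R0 x : 0 < R0 -> - R0 <= x <= R0 -> 0 <= (x / R0) ^ 2 <= 1.
Proof.
  intros HR Hx; split; [apply pow2_ge_0|].
  replace 1 with (1 ^ 2) by ring; apply pow_maj_Rabs.
  unfold Rdiv; rewrite Rabs_mult, (Rabs_pos_eq (/ R0)) by (left; apply Rinv_0_lt_compat; lra).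
  apply Rmult_le_reg_r with R0; [lra|]; rewrite Rmult_assoc, Rinv_l by lra.
  assert (Rabs x <= R0) by (apply Rabs_le; lra); lra.
Qed.

Lemma cutoff_bounds R0 x : 0 < R0 -> - R0 <= x <= R0 -> 0 <= cutoff R0 x <= 1.
Proof.
  intros HR Hx; pose proof (cutoff_arg R0 x HR Hx); unfold cutoff; split.
  - apply pow_le; lra.
  - replace 1 with (1 ^ 4) at 2 by ring; apply pow_incr; lra.
Qed.

Lemma cutoff_ends R0 : 0 < R0 -> cutoff R0 R0 = 0 /\ cutoff R0 (- R0) = 0 /\
  cutoff1 R0 R0 = 0 /\ cutoff1 R0 (- R0) = 0.
Proof.
  intros; unfold cutoff, cutoff1.
  replace (R0 / R0) with 1 by (field; lra).
  replace (- R0 / R0) with (- 1) by (field; lra).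
  repeat split; ring.
Qed.

(* The absorption term beats the cut-off error: [2ab <= a^2 + b^2]. *)
Lemma cutoff_young R0 x j : 0 < R0 -> - R0 <= x <= R0 ->
  / 2 * j * cutoff2 R0 x - / 2 * j ^ 2 * cutoff R0 x <= 288 / R0 ^ 4.
Proof.
  intros HR Hx; pose proof (cutoff_arg R0 x HR Hx) as [z0 z1].
  unfold cutoff, cutoff2; set (z := (x / R0) ^ 2) in *.
  set (a := 48 * z - 8 * (1 - z)); set (q := j * (1 - z) ^ 2).
  assert (Ha : a ^ 2 <= 48 ^ 2) by (unfold a; nra).
  assert (0 < / R0 ^ 2) by (apply Rinv_0_lt_compat, pow_lt; lra).
  replace (288 / R0 ^ 4) with (48 ^ 2 / 8 * (/ R0 ^ 2) ^ 2) by (field; lra).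
  replace (/ 2 * j * ((1 - z) ^ 2 * a / R0 ^ 2) - / 2 * j ^ 2 * (1 - z) ^ 4)
    with (/ 2 * q * a * / R0 ^ 2 - / 2 * q ^ 2) by (unfold q; field; lra).
  set (i := / R0 ^ 2) in *.
  assert (0 <= (q - / 2 * a * i) ^ 2) by apply pow2_ge_0.
  assert (a ^ 2 * i ^ 2 <= 48 ^ 2 * i ^ 2) by (apply Rmult_le_compat_r; [apply pow2_ge_0|exact Ha]).
  nra.
Qed.

Lemma RInt_reflect (f : R -> R) a b : (forall x, continuous f x) ->
  RInt (fun x => f (- x)) a b = RInt f (- b) (- a).
Proof.
  intros c.
  assert (ex : forall u v, ex_RInt f u v) by (intros; apply ex_RInt_cont; exact c).
  pose proof (RInt_comp_lin (V := R_CompleteNormedModule) f (-1) 0 a b) as E.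
  replace (-1 * a + 0) with (- a) in E by ring; replace (-1 * b + 0) with (- b) in E by ring.
  specialize (E (ex _ _)).
  rewrite <- (opp_RInt_swap (V := R_CompleteNormedModule) f (- b) (- a)) in E by apply ex.
  assert (E1 : RInt (fun y => -1 * f (-1 * y + 0)) a b = - RInt f (- b) (- a)) by exact E.
  assert (E2 : RInt (fun x => f (- x)) a b = -1 * RInt (fun y => -1 * f (-1 * y + 0)) a b).
  { rewrite <- RInt_scal_R.
    - apply RInt_ext; intros x _.
      replace (-1 * x + 0) with (- x) by ring; Req; ring.
    - apply (ex_RInt_comp_lin (V := R_NormedModule) f); apply ex. }
  rewrite E2, E1; Req; ring.
Qed.

(** * Comparison without growth conditions *)

(** The derivatives are carried as data, so that sums, products and rescalings have explicit ones.
    Continuity is joint for [f] and [ft], to differentiate under the integral, and in [x] alone for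
    [fxx], to integrate by parts. *)
Record C12 (t0 : R) (f ft fx fxx : R -> R -> R) : Prop := {
  c12_t : forall t x, t0 < t -> is_derive (fun s => f s x) t (ft t x);
  c12_x : forall t x, t0 < t -> is_derive (fun y => f t y) x (fx t x);
  c12_xx : forall t x, t0 < t -> is_derive (fun y => fx t y) x (fxx t x);
  c12_cont : forall t x, t0 < t -> continuity_2d_pt f t x;
  c12_cont_t : forall t x, t0 < t -> continuity_2d_pt ft t x;
  c12_cont_xx : forall t x, t0 < t -> continuous (fun y => fxx t y) x }.

Lemma C12_weaken t0 t1 f ft fx fxx : t0 <= t1 -> C12 t0 f ft fx fxx -> C12 t1 f ft fx fxx.
Proof. intros H [h1 h2 h3 h4 h5 h6]; split; intros; eauto using Rle_lt_trans. Qed.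

Lemma C12_lin a b t0 f ft fx fxx g gt gx gxx :
  C12 t0 f ft fx fxx -> C12 t0 g gt gx gxx ->
  C12 t0 (fun t x => a * f t x + b * g t x) (fun t x => a * ft t x + b * gt t x)
    (fun t x => a * fx t x + b * gx t x) (fun t x => a * fxx t x + b * gxx t x).
Proof.
  assert (K : forall (u v : R -> R) (z lu lv : R), is_derive u z lu -> is_derive v z lv ->
    is_derive (fun y => a * u y + b * v y) z (a * lu + b * lv)).
  { intros u v z lu lv Hu Hv.
    apply (is_derive_plus (V := R_NormedModule) (fun y => a * u y) (fun y => b * v y)).
    apply (is_derive_scal u z a); exact Hu. apply (is_derive_scal v z b); exact Hv. }
  intros [f1 f2 f3 f4 f5 f6] [g1 g2 g3 g4 g5 g6]; split; intros.
  - apply (K (fun s => f s x) (fun s => g s x)); auto.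
  - apply K; auto.
  - apply K; auto.
  - apply continuity_2d_pt_plus; apply continuity_2d_pt_mult; auto; apply continuity_2d_pt_const.
  - apply continuity_2d_pt_plus; apply continuity_2d_pt_mult; auto; apply continuity_2d_pt_const.
  - apply cont_plus; apply cont_mult; auto; apply cont_const.
Qed.

Lemma C12_mult_time t0 (w w1 : R -> R) f ft fx fxx :
  (forall t, t0 < t -> is_derive w t (w1 t)) -> (forall t, t0 < t -> continuous w1 t) ->
  C12 t0 f ft fx fxx ->
  C12 t0 (fun t x => w t * f t x) (fun t x => w1 t * f t x + w t * ft t x)
    (fun t x => w t * fx t x) (fun t x => w t * fxx t x).
Proof.
  intros Hw Cw [f1 f2 f3 f4 f5 f6].
  assert (c1 : forall t x, t0 < t -> continuity_2d_pt (fun s _ : R => w s) t x).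
  { intros; apply (continuity_2d_comp w (fun s _ => s)); [|apply continuity_2d_pt_id1].
    eapply cont_is_derive; apply Hw; auto. }
  assert (c2 : forall t x, t0 < t -> continuity_2d_pt (fun s _ : R => w1 s) t x).
  { intros; apply (continuity_2d_comp w1 (fun s _ => s)); [|apply continuity_2d_pt_id1]; auto. }
  split; intros.
  - evar_last.
    apply (is_derive_mult (K := R_AbsRing) w (fun s => f s x)); [apply Hw; auto|apply f1; auto|intros; apply Rmult_comm].
    reflexivity.
  - apply (is_derive_scal (fun y => f t y)); auto.
  - apply (is_derive_scal (fun y => fx t y)); auto.
  - apply continuity_2d_pt_mult; auto.
  - apply continuity_2d_pt_plus; apply continuity_2d_pt_mult; auto.
  - apply cont_mult; auto; apply cont_const.
Qed.

(** The strip is bounded above because a backward kernel will be singular at its final time. *)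
Lemma is_derive_RInt_time (t0 t1 : R) (g gt : R -> R -> R) (a b t : R) : t0 < t < t1 ->
  (forall s x, t0 < s < t1 -> is_derive (fun r => g r x) s (gt s x)) ->
  (forall s x, t0 < s < t1 -> continuity_2d_pt gt s x) ->
  (forall s x, t0 < s < t1 -> continuous (fun y => g s y) x) ->
  is_derive (fun s => RInt (fun x => g s x) a b) t (RInt (fun x => gt t x) a b).
Proof.
  intros Ht Hd Hc Hx.
  assert (Hp : 0 < Rmin (t - t0) (t1 - t)) by (apply Rmin_glb_lt; lra).
  pose proof (Rmin_l (t - t0) (t1 - t)); pose proof (Rmin_r (t - t0) (t1 - t)).
  assert (Hloc : forall P : R -> Prop, (forall s, t0 < s < t1 -> P s) -> locally t P).
  { intros P HP; exists (mkposreal _ Hp); intros s Hs; apply HP.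
    unfold ball in Hs; simpl in Hs; unfold AbsRing_ball, abs, minus, plus, opp in Hs; simpl in Hs.
    apply Rabs_def2 in Hs; lra. }
  replace (RInt (fun x => gt t x) a b) with (RInt (fun x => Derive (fun u => g u x) t) a b).
  2: { apply RInt_ext; intros x _; apply is_derive_unique; apply Hd; exact Ht. }
  apply (is_derive_RInt_param g).
  - apply Hloc; intros s Hs x _; eexists; apply Hd; exact Hs.
  - intros x _; apply (continuity_2d_pt_ext_loc gt); [|apply Hc; exact Ht].
    exists (mkposreal _ Hp); intros u v Hu _; simpl in Hu.
    symmetry; apply is_derive_unique, Hd; apply Rabs_def2 in Hu; lra.
  - apply Hloc; intros s Hs; apply ex_RInt_cont; intros x; apply Hx; exact Hs.
Qed.

Section Core.
Variables (t0 : R) (D Dt Dx Dxx : R -> R -> R).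
Hypothesis HD : C12 t0 D Dt Dx Dxx.

Definition trunc_mass (R0 t : R) := RInt (fun x => J (D t x) * cutoff R0 x) (- R0) R0.

Lemma continuous_J_cutoff R0 t x : 0 < R0 -> t0 < t ->
  continuous (fun y => J (D t y) * cutoff R0 y) x.
Proof.
  intros HR Ht; apply cont_mult.
  - apply (cont_comp (fun y => D t y) J).
    eapply cont_is_derive, (c12_x _ _ _ _ _ HD); exact Ht.
    eapply cont_is_derive, is_derive_J.
  - eapply cont_is_derive, is_derive_cutoff; exact HR.
Qed.

Lemma is_derive_trunc_mass R0 t : 0 < R0 -> t0 < t ->
  is_derive (trunc_mass R0) t (RInt (fun x => J1 (D t x) * Dt t x * cutoff R0 x) (- R0) R0).
Proof.
  intros HR Ht.
  apply (is_derive_RInt_time t0 (t + 1) (fun s x => J (D s x) * cutoff R0 x)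
          (fun s x => J1 (D s x) * Dt s x * cutoff R0 x)); [lra| | |].
  - intros s x [Hs _].
    apply (is_derive_ext (fun r => cutoff R0 x * J (D r x))); [intros; apply Rmult_comm|].
    evar_last.
    apply (is_derive_scal (fun r => J (D r x)) s (cutoff R0 x)).
    apply (is_derive_comp (K := R_AbsRing) (V := R_NormedModule) J (fun r => D r x)).
    apply is_derive_J. apply (c12_t _ _ _ _ _ HD); exact Hs.
    unfold scal; simpl; unfold mult; simpl; ring.
  - intros s x [Hs _]; apply continuity_2d_pt_mult; [apply continuity_2d_pt_mult|].
    + apply (continuity_2d_comp J1 D); [eapply cont_is_derive, is_derive_J1|apply (c12_cont _ _ _ _ _ HD); exact Hs].
    + apply (c12_cont_t _ _ _ _ _ HD); exact Hs.
    + apply (continuity_2d_comp (cutoff R0) (fun _ y => y)); [|apply continuity_2d_pt_id2].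
      eapply cont_is_derive, is_derive_cutoff; exact HR.
  - intros s x [Hs _]; apply continuous_J_cutoff; auto.
Qed.

(** For a subsolution minus a nonnegative supersolution this is [a^2 - b^2 >= (a - b)^2], valid when
    [a > b >= 0]; hence the restriction to [D > 0]. *)
Hypothesis Habs : forall t x, t0 < t -> 0 < D t x ->
  Dt t x <= / 2 * Dxx t x - / 2 * D t x ^ 2.

(** Convexity of [J] gives [J'(D) Dxx <= J(D)_xx], the two space derivatives move onto the cut-off,
    and [cutoff_young] bounds what remains by [288/R0^4] on an interval of length [2 R0]. *)
Lemma trunc_mass_derive_le R0 t : 0 < R0 -> t0 < t ->
  RInt (fun x => J1 (D t x) * Dt t x * cutoff R0 x) (- R0) R0 <= 576 / R0 ^ 3.
Proof.
  intros HR Ht.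
  pose (a2 := fun x => J2 (D t x) * Dx t x ^ 2 + J1 (D t x) * Dxx t x).
  assert (cD : forall x, continuous (fun y => D t y) x)
    by (intros; eapply cont_is_derive, (c12_x _ _ _ _ _ HD); exact Ht).
  assert (cDx : forall x, continuous (fun y => Dx t y) x)
    by (intros; eapply cont_is_derive, (c12_xx _ _ _ _ _ HD); exact Ht).
  assert (cDxx : forall x, continuous (fun y => Dxx t y) x)
    by (intros; apply (c12_cont_xx _ _ _ _ _ HD); exact Ht).
  assert (cDt : forall x, continuous (fun y => Dt t y) x)
    by (intros; apply continuity_2d_snd, (c12_cont_t _ _ _ _ _ HD); exact Ht).
  assert (cJ : forall x, continuous (fun y => J (D t y)) x)
    by (intros; apply (cont_comp (fun y => D t y) J); [apply cD|eapply cont_is_derive, is_derive_J]).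
  assert (cJ1 : forall x, continuous (fun y => J1 (D t y)) x)
    by (intros; apply (cont_comp (fun y => D t y) J1); [apply cD|eapply cont_is_derive, is_derive_J1]).
  assert (cJ2 : forall x, continuous (fun y => J2 (D t y)) x)
    by (intros; apply (cont_comp (fun y => D t y) J2); [apply cD|apply continuous_J2]).
  assert (cc : forall x, continuous (cutoff R0) x)
    by (intros; eapply cont_is_derive, is_derive_cutoff; exact HR).
  assert (ca2 : forall x, continuous a2 x).
  { intros; apply cont_plus; apply cont_mult; auto; apply cont_pow; auto. }
  destruct (cutoff_ends R0 HR) as (e1 & e2 & e3 & e4).
  assert (G : RInt (fun x => a2 x * cutoff R0 x - J (D t x) * cutoff2 R0 x) (- R0) R0 = 0).
  { apply (RInt_green (fun x => J (D t x)) (fun x => J1 (D t x) * Dx t x) a2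
             (cutoff R0) (cutoff1 R0) (cutoff2 R0)); auto.
    - intros x; evar_last.
      apply (is_derive_comp (K := R_AbsRing) (V := R_NormedModule) J (fun r => D t r)).
      apply is_derive_J. apply (c12_x _ _ _ _ _ HD); exact Ht.
      unfold scal; simpl; unfold mult; simpl; ring.
    - intros x; evar_last.
      apply (is_derive_mult (K := R_AbsRing) (fun y => J1 (D t y)) (fun y => Dx t y)).
      apply (is_derive_comp (K := R_AbsRing) (V := R_NormedModule) J1 (fun r => D t r)).
      apply is_derive_J1. apply (c12_x _ _ _ _ _ HD); exact Ht.
      apply (c12_xx _ _ _ _ _ HD); exact Ht. intros; apply Rmult_comm.
      unfold a2, scal, plus, mult; simpl; unfold mult; simpl; ring.
    - intros; apply is_derive_cutoff; exact HR.
    - intros; apply is_derive_cutoff1; exact HR.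
    - intros; apply continuous_cutoff2; exact HR. }
  assert (ex1 : ex_RInt (fun x => J1 (D t x) * Dt t x * cutoff R0 x) (- R0) R0)
    by (apply ex_RInt_cont; intros; apply cont_mult; [apply cont_mult|]; auto).
  assert (ex2 : ex_RInt (fun x => a2 x * cutoff R0 x - J (D t x) * cutoff2 R0 x) (- R0) R0)
    by (apply ex_RInt_cont; intros; apply cont_minus; apply cont_mult; auto;
        apply continuous_cutoff2; exact HR).
  pose proof (RInt_lin_minus _ _ (/ 2) _ _ ex1 ex2) as E; rewrite G in E.
  rewrite Rmult_0_r, Rminus_0_r in E; rewrite <- E.
  replace (576 / R0 ^ 3) with (RInt (fun _ => 288 / R0 ^ 4) (- R0) R0)
    by (rewrite RInt_const_R; Req; field; lra).
  apply RInt_le; [lra| | |].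
  - apply ex_RInt_cont; intros; apply cont_minus; [apply cont_mult; [apply cont_mult|]; auto|].
    apply cont_mult; [apply cont_const|]; apply cont_minus; apply cont_mult; auto;
        apply continuous_cutoff2; exact HR.
  - apply ex_RInt_cont; intros; apply cont_const.
  - intros x Hx; assert (Hx' : - R0 <= x <= R0) by lra.
    eapply Rle_trans; [|apply (cutoff_young R0 x (J (D t x)) HR Hx')].
    pose proof (cutoff_bounds R0 x HR Hx') as [c0 _].
    unfold a2.
    assert (0 <= J2 (D t x) * Dx t x ^ 2 * cutoff R0 x)
      by (apply Rmult_le_pos; [apply Rmult_le_pos; [apply J2_ge0|apply pow2_ge_0]|exact c0]).
    assert (J (D t x) ^ 2 * cutoff R0 x <= J1 (D t x) * D t x ^ 2 * cutoff R0 x)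
      by (apply Rmult_le_compat_r; [exact c0|apply J_sqr_le]).
    assert (J1 (D t x) * Dt t x * cutoff R0 x <=
            J1 (D t x) * (/ 2 * Dxx t x - / 2 * D t x ^ 2) * cutoff R0 x).
    { apply Rmult_le_compat_r; [exact c0|].
      destruct (Rle_dec (D t x) 0) as [h|h]; [rewrite J1_nonpos by exact h; lra|].
      apply Rmult_le_compat_l; [apply J1_ge0|apply Habs; lra]. }
    lra.
Qed.

Lemma trunc_mass_growth R0 s t : 0 < R0 -> t0 < s <= t ->
  trunc_mass R0 t <= trunc_mass R0 s + 576 / R0 ^ 3 * (t - s).
Proof.
  intros HR Hst.
  apply (mvt_le (trunc_mass R0)
    (fun t => RInt (fun x => J1 (D t x) * Dt t x * cutoff R0 x) (- R0) R0)); [lra| |].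
  - intros r Hr; apply is_derive_trunc_mass; lra.
  - intros r Hr; apply trunc_mass_derive_le; lra.
Qed.

(** Near [x] the value of [J (D t y)] stays above half of [J (D t x)], and once [R0] is twice as far
    out the cut-off there is at least [(3/4)^4]; so one bound serves all large windows. *)
Lemma trunc_mass_lower t x : t0 < t -> 0 < D t x ->
  exists c, 0 < c /\ exists R1, 0 < R1 /\ forall R0, R1 <= R0 -> c <= trunc_mass R0 t.
Proof.
  intros Ht Hx.
  assert (cJ : continuous (fun y => J (D t y)) x).
  { apply (cont_comp (fun y => D t y) J).
    eapply cont_is_derive, (c12_x _ _ _ _ _ HD); exact Ht. eapply cont_is_derive, is_derive_J. }
  pose proof (J_pos _ Hx) as HJ.
  apply continuity_pt_filterlim in cJ.
  destruct (cJ (J (D t x) / 2)) as [d [Hd Hb]]; [lra|].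
  exists (J (D t x) / 2 * (3 / 4) ^ 4 * (d / 2)); split.
  { apply Rmult_lt_0_compat; [|lra]; apply Rmult_lt_0_compat; [lra|apply pow_lt; lra]. }
  exists (2 * (Rabs x + d)); pose proof (Rabs_pos x); split; [lra|].
  intros R0 HR.
  assert (Hxb : - Rabs x <= x <= Rabs x) by (apply Rabs_le_between; lra).
  assert (HR0 : 0 < R0) by lra.
  unfold trunc_mass.
  assert (exI : forall a b, ex_RInt (fun x => J (D t x) * cutoff R0 x) a b)
    by (intros; apply ex_RInt_cont; intros; apply continuous_J_cutoff; auto).
  assert (pos : forall y, - R0 <= y <= R0 -> 0 <= J (D t y) * cutoff R0 y).
  { intros; apply Rmult_le_pos; [apply J_ge0|apply cutoff_bounds; auto]. }
  rewrite <- (RInt_Chasles _ (- R0) x R0), <- (RInt_Chasles _ x (x + d / 2) R0) by auto.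
  unfold plus; simpl.
  assert (0 <= RInt (fun x => J (D t x) * cutoff R0 x) (- R0) x)
    by (apply RInt_ge_0; auto; [lra|intros; apply pos; lra]).
  assert (0 <= RInt (fun x => J (D t x) * cutoff R0 x) (x + d / 2) R0)
    by (apply RInt_ge_0; auto; [lra|intros; apply pos; lra]).
  assert (J (D t x) / 2 * (3 / 4) ^ 4 * (d / 2) <=
          RInt (fun x => J (D t x) * cutoff R0 x) x (x + d / 2)).
  { replace (J (D t x) / 2 * (3 / 4) ^ 4 * (d / 2))
      with (RInt (fun _ => J (D t x) / 2 * (3 / 4) ^ 4) x (x + d / 2))
      by (rewrite RInt_const_R; Req; ring).
    apply RInt_le; auto; [lra|apply ex_RInt_cont; intros; apply cont_const|].
    intros y Hy; apply Rmult_le_compat; [lra|apply pow_le; lra| |].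
    - destruct (Req_dec x y) as [->|n]; [lra|].
      assert (Hy' : Rabs (J (D t y) - J (D t x)) < J (D t x) / 2).
      { apply Hb; split; [split; [exact I|exact n]|].
        unfold dist; simpl; unfold R_dist; rewrite Rabs_pos_eq; lra. }
      apply Rabs_def2 in Hy'; lra.
    - unfold cutoff; apply pow_incr; split; [lra|].
      assert ((y / R0) ^ 2 <= (1 / 2) ^ 2); [|lra].
      apply pow_maj_Rabs.
      unfold Rdiv; rewrite Rabs_mult, (Rabs_pos_eq (/ R0)) by (left; apply Rinv_0_lt_compat; lra).
      apply Rmult_le_reg_r with R0; [lra|]; rewrite Rmult_assoc, Rinv_l by lra.
      assert (Rabs y <= Rabs x + d) by (apply Rabs_le; lra); lra. }
  lra.
Qed.

(** Positivity of [D] at one point costs a fixed mass, while the mass inherited from time [s] is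
    small and the growth rate [576/R0^3] vanishes as the window widens. The time [s] may depend on
    the window, which is all that a weak initial trace can offer. *)
Lemma comparison_limit t : t0 < t ->
  (forall R0 eta, 0 < R0 -> 0 < eta -> exists s, t0 < s <= t /\ trunc_mass R0 s <= eta) ->
  forall x, D t x <= 0.
Proof.
  intros Ht Hs x; apply Rnot_lt_le; intros Hx.
  destruct (trunc_mass_lower t x Ht Hx) as (c & Hc & R1 & HR1 & Hl).
  (* This [R0] keeps the growth below [c/2]; with at most [c/4] inherited, the total stays below
     [c]. *)
  set (R0 := Rmax R1 (Rmax 1 (1152 * (t - t0) / c + 1))).
  assert (h1 : R1 <= R0) by apply Rmax_l.
  assert (h2 : 1 <= R0) by (eapply Rle_trans; [apply Rmax_l|apply Rmax_r]).
  assert (h3 : 1152 * (t - t0) / c + 1 <= R0) by (eapply Rle_trans; [apply Rmax_r|apply Rmax_r]).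
  destruct (Hs R0 (c / 4)) as (s & Hst & Hm); [lra|lra|].
  pose proof (trunc_mass_growth R0 s t ltac:(lra) Hst) as Hg.
  specialize (Hl R0 h1).
  assert (576 / R0 ^ 3 * (t - s) <= c / 2); [|lra].
  apply Rle_trans with (576 / R0 * (t - t0)).
  - apply Rmult_le_compat; [apply Rlt_le, Rdiv_lt_0_compat; [lra|apply pow_lt; lra]|lra| |lra].
    apply Rmult_le_compat_l; [lra|]; apply Rinv_le_contravar; [lra|].
    assert (1 <= R0 ^ 2) by nra; simpl; nra.
  - assert (1152 * (t - t0) <= R0 * c).
    { apply Rmult_le_reg_r with (/ c); [apply Rinv_0_lt_compat; lra|].
      replace (R0 * c * / c) with R0 by (field; lra); unfold Rdiv in h3; lra. }
    apply Rmult_le_reg_r with R0; [lra|].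
    replace (576 / R0 * (t - t0) * R0) with (576 * (t - t0)) by (field; lra); lra.
Qed.

Lemma comparison_from s t : t0 < s <= t -> (forall x, D s x <= 0) -> forall x, D t x <= 0.
Proof.
  intros Hst Hs; apply comparison_limit; [lra|].
  intros R0 eta HR He; exists s; split; [lra|].
  unfold trunc_mass.
  rewrite (RInt_ext _ (fun _ => 0)); [rewrite RInt_const_R; lra|].
  intros x _; rewrite J_nonpos by apply Hs; Req; ring.
Qed.
End Core.

(* Multiplying by [exp (- B t / 2)] manufactures the absorption term. *)
Lemma comparison_bounded t0 D Dt Dx Dxx B : C12 t0 D Dt Dx Dxx -> 0 <= t0 -> 0 <= B ->
  (forall t x, t0 < t -> D t x <= B) ->
  (forall t x, t0 < t -> 0 < D t x -> Dt t x <= / 2 * Dxx t x) ->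
  forall s t, t0 < s <= t -> (forall x, D s x <= 0) -> forall x, D t x <= 0.
Proof.
  intros HD Ht0 HB Hb Hsub s t Hst Hs x.
  pose (w := fun t => exp (- (B / 2) * t)).
  assert (Hw : C12 t0 (fun t x => w t * D t x)
     (fun t x => (- (B / 2) * w t) * D t x + w t * Dt t x)
     (fun t x => w t * Dx t x) (fun t x => w t * Dxx t x)).
  { apply (C12_mult_time t0 w (fun t => - (B / 2) * w t)); auto.
    - intros; unfold w; auto_derive; [exact I|ring].
    - intros; apply cont_ex_derive; unfold w; auto_derive; exact I. }
  assert (wp : forall t, 0 < w t) by (intros; apply exp_pos).
  assert (K : w t * D t x <= 0).
  { apply (comparison_from _ _ _ _ _ Hw) with s; auto.
    - intros r y Hr Hp.
      assert (hD : 0 < D r y) by (apply Rmult_lt_reg_l with (w r); [apply wp|lra]).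
      specialize (Hsub r y Hr hD); specialize (Hb r y Hr); specialize (wp r).
      assert (w1 : w r <= 1).
      { unfold w; rewrite <- exp_0; destruct (Req_dec (- (B / 2) * r) 0) as [->|n]; [lra|].
        left; apply exp_increasing; assert (0 <= B / 2 * r) by (apply Rmult_le_pos; lra); lra. }
      assert (w r * Dt r y <= w r * (/ 2 * Dxx r y)) by (apply Rmult_le_compat_l; lra).
      assert (w r * D r y * D r y <= D r y * B * w r).
      { replace (D r y * B * w r) with (w r * D r y * B) by ring.
        apply Rmult_le_compat_l; lra. }
      assert (w r * D r y * (w r * D r y) <= w r * D r y * (1 * D r y)).
      { apply Rmult_le_compat_l; [lra|]; apply Rmult_le_compat_r; lra. }
      nra.
    - intros y; specialize (Hs y); specialize (wp s); nra. }
  specialize (wp t); nra.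
Qed.

(** * The heat kernel bound *)

Definition gint (A : R) : R := RInt (fun z => exp (- z ^ 2 / 2)) (- A) A.

Lemma continuous_gaussian z : continuous (fun z => exp (- z ^ 2 / 2)) z.
Proof. apply cont_ex_derive; auto_derive; exact I. Qed.

Lemma gint_incr A B : 0 <= A <= B -> gint A <= gint B.
Proof.
  intros H; unfold gint.
  assert (ex : forall a b, ex_RInt (fun z => exp (- z ^ 2 / 2)) a b)
    by (intros; apply ex_RInt_cont, continuous_gaussian).
  rewrite <- (RInt_Chasles _ (- B) (- A) B), <- (RInt_Chasles _ (- A) A B) by auto.
  unfold plus; simpl.
  assert (0 <= RInt (fun z => exp (- z ^ 2 / 2)) (- B) (- A))
    by (apply RInt_ge_0; auto; [lra|intros; apply Rlt_le, exp_pos]).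
  assert (0 <= RInt (fun z => exp (- z ^ 2 / 2)) A B)
    by (apply RInt_ge_0; auto; [lra|intros; apply Rlt_le, exp_pos]).
  simpl in *; lra.
Qed.

Lemma gint_bounded A : 0 <= A -> gint A <= 2 * PI.
Proof.
  intros HA; unfold gint.
  apply Rle_trans with (RInt (fun z => 2 / (1 + z ^ 2)) (- A) A).
  - apply RInt_le; [lra|apply ex_RInt_cont, continuous_gaussian| |].
    + apply ex_RInt_cont; intros z; apply cont_ex_derive; auto_derive; nra.
    + intros z _.
      replace (- z ^ 2 / 2) with (- (z ^ 2 / 2)) by field; rewrite exp_Ropp.
      replace (2 / (1 + z ^ 2)) with (/ ((1 + z ^ 2) / 2)) by (field; nra).
      apply Rinv_le_contravar; [nra|].
      pose proof (exp_ineq1_le (z ^ 2 / 2)); nra.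
  - rewrite (is_RInt_unique _ _ _ (2 * atan A - 2 * atan (- A))).
    + pose proof (atan_bound A); pose proof (atan_bound (- A)); lra.
    + apply (is_RInt_derive (V := R_CompleteNormedModule) (fun z => 2 * atan z)).
      * intros z _; auto_derive; [exact I|]; field; nra.
      * intros z _; apply cont_ex_derive; auto_derive; nra.
Qed.

Definition gint_values (v : R) : Prop := exists A, 0 <= A /\ v = gint A.

Lemma gint_values_bound : bound gint_values.
Proof. exists (2 * PI); intros v [A [HA ->]]; apply gint_bounded; exact HA. Qed.

Lemma gint_values_ex : exists v, gint_values v.
Proof. exists (gint 0), 0; split; [lra|reflexivity]. Qed.

(* Equal to [sqrt (2 * PI)], but only its being the supremum matters. *)
Definition gmass : R := proj1_sig (completeness gint_values gint_values_bound gint_values_ex).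

Lemma gmass_lub : is_lub gint_values gmass.
Proof. exact (proj2_sig (completeness gint_values gint_values_bound gint_values_ex)). Qed.

Lemma gmass_ub A : 0 <= A -> gint A <= gmass.
Proof.
  intros HA; apply (proj1 gmass_lub); exists A; auto.
Qed.

Lemma gmass_approx eta : 0 < eta -> exists A, 0 < A /\ gmass - eta < gint A.
Proof.
  intros He; destruct gmass_lub as [_ Hl]; set (c := gmass) in *.
  destruct (Rlt_dec (c - eta) (gint 1)) as [h|h]; [exists 1; lra|].
  apply Rnot_lt_le in h.
  destruct (Classical_Prop.classic (exists A, 0 <= A /\ c - eta < gint A)) as [[A [HA H]]|N].
  - exists (A + 1); split; [lra|].
    eapply Rlt_le_trans; [exact H|apply gint_incr; lra].
  - exfalso; assert (c <= c - eta); [|lra].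
    apply Hl; intros v [A [HA ->]]; apply Rnot_lt_le; intros h'; apply N; eauto.
Qed.

Lemma gmass_pos : 0 < gmass.
Proof.
  apply Rlt_le_trans with (gint 1); [|apply gmass_ub; lra].
  unfold gint; apply RInt_gt_0; [lra|intros; apply exp_pos|intros; apply continuous_gaussian].
Qed.

Definition heat (t x : R) : R := exp (- x ^ 2 / (2 * t)) / (gmass * sqrt t).

Lemma heat_pos t x : 0 < t -> 0 < heat t x.
Proof.
  intros; apply Rdiv_lt_0_compat; [apply exp_pos|].
  apply Rmult_lt_0_compat; [apply gmass_pos|apply sqrt_lt_R0; lra].
Qed.

Lemma RInt_gaussian_scaled t x0 d : 0 < t ->
  RInt (fun y => exp (- (y - x0) ^ 2 / (2 * t)) / sqrt t) (x0 - d) (x0 + d) = gint (d / sqrt t).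
Proof.
  intros Ht; pose proof (sqrt_lt_R0 t Ht) as Hs.
  unfold gint.
  pose proof (RInt_comp_lin (V := R_CompleteNormedModule) (fun z => exp (- z ^ 2 / 2))
    (/ sqrt t) (- x0 / sqrt t) (x0 - d) (x0 + d)) as H.
  replace (- (d / sqrt t)) with (/ sqrt t * (x0 - d) + - x0 / sqrt t) by (field; lra).
  replace (d / sqrt t) with (/ sqrt t * (x0 + d) + - x0 / sqrt t) by (field; lra).
  rewrite <- H; [|apply ex_RInt_cont, continuous_gaussian].
  apply RInt_ext; intros y _; unfold scal; simpl; unfold mult; simpl.
  assert (E : - (y - x0) ^ 2 / (2 * t) = - (/ sqrt t * y + - x0 / sqrt t) ^ 2 / 2).
  { rewrite <- (sqrt_sqrt t) at 1 by lra; field; lra. }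
  simpl in E; rewrite E; Req; field; lra.
Qed.

Lemma heat_cutoff_mass t R0 : 0 < t -> 0 < R0 ->
  RInt (fun x => heat t x * cutoff R0 x) (- R0) R0 <= 1.
Proof.
  intros Ht HR; pose proof (sqrt_lt_R0 t Ht) as Hs; pose proof gmass_pos as Hg.
  assert (c1 : forall x, continuous (fun y => heat t y) x)
    by (intros; apply cont_ex_derive; unfold heat; auto_derive;
        assert (0 < gmass * sqrt t) by (apply Rmult_lt_0_compat; lra); split; lra).
  apply Rle_trans with (RInt (fun x => heat t x) (- R0) R0).
  - apply RInt_le; [lra| |apply ex_RInt_cont; auto|].
    + apply ex_RInt_cont; intros; apply cont_mult; auto.
      eapply cont_is_derive, is_derive_cutoff; exact HR.
    + intros x Hx; pose proof (cutoff_bounds R0 x HR ltac:(lra)).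
      pose proof (heat_pos t x Ht); nra.
  - rewrite (RInt_ext _ (fun x => / gmass * (exp (- (x - 0) ^ 2 / (2 * t)) / sqrt t))).
    2: { intros x _; unfold heat; rewrite Rminus_0_r; Req; field; lra. }
    rewrite RInt_scal_R.
    2: { apply ex_RInt_cont; intros; apply cont_ex_derive; auto_derive; lra. }
    replace (- R0) with (0 - R0) by ring; replace R0 with (0 + R0) at 2 by ring.
    rewrite RInt_gaussian_scaled by exact Ht.
    apply Rmult_le_reg_l with gmass; [exact Hg|].
    rewrite <- Rmult_assoc, Rinv_r, Rmult_1_l, Rmult_1_r by lra.
    apply gmass_ub; apply Rlt_le, Rdiv_lt_0_compat; lra.
Qed.

(** [cutoff] is positive beyond [R0], hence not an admissible test function for
    [initial_trace_delta]; taking the positive part before the power gives compact support and keeps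
    continuity. *)
Definition cutoff_ext (R0 x : R) : R := Rmax 0 (1 - (x / R0) ^ 2) ^ 4.

Lemma cutoff_ext_eq R0 x : 0 < R0 -> - R0 <= x <= R0 -> cutoff_ext R0 x = cutoff R0 x.
Proof.
  intros HR Hx; pose proof (cutoff_arg R0 x HR Hx).
  unfold cutoff_ext, cutoff; rewrite Rmax_right by lra; reflexivity.
Qed.

Lemma cutoff_ext_out R0 x : 0 < R0 -> R0 < Rabs x -> cutoff_ext R0 x = 0.
Proof.
  intros HR Hx; unfold cutoff_ext; rewrite Rmax_left; [ring|].
  assert (1 ^ 2 <= (x / R0) ^ 2); [|lra].
  rewrite <- (pow2_abs (x / R0)); apply pow_incr; split; [lra|].
  unfold Rdiv; rewrite Rabs_mult, (Rabs_pos_eq (/ R0)) by (left; apply Rinv_0_lt_compat; lra).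
  apply Rmult_le_reg_r with R0; [lra|]; rewrite Rmult_assoc, Rinv_l by lra; lra.
Qed.

Lemma continuous_cutoff_ext R0 x : 0 < R0 -> continuous (cutoff_ext R0) x.
Proof.
  intros HR; unfold cutoff_ext; apply cont_pow.
  apply (continuous_ext (fun x => ((1 - (x / R0) ^ 2) + Rabs (1 - (x / R0) ^ 2)) * / 2)).
  - intros y; Req; unfold Rmax; destruct (Rle_dec 0 (1 - (y / R0) ^ 2)).
    rewrite Rabs_pos_eq; lra. rewrite Rabs_left; lra.
  - assert (c : continuous (fun x => 1 - (x / R0) ^ 2) x)
      by (apply cont_ex_derive; auto_derive; lra).
    apply cont_mult; [|apply cont_const]; apply cont_plus; [exact c|].
    apply (cont_comp (fun x => 1 - (x / R0) ^ 2) Rabs); [exact c|].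
    apply continuity_pt_filterlim, Rcontinuity_abs.
Qed.

(** The working form of [is_V_lambda]: the derivatives are existential witnesses, so that a rescaled
    or reflected solution can bring its own. *)
Definition Vsol (V : R -> R -> R) (lam : R) : Prop :=
  exists Vt Vx Vxx, C12 0 V Vt Vx Vxx /\ (forall t x, 0 < t -> 0 <= V t x) /\
    (forall t x, 0 < t -> Vt t x = / 2 * Vxx t x - / 2 * V t x ^ 2) /\
    initial_trace_delta V lam.

Lemma trace_cutoff V lam q R0 : initial_trace_delta V lam -> 0 < R0 ->
  (forall x, continuous q x) ->
  filterlim (fun t => RInt (fun x => V t x * (q x * cutoff R0 x)) (- R0) R0) (at_right 0)
    (locally (lam * q 0)).
Proof.
  intros HV HR Hq.
  replace (lam * q 0) with (lam * (q 0 * cutoff_ext R0 0)).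
  2: { rewrite cutoff_ext_eq by lra; unfold cutoff; field; lra. }
  eapply filterlim_ext; [|apply (HV (fun x => q x * cutoff_ext R0 x) R0)].
  - intros t; apply RInt_ext; intros x Hx.
    rewrite Rmin_left, Rmax_right in Hx by lra.
    rewrite cutoff_ext_eq by lra; reflexivity.
  - intros x; apply cont_mult; [apply Hq|apply continuous_cutoff_ext; exact HR].
  - intros x Hx; rewrite cutoff_ext_out by lra; ring.
Qed.

(** * Testing against the backward heat kernel *)

Definition kern (x0 T s y : R) : R := exp (- (y - x0) ^ 2 / (2 * (T - s))) / sqrt (T - s).
Definition kern1 (x0 T s y : R) : R := - (y - x0) / (T - s) * kern x0 T s y.
Definition kern2 (x0 T s y : R) : R :=
  ((y - x0) ^ 2 / (T - s) ^ 2 - / (T - s)) * kern x0 T s y.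

Lemma is_derive_kern x0 T s y : s < T -> is_derive (fun y => kern x0 T s y) y (kern1 x0 T s y).
Proof.
  intros H; pose proof (sqrt_lt_R0 (T - s) ltac:(lra)).
  assert (h : 0 < T - s) by lra; revert H0 h.
  unfold kern1, kern; generalize (T - s); intros tau w h.
  auto_derive; [lra|]; replace (y + - x0) with (y - x0) by ring; unfold Rdiv; simpl; field; split; lra.
Qed.

Lemma is_derive_kern1 x0 T s y : s < T -> is_derive (fun y => kern1 x0 T s y) y (kern2 x0 T s y).
Proof.
  intros H; pose proof (sqrt_lt_R0 (T - s) ltac:(lra)).
  assert (h : 0 < T - s) by lra; revert H0 h.
  unfold kern1, kern2, kern; generalize (T - s); intros tau w h.
  auto_derive; [lra|]; replace (y + - x0) with (y - x0) by ring; unfold Rdiv; simpl; field; split; lra.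
Qed.

(** [kern] is, up to a constant, the backward heat kernel with pole at time [T] and place [x0], so
    diffusion cancels when it is paired with [V]. *)
Lemma is_derive_kern_time x0 T s y : s < T ->
  is_derive (fun s => kern x0 T s y) s (- / 2 * kern2 x0 T s y).
Proof.
  intros H; pose proof (sqrt_lt_R0 (T - s) ltac:(lra)).
  unfold kern2, kern; auto_derive; [change (T + - s) with (T - s); repeat split; lra|].
  replace (T + - s) with (T - s) by ring.
  replace (y + - x0) with (y - x0) by ring.
  unfold Rdiv; simpl.
  assert (E : sqrt (T - s) * sqrt (T - s) = T - s) by (apply sqrt_sqrt; lra).
  set (w := sqrt (T - s)) in *; set (e := exp _).
  rewrite <- E; field; lra.
Qed.

(** The analogue of [cutoff_young] for the product of [kern] and [cutoff]. The cross term brings an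
    unbounded factor, controlled by [(y - x0)^2/(T - s)], whose square the Gaussian in [kern]
    absorbs; the constant depends on [eps] but still carries [R0^-4]. *)
Lemma kern_young x0 T s y R0 eps j : 0 < R0 -> - R0 <= y <= R0 -> 0 < eps <= T - s ->
  / 2 * j * (2 * kern1 x0 T s y * cutoff1 R0 y + kern x0 T s y * cutoff2 R0 y)
    - / 2 * j ^ 2 * (kern x0 T s y * cutoff R0 y)
  <= (176 + 16 * x0 ^ 2 / eps) ^ 2 / sqrt eps / (8 * R0 ^ 4).
Proof.
  intros HR Hy [He Ht]; pose proof (cutoff_arg R0 y HR Hy) as [z0 z1].
  assert (Hse : 0 < sqrt eps) by (apply sqrt_lt_R0; lra).
  set (tau := T - s) in *.
  assert (Hst : sqrt eps <= sqrt tau) by (apply sqrt_le_1; lra).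
  set (d := y - x0); set (v := d ^ 2 / tau).
  assert (Hv : 0 <= v) by (apply Rdiv_le_0_compat; [apply pow2_ge_0|lra]).
  set (k := kern x0 T s y).
  assert (Hk : 0 < k) by (apply Rdiv_lt_0_compat; [apply exp_pos|fold tau; lra]).
  assert (Ek : k = / (exp (v / 4)) ^ 2 / sqrt tau).
  { unfold k, kern; fold tau; fold d; f_equal.
    replace (- d ^ 2 / (2 * tau)) with (- (v / 4 + v / 4)) by (unfold v; field; lra).
    rewrite exp_Ropp, exp_plus; f_equal; ring. }
  set (u := 1 - (y / R0) ^ 2).
  set (a := 16 * y * d / tau * u + (48 * (y / R0) ^ 2 - 8 * u)).
  assert (E1 : 2 * kern1 x0 T s y * cutoff1 R0 y + k * cutoff2 R0 y = k * u ^ 2 * a * / R0 ^ 2).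
  { unfold kern1, cutoff1, cutoff2; fold k; fold tau; fold d; fold u; unfold a; field; lra. }
  fold k; rewrite E1.
  (* [176 = 48 + 4 * 32]: the part [48 + 32 v] of the bound on [a] is compared with [1 + v/4], hence
     with [exp (v/4)], whose square [k] cancels. *)
  set (K1 := 176 + 16 * x0 ^ 2 / eps).
  assert (Ha : Rabs a <= K1 * exp (v / 4)).
  { assert (Hyd : Rabs (y * d) <= 2 * d ^ 2 + x0 ^ 2).
    { replace y with (d + x0) by (unfold d; ring).
      pose proof (pow2_ge_0 (d + x0)); pose proof (pow2_ge_0 (d - x0));
      pose proof (pow2_ge_0 d); pose proof (pow2_ge_0 x0); apply Rabs_le; lra. }
    assert (h1 : Rabs (16 * y * d / tau * u) <= 32 * v + 16 * x0 ^ 2 / eps).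
    { replace (16 * y * d / tau * u) with (16 / tau * (y * d) * u) by (field; lra).
      rewrite Rabs_mult, (Rabs_pos_eq u) by (unfold u; lra).
      rewrite Rabs_mult, (Rabs_pos_eq (16 / tau)) by (apply Rlt_le, Rdiv_lt_0_compat; lra).
      apply Rle_trans with (16 / tau * (2 * d ^ 2 + x0 ^ 2) * 1).
      - apply Rmult_le_compat; [|unfold u; lra| |unfold u; lra].
        apply Rmult_le_pos; [apply Rlt_le, Rdiv_lt_0_compat; lra|apply Rabs_pos].
        apply Rmult_le_compat_l; [apply Rlt_le, Rdiv_lt_0_compat; lra|exact Hyd].
      - replace (16 / tau * (2 * d ^ 2 + x0 ^ 2) * 1) with (32 * v + 16 * x0 ^ 2 * / tau)
          by (unfold v; field; lra).
        apply Rplus_le_compat_l; apply Rmult_le_compat_l; [pose proof (pow2_ge_0 x0); lra|].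
        apply Rinv_le_contravar; lra. }
    assert (h2 : Rabs (48 * (y / R0) ^ 2 - 8 * u) <= 48) by (apply Rabs_le; unfold u; lra).
    pose proof (Rabs_triang (16 * y * d / tau * u) (48 * (y / R0) ^ 2 - 8 * u)) as h3.
    fold a in h3.
    pose proof (exp_ineq1_le (v / 4)).
    assert (0 <= 16 * x0 ^ 2 / eps)
      by (apply Rdiv_le_0_compat; [pose proof (pow2_ge_0 x0); lra|lra]).
    assert (K1 * (1 + v / 4) <= K1 * exp (v / 4)) by (apply Rmult_le_compat_l; unfold K1; lra).
    unfold K1 in *; nra. }
  assert (Ha2 : a ^ 2 * k <= K1 ^ 2 / sqrt eps).
  { rewrite Ek; pose proof (exp_pos (v / 4)) as Hp.
    assert (a ^ 2 <= (K1 * exp (v / 4)) ^ 2) by (apply pow_maj_Rabs; exact Ha).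
    apply Rle_trans with ((K1 * exp (v / 4)) ^ 2 * (/ exp (v / 4) ^ 2 / sqrt tau)).
    - apply Rmult_le_compat_r; [rewrite <- Ek; lra|assumption].
    - replace ((K1 * exp (v / 4)) ^ 2 * (/ exp (v / 4) ^ 2 / sqrt tau)) with (K1 ^ 2 * / sqrt tau)
        by (field; split; lra).
      apply Rmult_le_compat_l; [apply pow2_ge_0|apply Rinv_le_contravar; lra]. }
  set (i := / R0 ^ 2).
  assert (Hi : 0 < i) by (apply Rinv_0_lt_compat, pow_lt; lra).
  replace (K1 ^ 2 / sqrt eps / (8 * R0 ^ 4)) with (/ 8 * (K1 ^ 2 / sqrt eps) * i ^ 2)
    by (unfold i; field; split; lra).
  replace (cutoff R0 y) with (u ^ 4) by reflexivity.
  assert (/ 8 * (a ^ 2 * k) * i ^ 2 <= / 8 * (K1 ^ 2 / sqrt eps) * i ^ 2)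
    by (apply Rmult_le_compat_r; [apply pow2_ge_0|lra]).
  assert (0 <= k * (j * u ^ 2 - / 2 * a * i) ^ 2)
    by (apply Rmult_le_pos; [lra|apply pow2_ge_0]).
  nra.
Qed.

Lemma continuity_2d_div (f g : R -> R -> R) t x :
  continuity_2d_pt f t x -> continuity_2d_pt g t x -> g t x <> 0 ->
  continuity_2d_pt (fun s y => f s y / g s y) t x.
Proof. intros; apply continuity_2d_pt_mult; [|apply continuity_2d_pt_inv]; auto. Qed.

Lemma continuity_2d_pow (f : R -> R -> R) n t x :
  continuity_2d_pt f t x -> continuity_2d_pt (fun s y => f s y ^ n) t x.
Proof.
  intros; apply (continuity_2d_comp (fun z => z ^ n) f); auto.
  apply cont_pow, cont_id.
Qed.

Lemma continuity_2d_exp (f : R -> R -> R) t x :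
  continuity_2d_pt f t x -> continuity_2d_pt (fun s y => exp (f s y)) t x.
Proof. intros; apply (continuity_2d_comp exp f); auto; apply (cont_exp (fun z => z)), cont_id. Qed.

Lemma continuity_2d_sqrt (f : R -> R -> R) t x : 0 < f t x ->
  continuity_2d_pt f t x -> continuity_2d_pt (fun s y => sqrt (f s y)) t x.
Proof.
  intros Hp H; apply (continuity_2d_comp sqrt f); auto.
  apply cont_ex_derive; auto_derive; exact Hp.
Qed.

Lemma continuity_2d_kern x0 T s y : s < T -> continuity_2d_pt (kern x0 T) s y.
Proof.
  intros H; assert (0 < sqrt (T - s)) by (apply sqrt_lt_R0; lra).
  assert (c : continuity_2d_pt (fun u _ : R => T - u) s y)
    by (apply continuity_2d_pt_minus; [apply continuity_2d_pt_const|apply continuity_2d_pt_id1]).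
  apply (continuity_2d_div (fun s y => exp (- (y - x0) ^ 2 / (2 * (T - s)))) (fun s _ => sqrt (T - s)));
    [|apply (continuity_2d_sqrt (fun s _ => T - s)); [lra|exact c]|lra].
  apply continuity_2d_exp.
  apply (continuity_2d_div (fun _ y => - (y - x0) ^ 2) (fun s _ => 2 * (T - s))); [| |lra].
  - apply continuity_2d_pt_opp, (continuity_2d_pow (fun _ y => y - x0)).
    apply continuity_2d_pt_minus; [apply continuity_2d_pt_id2|apply continuity_2d_pt_const].
  - apply continuity_2d_pt_mult; [apply continuity_2d_pt_const|exact c].
Qed.

Lemma continuity_2d_kern2 x0 T s y : s < T -> continuity_2d_pt (kern2 x0 T) s y.
Proof.
  intros H.
  assert (c : continuity_2d_pt (fun u _ : R => T - u) s y)
    by (apply continuity_2d_pt_minus; [apply continuity_2d_pt_const|apply continuity_2d_pt_id1]).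
  apply (continuity_2d_pt_mult (fun s y => (y - x0) ^ 2 / (T - s) ^ 2 - / (T - s)) (kern x0 T));
    [|apply continuity_2d_kern; exact H].
  apply continuity_2d_pt_minus; [|apply (continuity_2d_pt_inv (fun s _ => T - s)); [exact c|lra]].
  apply (continuity_2d_div (fun _ y => (y - x0) ^ 2) (fun s _ => (T - s) ^ 2)).
  - apply (continuity_2d_pow (fun _ y => y - x0)).
    apply continuity_2d_pt_minus; [apply continuity_2d_pt_id2|apply continuity_2d_pt_const].
  - apply (continuity_2d_pow (fun s _ => T - s)); exact c.
  - apply pow_nonzero; lra.
Qed.

Lemma continuity_2d_cutoff R0 s y : 0 < R0 -> continuity_2d_pt (fun _ y => cutoff R0 y) s y.
Proof.
  intros; apply (continuity_2d_comp (cutoff R0) (fun _ y => y)); [|apply continuity_2d_pt_id2].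
  eapply cont_is_derive, is_derive_cutoff; assumption.
Qed.

(** Removes the cut-off at the end of an estimate, [r] being the size of the window. *)
Lemma le_of_le_plus_div (a Y C R1 : R) : (forall r, R1 <= r -> 0 < r -> a <= Y + C / r) -> a <= Y.
Proof.
  intros H; apply Rnot_lt_le; intros h.
  set (r := Rmax R1 (Rmax 1 (2 * Rabs C / (a - Y)))).
  assert (h1 : R1 <= r) by apply Rmax_l.
  assert (h2 : 1 <= r) by (eapply Rle_trans; [apply Rmax_l|apply Rmax_r]).
  assert (h3 : 2 * Rabs C / (a - Y) <= r) by (eapply Rle_trans; [apply Rmax_r|apply Rmax_r]).
  specialize (H r h1 ltac:(lra)).
  assert (Rabs C <= r * ((a - Y) / 2)).
  { apply Rmult_le_reg_r with (2 / (a - Y)); [apply Rdiv_lt_0_compat; lra|].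
    replace (r * ((a - Y) / 2) * (2 / (a - Y))) with r by (field; lra).
    replace (Rabs C * (2 / (a - Y))) with (2 * Rabs C / (a - Y)) by (field; lra); lra. }
  assert (C / r <= (a - Y) / 2); [|lra].
  apply Rmult_le_reg_r with r; [lra|]; unfold Rdiv at 1; rewrite Rmult_assoc, Rinv_l by lra.
  pose proof (Rle_abs C); lra.
Qed.

Section HK.
Variables (V Vt Vx Vxx : R -> R -> R) (lam : R).
Hypothesis HC : C12 0 V Vt Vx Vxx.
Hypothesis Hpos : forall t x, 0 < t -> 0 <= V t x.
Hypothesis Hpde : forall t x, 0 < t -> Vt t x = / 2 * Vxx t x - / 2 * V t x ^ 2.
Hypothesis Htr : initial_trace_delta V lam.

Definition dual (x0 T R0 s : R) : R :=
  RInt (fun y => V s y * (kern x0 T s y * cutoff R0 y)) (- R0) R0.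

Lemma continuous_kern x0 T s y : s < T -> continuous (fun y => kern x0 T s y) y.
Proof. intros; eapply cont_is_derive, is_derive_kern; assumption. Qed.

Lemma continuous_V t x : 0 < t -> continuous (fun y => V t y) x.
Proof. intros; eapply cont_is_derive, (c12_x _ _ _ _ _ HC); assumption. Qed.

Lemma is_derive_dual x0 T R0 s : 0 < R0 -> 0 < s < T ->
  is_derive (dual x0 T R0) s
    (RInt (fun y => Vt s y * (kern x0 T s y * cutoff R0 y)
                    - / 2 * (V s y * (kern2 x0 T s y * cutoff R0 y))) (- R0) R0).
Proof.
  intros HR Hs.
  apply (is_derive_RInt_time 0 T (fun s y => V s y * (kern x0 T s y * cutoff R0 y))
     (fun s y => Vt s y * (kern x0 T s y * cutoff R0 y)
                    - / 2 * (V s y * (kern2 x0 T s y * cutoff R0 y)))); auto.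
  - intros r y Hr.
    apply (is_derive_ext (fun r => cutoff R0 y * (V r y * kern x0 T r y))).
    { intros; Req; ring. }
    evar_last.
    apply (is_derive_scal (fun r => V r y * kern x0 T r y) r (cutoff R0 y)).
    apply (is_derive_mult (K := R_AbsRing) (fun r => V r y) (fun r => kern x0 T r y)).
    apply (c12_t _ _ _ _ _ HC); lra. apply is_derive_kern_time; lra. intros; apply Rmult_comm.
    unfold plus, mult; simpl; ring.
  - intros r y Hr; apply continuity_2d_pt_minus; [|apply continuity_2d_pt_mult; [apply continuity_2d_pt_const|]];
      (apply continuity_2d_pt_mult; [|apply continuity_2d_pt_mult]).
    + apply (c12_cont_t _ _ _ _ _ HC); lra.
    + apply continuity_2d_kern; lra.
    + apply continuity_2d_cutoff; lra.
    + apply (c12_cont _ _ _ _ _ HC); lra.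
    + apply continuity_2d_kern2; lra.
    + apply continuity_2d_cutoff; lra.
  - intros r y Hr; apply cont_mult; [apply continuous_V; lra|]; apply cont_mult.
    apply continuous_kern; lra. eapply cont_is_derive, is_derive_cutoff; exact HR.
Qed.

(** After integration by parts only the terms where the cut-off is differentiated survive, together
    with the absorption, and [kern_young] applies. So the pairing is almost nonincreasing in
    time. *)
Lemma dual_derive_le x0 T R0 s eps : 0 < R0 -> 0 < s -> 0 < eps <= T - s ->
  RInt (fun y => Vt s y * (kern x0 T s y * cutoff R0 y)
                    - / 2 * (V s y * (kern2 x0 T s y * cutoff R0 y))) (- R0) R0
  <= (176 + 16 * x0 ^ 2 / eps) ^ 2 / sqrt eps / (4 * R0 ^ 3).
Proof.
  intros HR Hs He.
  assert (HsT : s < T) by lra.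
  assert (ck : forall y, continuous (fun y => kern x0 T s y) y) by (intros; apply continuous_kern; exact HsT).
  assert (ck1 : forall y, continuous (fun y => kern1 x0 T s y) y)
    by (intros; eapply cont_is_derive, is_derive_kern1; exact HsT).
  assert (ck2 : forall y, continuous (fun y => kern2 x0 T s y) y)
    by (intros; apply continuity_2d_snd, continuity_2d_kern2; exact HsT).
  assert (cV : forall y, continuous (fun y => V s y) y) by (intros; apply continuous_V; exact Hs).
  assert (cVt : forall x, continuous (fun y => Vt s y) x)
    by (intros; apply continuity_2d_snd, (c12_cont_t _ _ _ _ _ HC); exact Hs).
  assert (cVxx : forall x, continuous (fun y => Vxx s y) x)
    by (intros; apply (c12_cont_xx _ _ _ _ _ HC); exact Hs).
  assert (cc : forall x, continuous (cutoff R0) x)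
    by (intros; eapply cont_is_derive, is_derive_cutoff; exact HR).
  assert (cc1 : forall x, continuous (cutoff1 R0) x)
    by (intros; eapply cont_is_derive, is_derive_cutoff1; exact HR).
  assert (cc2 : forall x, continuous (cutoff2 R0) x)
    by (intros; apply continuous_cutoff2; exact HR).
  pose (q := fun y => kern x0 T s y * cutoff R0 y).
  pose (q1 := fun y => kern1 x0 T s y * cutoff R0 y + kern x0 T s y * cutoff1 R0 y).
  pose (q2 := fun y => kern2 x0 T s y * cutoff R0 y
     + (2 * kern1 x0 T s y * cutoff1 R0 y + kern x0 T s y * cutoff2 R0 y)).
  assert (cq : forall y, continuous q y) by (intros; apply cont_mult; auto).
  assert (cq2 : forall y, continuous q2 y).
  { intros; apply cont_plus; [apply cont_mult; auto|].
    apply cont_plus; [apply cont_mult; [apply cont_mult; [apply cont_const|]|]|apply cont_mult]; auto. }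
  destruct (cutoff_ends R0 HR) as (e1 & e2 & e3 & e4).
  assert (G : RInt (fun x => Vxx s x * q x - V s x * q2 x) (- R0) R0 = 0).
  { apply (RInt_green (fun x => V s x) (fun x => Vx s x) (fun x => Vxx s x) q q1 q2); auto.
    - intros x; apply (c12_x _ _ _ _ _ HC); exact Hs.
    - intros x; apply (c12_xx _ _ _ _ _ HC); exact Hs.
    - intros x; evar_last.
      apply (is_derive_mult (K := R_AbsRing) (fun y => kern x0 T s y) (cutoff R0)).
      apply is_derive_kern; exact HsT. apply is_derive_cutoff; exact HR. intros; apply Rmult_comm.
      reflexivity.
    - intros x; evar_last.
      apply (is_derive_plus (V := R_NormedModule) (fun y => kern1 x0 T s y * cutoff R0 y)
               (fun y => kern x0 T s y * cutoff1 R0 y)).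
      apply (is_derive_mult (K := R_AbsRing) (fun y => kern1 x0 T s y) (cutoff R0)).
      apply is_derive_kern1; exact HsT. apply is_derive_cutoff; exact HR. intros; apply Rmult_comm.
      apply (is_derive_mult (K := R_AbsRing) (fun y => kern x0 T s y) (cutoff1 R0)).
      apply is_derive_kern; exact HsT. apply is_derive_cutoff1; exact HR. intros; apply Rmult_comm.
      unfold q2, plus, mult; simpl; ring.
    - unfold q; rewrite e2; ring.
    - unfold q; rewrite e1; ring.
    - unfold q1; rewrite e2, e4; ring.
    - unfold q1; rewrite e1, e3; ring. }
  assert (c1 : forall x, continuous (fun y => Vt s y * (kern x0 T s y * cutoff R0 y)
                    - / 2 * (V s y * (kern2 x0 T s y * cutoff R0 y))) x).
  { intros x; apply cont_minus; [apply cont_mult; auto|].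
    apply cont_mult; [apply cont_const|]; apply cont_mult; auto; apply cont_mult; auto. }
  assert (c2 : forall x, continuous (fun x => Vxx s x * q x - V s x * q2 x) x)
    by (intros; apply cont_minus; apply cont_mult; auto).
  assert (ex1 : ex_RInt (fun y => Vt s y * (kern x0 T s y * cutoff R0 y)
    - / 2 * (V s y * (kern2 x0 T s y * cutoff R0 y))) (- R0) R0) by (apply ex_RInt_cont, c1).
  assert (ex2 : ex_RInt (fun x => Vxx s x * q x - V s x * q2 x) (- R0) R0)
    by (apply ex_RInt_cont, c2).
  pose proof (RInt_lin_minus _ _ (/ 2) _ _ ex1 ex2) as E; cbv beta in E.
  rewrite G, Rmult_0_r, Rminus_0_r in E; rewrite <- E.
  set (K := (176 + 16 * x0 ^ 2 / eps) ^ 2 / sqrt eps).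
  assert (0 < sqrt eps) by (apply sqrt_lt_R0; lra).
  replace (K / (4 * R0 ^ 3)) with (RInt (fun _ => K / (8 * R0 ^ 4)) (- R0) R0)
    by (rewrite RInt_const_R; Req; field; lra).
  apply RInt_le; [lra| |apply ex_RInt_cont; intros; apply cont_const|].
  - apply ex_RInt_cont; intros; apply cont_minus; [apply c1|].
    apply cont_mult; [apply cont_const|apply c2].
  - intros x Hx.
    eapply Rle_trans; [|apply (kern_young x0 T s x R0 eps (V s x) HR ltac:(lra) He)].
    rewrite (Hpde s x Hs); unfold q, q2; lra.
Qed.

Lemma dual_growth x0 T R0 s t eps : 0 < R0 -> 0 < s <= t -> 0 < eps -> t + eps <= T ->
  dual x0 T R0 t <= dual x0 T R0 s
    + (176 + 16 * x0 ^ 2 / eps) ^ 2 / sqrt eps / (4 * R0 ^ 3) * (t - s).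
Proof.
  intros HR Hst He HT.
  eapply mvt_le; [lra| |].
  - intros r Hr; apply is_derive_dual; lra.
  - intros r Hr; apply dual_derive_le; lra.
Qed.

(** Freezes the kernel at time 0: the trace can only be tested against a fixed function, and the
    factor tends to 1 as [s] tends to 0. *)
Lemma kern_time_le x0 T s y : 0 < s < T ->
  kern x0 T s y <= sqrt (T / (T - s)) * kern x0 T 0 y.
Proof.
  intros Hs; unfold kern; rewrite Rminus_0_r.
  rewrite sqrt_div_alt by lra.
  assert (0 < sqrt T) by (apply sqrt_lt_R0; lra).
  assert (0 < sqrt (T - s)) by (apply sqrt_lt_R0; lra).
  replace (sqrt T / sqrt (T - s) * (exp (- (y - x0) ^ 2 / (2 * T)) / sqrt T))
    with (exp (- (y - x0) ^ 2 / (2 * T)) / sqrt (T - s)) by (field; lra).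
  apply Rmult_le_compat_r; [left; apply Rinv_0_lt_compat; lra|].
  assert (h : - (y - x0) ^ 2 / (2 * (T - s)) <= - (y - x0) ^ 2 / (2 * T)).
  { assert (/ (2 * T) <= / (2 * (T - s))) by (apply Rinv_le_contravar; lra).
    pose proof (pow2_ge_0 (y - x0)); unfold Rdiv; nra. }
  destruct h as [h| ->]; [left; apply exp_increasing; exact h|lra].
Qed.

Lemma dual_trace_bound x0 t eps R0 : 0 < R0 -> 0 < t -> 0 < eps ->
  dual x0 (t + eps) R0 t <= lam * kern x0 (t + eps) 0 0
    + (176 + 16 * x0 ^ 2 / eps) ^ 2 / sqrt eps / (4 * R0 ^ 3) * t.
Proof.
  intros HR Ht He; set (T := t + eps).
  set (K := (176 + 16 * x0 ^ 2 / eps) ^ 2 / sqrt eps / (4 * R0 ^ 3)).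
  assert (HK : 0 <= K).
  { apply Rdiv_le_0_compat; [apply Rdiv_le_0_compat; [apply pow2_ge_0|apply sqrt_lt_R0; lra]|].
    assert (0 < R0 ^ 3) by (apply pow_lt; lra); lra. }
  assert (Hle : dual x0 T R0 t - K * t <= lam * kern x0 T 0 0); [|lra].
  pose (m := fun s => RInt (fun y => V s y * (kern x0 T 0 y * cutoff R0 y)) (- R0) R0).
  assert (L1 : filterlim m (at_right 0) (locally (lam * kern x0 T 0 0))).
  { apply (trace_cutoff V lam (fun y => kern x0 T 0 y) R0); auto.
    intros; apply continuous_kern; unfold T; lra. }
  assert (L2 : filterlim (fun s => sqrt (T / (T - s))) (at_right 0) (locally 1)).
  { apply (filterlim_filter_le_1 (F := locally 0) (G := at_right 0)); [apply filter_le_within|].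
    replace 1 with (sqrt (T / (T - 0))).
    2: { replace (T / (T - 0)) with 1 by (field; unfold T; lra); apply sqrt_1. }
    apply (cont_ex_derive (fun s => sqrt (T / (T - s)))); auto_derive.
    assert (0 < T) by (unfold T; lra); split; [lra|split; [|exact I]].
    apply Rmult_lt_0_compat; [lra|apply Rinv_0_lt_compat; lra]. }
  assert (L3 : filterlim (fun s => sqrt (T / (T - s)) * m s) (at_right 0)
                 (locally (1 * (lam * kern x0 T 0 0)))).
  { eapply filterlim_comp_2; [exact L2|exact L1|].
    apply (filterlim_mult (K := R_AbsRing) 1 (lam * kern x0 T 0 0)). }
  rewrite Rmult_1_l in L3.
  apply (filterlim_le (F := at_right 0) (fun _ => dual x0 T R0 t - K * t)
          (fun s => sqrt (T / (T - s)) * m s) (Finite _) (Finite _)); [|apply filterlim_const|exact L3].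
  exists (mkposreal t Ht); intros s Hs Hs0.
  unfold ball in Hs; simpl in Hs; unfold AbsRing_ball, abs, minus, plus, opp in Hs; simpl in Hs.
  apply Rabs_def2 in Hs.
  pose proof (dual_growth x0 T R0 s t eps HR ltac:(lra) He ltac:(unfold T; lra)) as G; fold K in G.
  assert (K * (t - s) <= K * t) by (apply Rmult_le_compat_l; lra).
  apply Rle_trans with (dual x0 T R0 s); [lra|].
  unfold m; rewrite <- RInt_scal_R.
  2: { apply ex_RInt_cont; intros; apply cont_mult; [apply continuous_V; lra|]; apply cont_mult.
       apply continuous_kern; unfold T; lra. eapply cont_is_derive, is_derive_cutoff; exact HR. }
  apply RInt_le; [lra| | |].
  - apply ex_RInt_cont; intros; apply cont_mult; [apply continuous_V; lra|]; apply cont_mult.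
    apply continuous_kern; unfold T; lra. eapply cont_is_derive, is_derive_cutoff; exact HR.
  - apply ex_RInt_cont; intros; apply cont_mult; [apply cont_const|].
    apply cont_mult; [apply continuous_V; lra|]; apply cont_mult.
    apply continuous_kern; unfold T; lra. eapply cont_is_derive, is_derive_cutoff; exact HR.
  - intros y Hy.
    pose proof (kern_time_le x0 T s y ltac:(unfold T; lra)).
    pose proof (cutoff_bounds R0 y HR ltac:(lra)) as [c0 _].
    pose proof (Hpos s y Hs0).
    replace (sqrt (T / (T - s)) * (V s y * (kern x0 T 0 y * cutoff R0 y)))
      with (V s y * (sqrt (T / (T - s)) * kern x0 T 0 y * cutoff R0 y)) by ring.
    apply Rmult_le_compat_l; [lra|]; apply Rmult_le_compat_r; lra.
Qed.

(** At time [t] the kernel has variance [eps] and concentrates at [x0], while its value at time 0 is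
    paired with the initial mass. Widening the window removes the cut-off errors on both sides. *)
Lemma approx_identity_bound x0 t eps X d : 0 < t -> 0 < eps -> 0 < d -> 0 <= X ->
  (forall y, x0 - d <= y <= x0 + d -> X <= V t y) ->
  X * gint (d / sqrt eps) <= lam * kern x0 (t + eps) 0 0.
Proof.
  intros Ht He Hd HX HV.
  set (B := Rabs x0 + d).
  assert (HB : 0 < B) by (unfold B; pose proof (Rabs_pos x0); lra).
  set (C := (176 + 16 * x0 ^ 2 / eps) ^ 2 / sqrt eps / 4 * t).
  set (g := gint (d / sqrt eps)).
  assert (Hse : 0 < sqrt eps) by (apply sqrt_lt_R0; lra).
  assert (Hg : 0 <= g).
  { unfold g, gint; apply RInt_ge_0; [|apply ex_RInt_cont, continuous_gaussian|intros; apply Rlt_le, exp_pos].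
    assert (0 < d / sqrt eps) by (apply Rdiv_lt_0_compat; lra); lra. }
  assert (HC0 : 0 <= C).
  { apply Rmult_le_pos; [|lra]; apply Rdiv_le_0_compat; [|lra]; apply Rdiv_le_0_compat; [apply pow2_ge_0|lra]. }
  apply (le_of_le_plus_div _ _ (C + 4 * B ^ 2 * (X * g)) (Rmax 1 B)).
  intros r Hr Hr0.
  assert (Hr1 : 1 <= r) by (eapply Rle_trans; [apply Rmax_l|exact Hr]).
  assert (HrB : B <= r) by (eapply Rle_trans; [apply Rmax_r|exact Hr]).
  pose proof (dual_trace_bound x0 t eps r Hr0 Ht He) as H.
  assert (H1 : (176 + 16 * x0 ^ 2 / eps) ^ 2 / sqrt eps / (4 * r ^ 3) * t <= C / r).
  { replace ((176 + 16 * x0 ^ 2 / eps) ^ 2 / sqrt eps / (4 * r ^ 3) * t) with (C / r * / r ^ 2)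
      by (unfold C; field; lra).
    rewrite <- (Rmult_1_r (C / r)) at 2; apply Rmult_le_compat_l; [apply Rdiv_le_0_compat; lra|].
    rewrite <- Rinv_1; apply Rinv_le_contravar; nra. }
  assert (ir : 0 < / r <= 1).
  { split; [apply Rinv_0_lt_compat; lra|]; rewrite <- Rinv_1; apply Rinv_le_contravar; lra. }
  assert (H2 : (X * (1 - 4 * B ^ 2 / r)) * g <= dual x0 (t + eps) r t).
  { assert (cc : forall x, continuous (fun y => V t y * (kern x0 (t + eps) t y * cutoff r y)) x).
    { intros; apply cont_mult; [apply continuous_V; lra|]; apply cont_mult.
      apply continuous_kern; lra. eapply cont_is_derive, is_derive_cutoff; exact Hr0. }
    assert (pk : forall y, 0 < kern x0 (t + eps) t y)
      by (intros; apply Rdiv_lt_0_compat; [apply exp_pos|apply sqrt_lt_R0; lra]).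
    assert (pos : forall y, - r <= y <= r -> 0 <= V t y * (kern x0 (t + eps) t y * cutoff r y)).
    { intros y Hy; apply Rmult_le_pos; [apply Hpos; lra|]; apply Rmult_le_pos; [left; apply pk|].
      apply cutoff_bounds; lra. }
    assert (Hxb : - Rabs x0 <= x0 <= Rabs x0) by (apply Rabs_le_between; lra).
    unfold dual.
    rewrite <- (RInt_Chasles _ (- r) (x0 - d) r), <- (RInt_Chasles _ (x0 - d) (x0 + d) r)
      by (apply ex_RInt_cont; exact cc).
    unfold plus; simpl.
    assert (0 <= RInt (fun y => V t y * (kern x0 (t + eps) t y * cutoff r y)) (- r) (x0 - d)).
    { apply RInt_ge_0; [unfold B in *; lra|apply ex_RInt_cont; exact cc|].
      intros; apply pos; unfold B in *; lra. }
    assert (0 <= RInt (fun y => V t y * (kern x0 (t + eps) t y * cutoff r y)) (x0 + d) r).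
    { apply RInt_ge_0; [unfold B in *; lra|apply ex_RInt_cont; exact cc|].
      intros; apply pos; unfold B in *; lra. }
    assert (X * (1 - 4 * B ^ 2 / r) * g <=
      RInt (fun y => V t y * (kern x0 (t + eps) t y * cutoff r y)) (x0 - d) (x0 + d)).
    { unfold g; rewrite <- RInt_gaussian_scaled with (x0 := x0) by exact He.
      rewrite <- RInt_scal_R.
      2: { apply ex_RInt_cont; intros; apply cont_ex_derive; auto_derive; lra. }
      apply RInt_le; [lra| |apply ex_RInt_cont; exact cc|].
      { apply ex_RInt_cont; intros; apply cont_ex_derive; auto_derive; lra. }
      intros y Hy.
      assert (Ek : kern x0 (t + eps) t y = exp (- (y - x0) ^ 2 / (2 * eps)) / sqrt eps).
      { unfold kern; replace (t + eps - t) with eps by ring; reflexivity. }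
      rewrite <- Ek; specialize (pk y).
      replace (X * (1 - 4 * B ^ 2 / r) * kern x0 (t + eps) t y)
        with (X * (kern x0 (t + eps) t y * (1 - 4 * B ^ 2 / r))) by ring.
      assert (hc : 1 - 4 * B ^ 2 / r <= cutoff r y).
      { assert (hy : (y / r) ^ 2 <= B ^ 2 / r).
        { assert (Hy2 : y ^ 2 <= B ^ 2) by (apply pow_maj_Rabs, Rabs_le; unfold B; lra).
          replace ((y / r) ^ 2) with (y ^ 2 * / r * / r) by (field; lra).
          unfold Rdiv; pose proof (pow2_ge_0 y).
          assert (y ^ 2 * / r <= B ^ 2 * / r) by (apply Rmult_le_compat_r; lra).
          assert (0 <= y ^ 2 * / r) by (apply Rmult_le_pos; lra).
          nra. }
        pose proof (cutoff_arg r y Hr0 ltac:(unfold B in *; lra)) as [z0 z1].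
        unfold cutoff; set (z := (y / r) ^ 2) in *.
        assert (1 - 4 * z <= (1 - z) ^ 4); [|lra].
        assert (0 <= z ^ 2) by apply pow2_ge_0.
        nra. }
      assert (kern x0 (t + eps) t y * (1 - 4 * B ^ 2 / r) <= kern x0 (t + eps) t y * cutoff r y)
        by (apply Rmult_le_compat_l; lra).
      assert (0 <= kern x0 (t + eps) t y * cutoff r y).
      { apply Rmult_le_pos; [lra|apply cutoff_bounds; [lra|unfold B in *; lra]]. }
      assert (X <= V t y) by (apply HV; lra).
      apply Rle_trans with (X * (kern x0 (t + eps) t y * cutoff r y));
        [apply Rmult_le_compat_l|apply Rmult_le_compat_r]; lra. }
    simpl in *; lra. }
  replace ((C + 4 * B ^ 2 * (X * g)) / r) with (C / r + X * (4 * B ^ 2 / r) * g) by (field; lra).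
  replace (X * (1 - 4 * B ^ 2 / r) * g) with (X * g - X * (4 * B ^ 2 / r) * g) in H2 by ring.
  lra.
Qed.

(** As [eps] tends to 0 in [approx_identity_bound], the Gaussian integral tends to [gmass] and the
    kernel to the one of time [t]. The slack [eta] buys an interval around [x] on which [V] is
    nearly its value at [x]. *)
Lemma V_le_heat t x : 0 <= lam -> 0 < t -> V t x <= lam * heat t x.
Proof.
  intros Hl Ht; pose proof gmass_pos as Hg.
  pose proof (sqrt_lt_R0 t Ht) as Hs.
  set (Y := lam * (exp (- x ^ 2 / (2 * t)) / sqrt t)).
  assert (HY : 0 <= Y) by (apply Rmult_le_pos; [lra|apply Rlt_le, Rdiv_lt_0_compat; [apply exp_pos|lra]]).
  enough (main : forall eta, 0 < eta -> (V t x - eta) * gmass <= Y).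
  { replace (lam * heat t x) with (Y / gmass) by (unfold Y, heat; field; lra).
    apply Rmult_le_reg_r with gmass; [lra|].
    unfold Rdiv; rewrite Rmult_assoc, Rinv_l, Rmult_1_r by lra.
    apply Rnot_lt_le; intros h.
    specialize (main ((V t x * gmass - Y) / (2 * gmass)) ltac:(apply Rdiv_lt_0_compat; lra)).
    replace ((V t x - (V t x * gmass - Y) / (2 * gmass)) * gmass)
      with ((V t x * gmass + Y) / 2) in main by (field; lra).
    lra. }
  intros eta Heta.
  destruct (Rle_dec (V t x - eta) 0) as [h|h].
  { apply Rle_trans with 0; [|exact HY]; nra. }
  set (X := V t x - eta) in *; assert (HX : 0 < X) by lra; clear h.
  assert (Hd : exists d, 0 < d /\ forall y, x - d <= y <= x + d -> X <= V t y).
  { pose proof (continuous_V t x Ht) as c; apply continuity_pt_filterlim in c.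
    destruct (c eta Heta) as [d [Hd Hb]].
    exists (d / 2); split; [lra|]; intros y Hy.
    destruct (Req_dec x y) as [<-|n]; [unfold X; lra|].
    assert (hy : Rabs (V t y - V t x) < eta).
    { apply Hb; split; [split; [exact I|exact n]|].
      unfold dist; simpl; unfold R_dist; apply Rabs_def1; lra. }
    apply Rabs_def2 in hy; unfold X; lra. }
  destruct Hd as (d & Hd & HV).
  pose (r := fun e => lam * kern x (t + e) 0 0).
  assert (cr : continuous r 0).
  { apply cont_ex_derive; unfold r, kern; auto_derive.
    assert (0 < sqrt (t + 0 + - 0)) by (apply sqrt_lt_R0; lra); repeat split; lra. }
  assert (r0 : r 0 = Y).
  { unfold r, Y, kern; replace (t + 0 - 0) with t by ring; do 3 f_equal.
    f_equal; ring. }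
  apply Rnot_lt_le; intros h.
  (* Replacing [gmass] by [gmass - e1] and [Y] by [Y + e1] costs [e1 (X + 1)], half of the assumed
     excess. *)
  set (e1 := (X * gmass - Y) / (2 * (X + 1))).
  assert (He1 : 0 < e1) by (apply Rdiv_lt_0_compat; lra).
  destruct (gmass_approx e1 He1) as (A & HA & Hap).
  apply continuity_pt_filterlim in cr.
  destruct (cr e1 He1) as [d1 [Hd1 Hb1]].
  set (eps := Rmin (d1 / 2) ((d / A) ^ 2)).
  assert (HdA : 0 < d / A) by (apply Rdiv_lt_0_compat; lra).
  assert (He : 0 < eps) by (apply Rmin_glb_lt; [lra|apply pow_lt; lra]).
  assert (he1 : eps <= d1 / 2) by apply Rmin_l.
  assert (he2 : eps <= (d / A) ^ 2) by apply Rmin_r.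
  pose proof (approx_identity_bound x t eps X d Ht He Hd ltac:(lra) HV) as M.
  assert (hr : Rabs (r eps - r 0) < e1).
  { apply Hb1; split; [split; [exact I|lra]|].
    unfold dist; simpl; unfold R_dist; apply Rabs_def1; lra. }
  apply Rabs_def2 in hr; rewrite r0 in hr; unfold r in hr.
  assert (hg : gint A <= gint (d / sqrt eps)).
  { apply gint_incr; split; [lra|].
    assert (hse : 0 < sqrt eps) by (apply sqrt_lt_R0; lra).
    assert (hs2 : sqrt eps <= d / A) by (rewrite <- (sqrt_pow2 (d / A)) by lra; apply sqrt_le_1; lra).
    apply Rmult_le_reg_r with (sqrt eps); [lra|].
    unfold Rdiv; rewrite Rmult_assoc, Rinv_l, Rmult_1_r by lra.
    apply Rle_trans with (A * (d / A)); [apply Rmult_le_compat_l; lra|].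
    right; field; lra. }
  assert (X * (gmass - e1) <= X * gint (d / sqrt eps)) by (apply Rmult_le_compat_l; lra).
  assert (e1 * (X + 1) = (X * gmass - Y) / 2) by (unfold e1; field; lra).
  lra.
Qed.
End HK.

(** * Comparison, scaling and concavity in the mass *)

Lemma Vsol_of_is_V_lambda V lam : is_V_lambda V lam -> Vsol V lam.
Proof.
  intros [HC Htr].
  exists (dt V), (dx V), (dxx V); split; [split|split; [|split; [|exact Htr]]]; intros t x Ht;
    destruct (HC t x Ht) as (p & e1 & e2 & e3 & j1 & j2 & j3 & j4 & E).
  - apply Derive_correct; exact e1.
  - apply Derive_correct; exact e2.
  - apply Derive_correct; exact e3.
  - apply continuity_2d_pt_filterlim; exact j1.
  - apply continuity_2d_pt_filterlim; exact j2.
  - apply continuity_2d_snd, continuity_2d_pt_filterlim; exact j4.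
  - exact p.
  - exact E.
Qed.

Lemma Vsol_le_heat V lam t x : Vsol V lam -> 0 <= lam -> 0 < t -> V t x <= lam * heat t x.
Proof.
  intros (Vt & Vx & Vxx & HC & Hp & He & Htr) Hl Ht; eapply V_le_heat; eauto.
Qed.

Lemma Vsol_pos V lam t x : Vsol V lam -> 0 < t -> 0 <= V t x.
Proof. intros (Vt & Vx & Vxx & HC & Hp & He & Htr) Ht; auto. Qed.

Lemma continuous_heat t x : 0 < t -> continuous (fun y => heat t y) x.
Proof.
  intros Ht; pose proof (sqrt_lt_R0 t Ht); pose proof gmass_pos.
  apply cont_ex_derive; unfold heat; auto_derive.
  assert (0 < gmass * sqrt t) by (apply Rmult_lt_0_compat; lra); split; lra.
Qed.

Lemma at_right_0_scale (f : R -> R) l k : 0 < k ->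
  filterlim f (at_right 0) (locally l) -> filterlim (fun t => f (k * t)) (at_right 0) (locally l).
Proof.
  intros Hk Hf; eapply filterlim_comp; [|exact Hf].
  intros P [d Hd].
  assert (Hp : 0 < d / k) by (apply Rdiv_lt_0_compat; [apply cond_pos|exact Hk]).
  exists (mkposreal _ Hp); intros t Ht H0.
  apply Hd; [|apply Rmult_lt_0_compat; lra].
  unfold ball in *; simpl in *; unfold AbsRing_ball, abs, minus, plus, opp in *; simpl in *.
  replace (k * t + - 0) with (k * (t + - 0)) by ring.
  rewrite Rabs_mult, (Rabs_pos_eq k) by lra.
  replace (pos d) with (k * (d / k)) by (field; lra).
  apply Rmult_lt_compat_l; assumption.
Qed.

(* The defect [lam * heat - V] is nonnegative, so its weak convergence to 0 is convergence in L^1. *)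
Lemma subsolution_le U Ut Ux Uxx V lam : C12 0 U Ut Ux Uxx ->
  (forall t x, 0 < t -> Ut t x <= / 2 * Uxx t x - / 2 * U t x ^ 2) ->
  Vsol V lam -> 0 <= lam -> (forall t x, 0 < t -> U t x <= lam * heat t x) ->
  forall t x, 0 < t -> U t x <= V t x.
Proof.
  intros HU Hsub HV Hl HUh t x Ht.
  destruct (HV) as (Vt & Vx & Vxx & HC & Hp & He & Htr).
  pose proof (C12_lin 1 (-1) _ _ _ _ _ _ _ _ _ HU HC) as HD.
  enough (1 * U t x + -1 * V t x <= 0) by lra.
  apply (comparison_limit _ _ _ _ _ HD); auto.
  - clear x t Ht; intros t x Ht Hpos; rewrite (He t x Ht).
    specialize (Hsub t x Ht); specialize (Hp t x Ht); nra.
  - intros R0 eta HR Heta.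
    assert (T := trace_cutoff V lam (fun _ => 1) R0 Htr HR (fun x => cont_const 1 x)).
    assert (Hb : locally (lam * 1) (fun v => lam - eta < v)).
    { exists (mkposreal _ Heta); intros v Hv.
      unfold ball in *; simpl in *; unfold AbsRing_ball, abs, minus, plus, opp in *; simpl in *.
      apply Rabs_def2 in Hv; lra. }
    destruct (T _ Hb) as [d Hd]; simpl in Hd.
    set (s := Rmin t (d / 2)).
    pose proof (cond_pos d).
    assert (Hs : 0 < s) by (apply Rmin_glb_lt; lra).
    assert (Hst : s <= t) by apply Rmin_l.
    assert (Hsd : s <= d / 2) by apply Rmin_r.
    exists s; split; [lra|].
    specialize (Hd s).
    assert (B : lam - eta < RInt (fun x0 => V s x0 * (1 * cutoff R0 x0)) (- R0) R0).
    { apply Hd; [|exact Hs].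
      unfold ball; simpl; unfold AbsRing_ball, abs, minus, plus, opp; simpl.
      rewrite Ropp_0, Rplus_0_r, Rabs_pos_eq; lra. }
    assert (cc : forall x, continuous (cutoff R0) x)
      by (intros; eapply cont_is_derive, is_derive_cutoff; exact HR).
    assert (cV : forall x, continuous (fun y => V s y) x)
      by (intros; eapply cont_is_derive, (c12_x _ _ _ _ _ HC); exact Hs).
    assert (ex1 : ex_RInt (fun x => heat s x * cutoff R0 x) (- R0) R0)
      by (apply ex_RInt_cont; intros; apply cont_mult; auto; apply continuous_heat; exact Hs).
    assert (ex2 : ex_RInt (fun x => V s x * (1 * cutoff R0 x)) (- R0) R0)
      by (apply ex_RInt_cont; intros; apply cont_mult; auto; apply cont_mult; auto; apply cont_const).
    assert (ex3 : ex_RInt (fun x => lam * (heat s x * cutoff R0 x)) (- R0) R0)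
      by (apply ex_RInt_cont; intros; apply cont_mult; [apply cont_const|]; apply cont_mult; auto; apply continuous_heat; exact Hs).
    unfold trunc_mass.
    (* [U] and [V] both lie below [lam] times [heat], so [J (U - V)] is at most the defect, whose
       truncated mass is at most [lam - (lam - eta)]. *)
    apply Rle_trans with (RInt (fun x => lam * (heat s x * cutoff R0 x) - 1 * (V s x * (1 * cutoff R0 x))) (- R0) R0).
    + apply RInt_le; [lra| | |].
      * apply ex_RInt_cont; intros; apply (continuous_J_cutoff _ _ _ _ _ HD); auto.
      * apply ex_RInt_cont; intros; apply cont_minus.
        apply cont_mult; [apply cont_const|]; apply cont_mult; auto; apply continuous_heat; exact Hs.
        apply cont_mult; [apply cont_const|]; apply cont_mult; auto; apply cont_mult; auto; apply cont_const.
      * intros y Hy; pose proof (cutoff_bounds R0 y HR ltac:(lra)) as [c0 _].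
        assert (J (1 * U s y + -1 * V s y) <= lam * heat s y - V s y).
        { pose proof (Vsol_le_heat V lam s y HV Hl Hs); specialize (HUh s y Hs).
          apply J_le; lra. }
        apply Rle_trans with ((lam * heat s y - V s y) * cutoff R0 y);
          [apply Rmult_le_compat_r; lra|lra].
    + rewrite RInt_lin_minus, RInt_scal_R by assumption.
      pose proof (heat_cutoff_mass s R0 Hs HR).
      assert (lam * RInt (fun x => heat s x * cutoff R0 x) (- R0) R0 <= lam * 1)
        by (apply Rmult_le_compat_l; lra).
      lra.
Qed.

Lemma Vsol_mono V1 V2 l1 l2 t x : Vsol V1 l1 -> Vsol V2 l2 -> 0 <= l1 <= l2 -> 0 < t ->
  V1 t x <= V2 t x.
Proof.
  intros H1 H2 Hl Ht.
  destruct (H1) as (Vt & Vx & Vxx & HC & Hp & He & Htr).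
  apply (subsolution_le V1 Vt Vx Vxx V2 l2); auto; [|lra|].
  - intros; rewrite He; auto; lra.
  - intros s y Hs; pose proof (Vsol_le_heat V1 l1 s y H1 ltac:(lra) Hs).
    pose proof (heat_pos s y Hs); nra.
Qed.

Lemma Vsol_unique V1 V2 lam t x : Vsol V1 lam -> Vsol V2 lam -> 0 <= lam -> 0 < t ->
  V1 t x = V2 t x.
Proof.
  intros H1 H2 Hl Ht; apply Rle_antisym; eapply Vsol_mono; eauto; lra.
Qed.

(** Convexity of the square makes a convex combination of solutions a subsolution, and it lies below
    the heat kernel carrying the combined mass. *)
Lemma Vsol_concave V1 V2 V3 l1 l2 th t x : Vsol V1 l1 -> Vsol V2 l2 ->
  0 <= l1 -> 0 <= l2 -> 0 <= th <= 1 -> Vsol V3 (th * l1 + (1 - th) * l2) -> 0 < t ->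
  th * V1 t x + (1 - th) * V2 t x <= V3 t x.
Proof.
  intros H1 H2 Hl1 Hl2 Hth H3 Ht.
  destruct (H1) as (Vt & Vx & Vxx & HC & Hp & He & Htr).
  destruct (H2) as (Wt & Wx & Wxx & HC2 & Hp2 & He2 & Htr2).
  pose proof (C12_lin th (1 - th) _ _ _ _ _ _ _ _ _ HC HC2) as HD.
  apply (subsolution_le _ _ _ _ V3 (th * l1 + (1 - th) * l2) HD); auto.
  - intros s y Hs; rewrite He, He2 by exact Hs.
    assert (0 <= th * (1 - th) * (V1 s y - V2 s y) ^ 2)
      by (apply Rmult_le_pos; [nra|apply pow2_ge_0]).
    nra.
  - assert (0 <= th * l1) by nra; assert (0 <= (1 - th) * l2) by nra; lra.
  - intros s y Hs.
    pose proof (Vsol_le_heat V1 l1 s y H1 Hl1 Hs); pose proof (Vsol_le_heat V2 l2 s y H2 Hl2 Hs).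
    assert (th * V1 s y <= th * (l1 * heat s y)) by (apply Rmult_le_compat_l; lra).
    assert ((1 - th) * V2 s y <= (1 - th) * (l2 * heat s y)) by (apply Rmult_le_compat_l; lra).
    lra.
Qed.

Lemma continuity_2d_scale f a b t x : continuity_2d_pt f (a * t) (b * x) ->
  continuity_2d_pt (fun s y => f (a * s) (b * y)) t x.
Proof.
  intros H e; destruct (H e) as [d Hd].
  set (m := Rabs a + Rabs b + 1).
  pose proof (Rabs_pos a); pose proof (Rabs_pos b); pose proof (cond_pos d).
  assert (Hm : 0 < d / m) by (apply Rdiv_lt_0_compat; unfold m; lra).
  assert (K : forall c u v, Rabs c <= m -> Rabs (u - v) < d / m -> Rabs (c * u - c * v) < d).
  { intros c u v Hc Huv; replace (c * u - c * v) with (c * (u - v)) by ring; rewrite Rabs_mult.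
    apply Rle_lt_trans with (m * Rabs (u - v)); [apply Rmult_le_compat_r; [apply Rabs_pos|exact Hc]|].
    replace (pos d) with (m * (d / m)) by (field; unfold m; lra).
    apply Rmult_lt_compat_l; [unfold m; lra|exact Huv]. }
  exists (mkposreal _ Hm); simpl; intros u v Hu Hv.
  apply Hd; apply K; unfold m in *; auto; lra.
Qed.

Lemma C12_scale c a b t0 f ft fx fxx : 0 < a -> C12 (a * t0) f ft fx fxx ->
  C12 t0 (fun t x => c * f (a * t) (b * x)) (fun t x => c * a * ft (a * t) (b * x))
    (fun t x => c * b * fx (a * t) (b * x)) (fun t x => c * b ^ 2 * fxx (a * t) (b * x)).
Proof.
  intros Ha [h1 h2 h3 h4 h5 h6].
  assert (K : forall (u : R -> R) (z l k e : R), is_derive u (k * z) l ->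
    is_derive (fun y => e * u (k * y)) z (e * k * l)).
  { intros u z l k e Hu; evar_last.
    apply (is_derive_scal (fun y => u (k * y)) z e).
    apply (is_derive_comp (K := R_AbsRing) (V := R_NormedModule) u (fun y => k * y)); [exact Hu|].
    apply (is_derive_scal (fun y => y) z k), (is_derive_id (K := R_AbsRing)).
    unfold scal, one; simpl; unfold mult; simpl; ring. }
  assert (T : forall t, t0 < t -> a * t0 < a * t) by (intros; apply Rmult_lt_compat_l; lra).
  split; intros t x Ht.
  - apply (K (fun s => f s (b * x))); auto.
  - apply (K (fun y => f (a * t) y)); auto.
  - evar_last; [apply (K (fun y => fx (a * t) y)); auto|ring].
  - apply continuity_2d_pt_mult; [apply continuity_2d_pt_const|apply continuity_2d_scale; auto].
  - apply continuity_2d_pt_mult; [apply continuity_2d_pt_const|apply continuity_2d_scale; auto].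
  - apply cont_mult; [apply cont_const|].
    apply (cont_comp (fun y => b * y) (fun y => fxx (a * t) y)); auto.
    apply cont_mult; [apply cont_const|apply cont_id].
Qed.

(** The quadratic term forces the amplitude [sg^2], and the change of variable in the trace takes
    one factor [sg] back. *)
Lemma Vsol_scale V lam sg : 0 < sg -> Vsol V lam ->
  Vsol (fun t x => sg ^ 2 * V (sg ^ 2 * t) (sg * x)) (sg * lam).
Proof.
  intros Hs (Vt & Vx & Vxx & HC & Hp & He & Htr).
  assert (H2 : 0 < sg ^ 2) by (apply pow_lt; exact Hs).
  assert (T : forall t, 0 < t -> 0 < sg ^ 2 * t) by (intros; apply Rmult_lt_0_compat; lra).
  eexists _, _, _; split; [|split; [|split]].
  - apply (C12_scale (sg ^ 2) (sg ^ 2) sg); auto.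
    rewrite Rmult_0_r; exact HC.
  - intros t x Ht; apply Rmult_le_pos; [lra|apply Hp; auto].
  - intros t x Ht; simpl; rewrite He by auto; ring.
  - intros phi Rs Hphi Hout.
    assert (TT := Htr (fun z => phi (/ sg * z)) (sg * Rs)).
    replace (sg * lam * phi 0) with (sg * (lam * phi (/ sg * 0))) by (rewrite Rmult_0_r; ring).
    assert (is0 : 0 < / sg) by (apply Rinv_0_lt_compat; exact Hs).
    assert (L : filterlim (fun t => sg * RInt (fun x => V (sg ^ 2 * t) x * phi (/ sg * x)) (- (sg * Rs)) (sg * Rs))
       (at_right 0) (locally (sg * (lam * phi (/ sg * 0))))).
    { apply (filterlim_comp _ _ _ (fun t => RInt (fun x => V (sg ^ 2 * t) x * phi (/ sg * x)) (- (sg * Rs)) (sg * Rs))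
        (fun v => sg * v) (at_right 0) (locally (lam * phi (/ sg * 0))));
        [|apply (cont_mult (fun _ => sg) (fun v => v)); [apply cont_const|apply cont_id]].
      apply (at_right_0_scale (fun s => RInt (fun x => V s x * phi (/ sg * x)) (- (sg * Rs)) (sg * Rs)));
        [exact H2|apply TT].
      - intros x; apply (cont_comp (fun z => / sg * z) phi); auto.
        apply cont_mult; [apply cont_const|apply cont_id].
      - intros x Hx; apply Hout; rewrite Rabs_mult, (Rabs_pos_eq (/ sg)) by lra.
        apply Rmult_lt_reg_l with sg; [exact Hs|].
        rewrite <- Rmult_assoc, Rinv_r, Rmult_1_l by lra; exact Hx. }
    eapply filterlim_ext_loc; [|exact L].
    exists (mkposreal 1 Rlt_0_1); intros t _ Ht; simpl.
    pose proof (RInt_comp_lin (V := R_CompleteNormedModule) (fun x => V (sg ^ 2 * t) x * phi (/ sg * x))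
      sg 0 (- Rs) Rs) as E.
    replace (sg * - Rs + 0) with (- (sg * Rs)) in E by ring.
    replace (sg * Rs + 0) with (sg * Rs) in E by ring.
    assert (cx : forall x, continuous (fun x => V (sg ^ 2 * t) x * phi (/ sg * x)) x).
    { intros x; apply cont_mult.
      - eapply cont_is_derive, (c12_x _ _ _ _ _ HC); auto.
      - apply (cont_comp (fun z => / sg * z) phi); auto.
        apply cont_mult; [apply cont_const|apply cont_id]. }
    simpl in E, cx; rewrite <- E by (apply ex_RInt_cont; exact cx).
    rewrite <- RInt_scal_R.
    + apply RInt_ext; intros x _; unfold scal; simpl; unfold mult; simpl.
      replace (/ sg * (sg * x + 0)) with x by (field; lra).
      replace (sg * x + 0) with (sg * x) by ring; Req; ring.
    + apply (ex_RInt_comp_lin (V := R_NormedModule) (fun x => V (sg ^ 2 * t) x * phi (/ sg * x)) sg 0).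
      replace (sg * - Rs + 0) with (- (sg * Rs)) by ring.
      replace (sg * Rs + 0) with (sg * Rs) by ring.
      apply ex_RInt_cont; exact cx.
Qed.

Lemma Vsol_reflect V lam : Vsol V lam -> Vsol (fun t x => V t (- x)) lam.
Proof.
  intros (Vt & Vx & Vxx & HC & Hp & He & Htr).
  assert (HC' : C12 (1 * 0) V Vt Vx Vxx) by (rewrite Rmult_0_r; exact HC).
  pose proof (C12_scale 1 1 (-1) 0 V Vt Vx Vxx Rlt_0_1 HC') as HS.
  assert (Ev : forall (g : R -> R -> R) t x, g (1 * t) (-1 * x) = g t (- x))
    by (intros; f_equal; ring).
  exists (fun t x => Vt t (- x)), (fun t x => - Vx t (- x)), (fun t x => Vxx t (- x)).
  split; [|split; [|split]].
  - destruct HS as [h1 h2 h3 h4 h5 h6]; split; intros t x Ht.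
    + evar_last; [eapply is_derive_ext; [|apply (h1 t x Ht)]|];
        [intros; simpl; rewrite ?(Ev V), ?(Ev Vt), ?(Ev Vx), ?(Ev Vxx); Req; ring|simpl; rewrite ?(Ev V), ?(Ev Vt), ?(Ev Vx), ?(Ev Vxx); Req; ring].
    + evar_last; [eapply is_derive_ext; [|apply (h2 t x Ht)]|];
        [intros; simpl; rewrite ?(Ev V), ?(Ev Vt), ?(Ev Vx), ?(Ev Vxx); Req; ring|simpl; rewrite ?(Ev V), ?(Ev Vt), ?(Ev Vx), ?(Ev Vxx); Req; ring].
    + evar_last; [eapply is_derive_ext; [|apply (h3 t x Ht)]|];
        [intros; simpl; rewrite ?(Ev V), ?(Ev Vt), ?(Ev Vx), ?(Ev Vxx); Req; ring|simpl; rewrite ?(Ev V), ?(Ev Vt), ?(Ev Vx), ?(Ev Vxx); Req; ring].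
    + eapply continuity_2d_pt_ext; [|apply (h4 t x Ht)]; intros; simpl; rewrite ?(Ev V), ?(Ev Vt), ?(Ev Vx), ?(Ev Vxx); ring.
    + eapply continuity_2d_pt_ext; [|apply (h5 t x Ht)]; intros; simpl; rewrite ?(Ev V), ?(Ev Vt), ?(Ev Vx), ?(Ev Vxx); ring.
    + eapply continuous_ext; [|apply (h6 t x Ht)]; intros; simpl; rewrite ?(Ev V), ?(Ev Vt), ?(Ev Vx), ?(Ev Vxx); Req; ring.
  - intros; auto.
  - intros; apply He; auto.
  - intros phi Rs Hphi Hout.
    assert (TT := Htr (fun z => phi (- z)) Rs).
    cbv beta in TT; rewrite Ropp_0 in TT.
    eapply filterlim_ext_loc; [|apply TT].
    + exists (mkposreal 1 Rlt_0_1); intros t _ Ht; simpl.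
      assert (cx : forall x, continuous (fun x => V t x * phi (- x)) x).
      { intros x; apply cont_mult.
        - eapply cont_is_derive, (c12_x _ _ _ _ _ HC); auto.
        - apply (cont_comp (fun z => - z) phi); auto.
          apply cont_ex_derive; auto_derive; exact I. }
      pose proof (RInt_reflect (fun x : R => V t x * phi (- x)) (- Rs) Rs cx) as E.
      rewrite Ropp_involutive in E; rewrite <- E.
      apply RInt_ext; intros x _; rewrite Ropp_involutive; reflexivity.
    + intros x; apply (cont_comp (fun z => - z) phi); auto.
      apply cont_ex_derive; auto_derive; exact I.
    + intros x Hx; apply Hout; rewrite Rabs_Ropp; exact Hx.
Qed.

(** * Self-similar functions and Gaussian bounds *)

Section SelfSim.
Variables (b : R) (q q1 q2 : R -> R).
Hypothesis (Hq : forall y, is_derive q y (q1 y)) (Hq1 : forall y, is_derive q1 y (q2 y))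
  (Cq2 : forall y, continuous q2 y).

Definition ss (t x : R) : R := Rpower t (- b) * q (x / sqrt t).
Definition ss_t (t x : R) : R :=
  Rpower t (- b) * (- b * q (x / sqrt t) - / 2 * (x / sqrt t) * q1 (x / sqrt t)) / t.
Definition ss_x (t x : R) : R := Rpower t (- b) * q1 (x / sqrt t) / sqrt t.
Definition ss_xx (t x : R) : R := Rpower t (- b) * q2 (x / sqrt t) / t.

Lemma C12_ss : C12 0 ss ss_t ss_x ss_xx.
Proof.
  assert (Dq : forall y, Derive (fun z => q z) y = q1 y) by (intros; apply is_derive_unique, Hq).
  assert (Dq1 : forall y, Derive (fun z => q1 z) y = q2 y) by (intros; apply is_derive_unique, Hq1).
  assert (cb : forall t x, 0 < t -> continuity_2d_pt (fun s _ : R => Rpower s (- b)) t x).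
  { intros; apply (continuity_2d_comp (fun s => Rpower s (- b)) (fun s _ => s)); [|apply continuity_2d_pt_id1].
    apply cont_ex_derive; unfold Rpower; auto_derive; assumption. }
  assert (cy : forall t x, 0 < t -> continuity_2d_pt (fun s y : R => y / sqrt s) t x).
  { intros t x Ht; apply (continuity_2d_div (fun _ y => y) (fun s _ => sqrt s)).
    apply continuity_2d_pt_id2. apply (continuity_2d_sqrt (fun s _ => s)); [lra|apply continuity_2d_pt_id1].
    pose proof (sqrt_lt_R0 t Ht); lra. }
  assert (cq : forall t x, 0 < t -> continuity_2d_pt (fun s y : R => q (y / sqrt s)) t x).
  { intros; apply (continuity_2d_comp q); auto; eapply cont_is_derive, Hq. }
  assert (cq1 : forall t x, 0 < t -> continuity_2d_pt (fun s y : R => q1 (y / sqrt s)) t x).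
  { intros; apply (continuity_2d_comp q1); auto; eapply cont_is_derive, Hq1. }
  split; intros t x Ht; pose proof (sqrt_lt_R0 t Ht) as Hs;
    assert (Et : sqrt t * sqrt t = t) by (apply sqrt_sqrt; lra).
  - unfold ss, ss_t, Rpower; auto_derive.
    { repeat split; auto; try lra; eexists; apply Hq. }
    change (x * / sqrt t) with (x / sqrt t); rewrite Dq.
    set (w := sqrt t) in *; set (E := exp _); rewrite <- Et.
    field; lra.
  - unfold ss, ss_x; auto_derive; [repeat split; auto; eexists; apply Hq|].
    change (x * / sqrt t) with (x / sqrt t); rewrite Dq; field; lra.
  - unfold ss_x, ss_xx; auto_derive; [repeat split; auto; eexists; apply Hq1|].
    change (x * / sqrt t) with (x / sqrt t); rewrite Dq1.
    set (w := sqrt t) in *; set (E := Rpower _ _); rewrite <- Et; field; lra.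
  - apply continuity_2d_pt_mult; auto.
  - apply (continuity_2d_div (fun t x => Rpower t (- b) * (- b * q (x / sqrt t) - / 2 * (x / sqrt t) * q1 (x / sqrt t))) (fun t _ => t));
      [|apply continuity_2d_pt_id1|lra].
    apply continuity_2d_pt_mult; auto.
    apply continuity_2d_pt_minus; apply continuity_2d_pt_mult; auto;
      [apply continuity_2d_pt_const|apply continuity_2d_pt_mult; auto; apply continuity_2d_pt_const].
  - unfold ss_xx; apply cont_mult; [|apply cont_const]; apply cont_mult; [apply cont_const|].
    apply (cont_comp (fun y => y / sqrt t) q2); auto.
    apply cont_mult; [apply cont_id|apply cont_const].
Qed.
End SelfSim.

Lemma Rpower_half t : 0 < t -> Rpower t (- / 2) = / sqrt t.
Proof. intros; rewrite Rpower_Ropp, Rpower_sqrt; auto. Qed.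

Lemma Rpower_m1 t : 0 < t -> Rpower t (- (1)) = / t.
Proof. intros; rewrite Rpower_Ropp, Rpower_1; auto. Qed.

Definition gq (c a y : R) : R := c * exp (- a * y ^ 2).
Definition gq1 (c a y : R) : R := - 2 * a * y * gq c a y.
Definition gq2 (c a y : R) : R := (4 * a ^ 2 * y ^ 2 - 2 * a) * gq c a y.

Lemma is_derive_gq c a y : is_derive (gq c a) y (gq1 c a y).
Proof.
  unfold gq1, gq; auto_derive; [exact I|].
  simpl; ring.
Qed.

Lemma is_derive_gq1 c a y : is_derive (gq1 c a) y (gq2 c a y).
Proof.
  unfold gq2, gq1, gq; auto_derive; [exact I|].
  simpl; ring.
Qed.

Lemma continuous_gq2 c a y : continuous (gq2 c a) y.
Proof. apply cont_ex_derive; unfold gq2, gq; auto_derive; exact I. Qed.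

Lemma C12_gauss b c a : C12 0 (ss b (gq c a)) (ss_t b (gq c a) (gq1 c a))
  (ss_x b (gq1 c a)) (ss_xx b (gq2 c a)).
Proof.
  apply C12_ss; intros; [apply is_derive_gq|apply is_derive_gq1|apply continuous_gq2].
Qed.

Lemma heat_ss t x : 0 < t -> heat t x = ss (/ 2) (gq (/ gmass) (/ 2)) t x.
Proof.
  intros Ht; pose proof (sqrt_lt_R0 t Ht); pose proof gmass_pos.
  unfold heat, ss, gq; rewrite Rpower_half by exact Ht.
  replace (- / 2 * (x / sqrt t) ^ 2) with (- x ^ 2 / (2 * t)).
  - field; lra.
  - rewrite <- (sqrt_sqrt t) at 1 by lra; field; lra.
Qed.

Lemma exp_le_compat u v : u <= v -> exp u <= exp v.
Proof. intros [h| ->]; [left; apply exp_increasing; exact h|lra]. Qed.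

(** Since [heat] is at most [1/(gmass sqrt t)], absorption removes mass at a relative rate of at
    most [lam/(2 gmass sqrt t)]; the exponential factor decays at exactly this rate and pays for
    it. *)
Lemma Vsol_lower V lam t x : Vsol V lam -> 0 < lam -> 0 < t ->
  lam * exp (- (lam / gmass) * sqrt t) * heat t x <= V t x.
Proof.
  intros HV Hl Ht; pose proof gmass_pos as Hg.
  pose (w := fun t => lam * exp (- (lam / gmass) * sqrt t)).
  pose (w1 := fun t => - (lam / gmass) / (2 * sqrt t) * w t).
  assert (wb : forall t, 0 < t -> 0 < w t <= lam).
  { intros s Hs; unfold w; split; [apply Rmult_lt_0_compat; [lra|apply exp_pos]|].
    rewrite <- (Rmult_1_r lam) at 3; apply Rmult_le_compat_l; [lra|].
    rewrite <- exp_0; apply exp_le_compat.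
    assert (0 < lam / gmass * sqrt s); [|lra].
    apply Rmult_lt_0_compat; [apply Rdiv_lt_0_compat; lra|apply sqrt_lt_R0; lra]. }
  assert (HC := C12_gauss (/ 2) (/ gmass) (/ 2)).
  apply (C12_mult_time 0 w w1) in HC.
  2: { intros s Hs; pose proof (sqrt_lt_R0 s Hs); unfold w1, w; auto_derive; [lra|field; lra]. }
  2: { intros s Hs; pose proof (sqrt_lt_R0 s Hs); apply cont_ex_derive; unfold w1, w; auto_derive.
       repeat split; lra. }
  rewrite heat_ss by exact Ht.
  apply (subsolution_le _ _ _ _ V lam HC); auto; [|lra|].
  - intros s y Hs; pose proof (sqrt_lt_R0 s Hs) as Hr; specialize (wb s Hs).
    set (h := ss (/ 2) (gq (/ gmass) (/ 2)) s y).
    assert (hp : 0 < h) by (unfold h; rewrite <- heat_ss by exact Hs; apply heat_pos; exact Hs).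
    assert (hb : h <= / (gmass * sqrt s)).
    { unfold h; rewrite <- heat_ss by exact Hs; unfold heat, Rdiv.
      rewrite <- (Rmult_1_l (/ (gmass * sqrt s))) at 2; apply Rmult_le_compat_r.
      left; apply Rinv_0_lt_compat, Rmult_lt_0_compat; lra.
      rewrite <- exp_0; apply exp_le_compat.
      assert (0 < / (2 * s)) by (apply Rinv_0_lt_compat; lra); pose proof (pow2_ge_0 y); nra. }
    assert (E : ss_t (/ 2) (gq (/ gmass) (/ 2)) (gq1 (/ gmass) (/ 2)) s y
                = / 2 * ss_xx (/ 2) (gq2 (/ gmass) (/ 2)) s y).
    { unfold ss_t, ss_xx, gq1, gq2; field; lra. }
    rewrite E.
    assert (w1 s * h <= - / 2 * (w s * h) ^ 2); [|nra].
    unfold w1.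
    assert (k : w s * h <= lam * / (gmass * sqrt s)) by (apply Rmult_le_compat; lra).
    replace (- (lam / gmass) / (2 * sqrt s) * w s * h)
      with (- / 2 * (w s * h) * (lam * / (gmass * sqrt s))) by (field; lra).
    assert (0 < w s * h) by (apply Rmult_lt_0_compat; lra).
    nra.
  - intros s y Hs; rewrite heat_ss by exact Hs; apply Rmult_le_compat_r; [|apply wb; exact Hs].
    rewrite <- heat_ss by exact Hs; left; apply heat_pos; exact Hs.
Qed.

(** For the profile [CG exp (- 7/16 y^2)] the supersolution inequality asks that half of it dominate
    [9/16 - 7/128 y^2]. That deficit ends at [y^2 = 72/7], where the exponential is [exp (- 9/2)]
    and the profile equals 9/8. *)
Definition CG : R := 9 / 8 * exp (9 / 2).

Lemma CG_pos : 0 < CG.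
Proof. unfold CG; pose proof (exp_pos (9 / 2)); lra. Qed.

(** The right side is a supersolution in which [lam] does not appear, so the bound passes to [Vinf];
    only the time from which the comparison starts depends on [lam]. *)
Lemma Vsol_upper V lam t x : Vsol V lam -> 0 < lam -> 0 < t ->
  V t x <= / t * gq CG (7 / 16) (x / sqrt t).
Proof.
  intros HV Hl Ht; pose proof gmass_pos as Hg; pose proof CG_pos as HCG.
  destruct (HV) as (Vt & Vx & Vxx & HC & Hp & He & Htr).
  pose proof (C12_lin 1 (-1) _ _ _ _ _ _ _ _ _ HC (C12_gauss 1 CG (7 / 16))) as HD.
  enough (1 * V t x + -1 * ss 1 (gq CG (7 / 16)) t x <= 0).
  { unfold ss in H; rewrite Rpower_m1 in H by exact Ht; lra. }
  (* At this time the amplitude [lam/(gmass sqrt s)] of the heat bound is below [CG/s], and its rate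
     1/2 exceeds 7/16. *)
  set (s := Rmin t ((CG * gmass / lam) ^ 2)).
  assert (Hk : 0 < CG * gmass / lam) by (apply Rdiv_lt_0_compat; [apply Rmult_lt_0_compat|]; lra).
  assert (Hs : 0 < s) by (apply Rmin_glb_lt; [lra|apply pow_lt; exact Hk]).
  assert (Hst : s <= t) by apply Rmin_l.
  assert (Hs2 : s <= (CG * gmass / lam) ^ 2) by apply Rmin_r.
  revert x; apply (comparison_from _ _ _ _ _ HD) with s; [|lra|].
  - clear t Ht Hst s Hs Hs2; intros t x Ht Hpos; rewrite He by exact Ht.
    unfold ss_t, ss_xx, ss in *; rewrite !Rpower_m1 in * by exact Ht.
    set (y := x / sqrt t) in *; set (q := gq CG (7 / 16) y) in *.
    assert (hq : 0 < q) by (apply Rmult_lt_0_compat; [lra|apply exp_pos]).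
    assert (it : 0 < / t) by (apply Rinv_0_lt_compat; lra).
    assert (key : 9 / 16 - 7 / 128 * y ^ 2 <= / 2 * q).
    { destruct (Rle_dec (72 / 7) (y ^ 2)) as [h|h]; [lra|].
      assert (9 / 16 <= / 2 * q); [|pose proof (pow2_ge_0 y); lra].
      unfold q, gq, CG.
      assert (exp (- (9 / 2)) <= exp (- (7 / 16) * y ^ 2)) by (apply exp_le_compat; lra).
      assert (e : exp (9 / 2) * exp (- (9 / 2)) = 1) by (rewrite <- exp_plus, Rplus_opp_r; apply exp_0).
      pose proof (exp_pos (9 / 2)); nra. }
    unfold gq1, gq2; fold q.
    assert (hd : (V t x - / t * q) ^ 2 <= V t x ^ 2 - (/ t * q) ^ 2).
    { assert (0 < / t * q) by (apply Rmult_lt_0_compat; lra); nra. }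
    assert (K : / t * / t * q * (9 / 16 - 7 / 128 * y ^ 2) <= / t * / t * q * (/ 2 * q)).
    { apply Rmult_le_compat_l; [|exact key].
      apply Rmult_le_pos; [apply Rmult_le_pos; lra|lra]. }
    unfold Rdiv in *; nra.
  - intros x.
    enough (V s x <= ss 1 (gq CG (7 / 16)) s x) by lra.
    eapply Rle_trans; [apply (Vsol_le_heat V lam); auto; lra|].
    rewrite heat_ss by exact Hs; unfold ss; rewrite Rpower_half, Rpower_m1 by exact Hs.
    pose proof (sqrt_lt_R0 s Hs) as Hr.
    assert (hr : sqrt s <= CG * gmass / lam)
      by (rewrite <- (sqrt_pow2 (CG * gmass / lam)) by lra; apply sqrt_le_1; lra).
    set (y := x / sqrt s); unfold gq.
    assert (h1 : exp (- / 2 * y ^ 2) <= exp (- (7 / 16) * y ^ 2))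
      by (apply exp_le_compat; pose proof (pow2_ge_0 y); lra).
    pose proof (exp_pos (- / 2 * y ^ 2)).
    assert (h2 : lam * (/ sqrt s * / gmass) <= / s * CG).
    { apply Rmult_le_reg_r with (s * gmass / lam);
        [apply Rdiv_lt_0_compat; [apply Rmult_lt_0_compat|]; lra|].
      replace (/ s * CG * (s * gmass / lam)) with (CG * gmass / lam) by (field; lra).
      replace (lam * (/ sqrt s * / gmass) * (s * gmass / lam)) with (sqrt s); [exact hr|].
      rewrite <- (sqrt_sqrt s) at 3 by lra; field; lra. }
    replace (lam * (/ sqrt s * (/ gmass * exp (- / 2 * y ^ 2))))
      with (lam * (/ sqrt s * / gmass) * exp (- / 2 * y ^ 2)) by ring.
    rewrite <- (Rmult_assoc (/ s)); apply Rmult_le_compat; try lra.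
    apply Rmult_le_pos; [lra|]; apply Rmult_le_pos; left; apply Rinv_0_lt_compat; lra.
Qed.

(** * The limit profile *)

Lemma is_derive_right_ge0 (f : R -> R) a l : is_derive f a l ->
  (forall s, a <= s -> f a <= f s) -> 0 <= l.
Proof.
  intros Hd Hm; apply Rnot_lt_le; intros Hl.
  apply is_derive_Reals in Hd.
  destruct (Hd (- l) ltac:(lra)) as [d H].
  pose proof (cond_pos d).
  specialize (H (d / 2) ltac:(lra) ltac:(rewrite Rabs_pos_eq; lra)).
  apply Rabs_def2 in H; destruct H as [H _].
  specialize (Hm (a + d / 2) ltac:(lra)).
  assert (0 <= (f (a + d / 2) - f a) / (d / 2)) by (apply Rdiv_le_0_compat; lra).
  lra.
Qed.

(** For a solution the differentiated function is also the value at time 1 of the solution of mass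
    [sqrt s] times [lam]; comparing the two exchanges [ft] for a derivative in the mass. *)
Lemma is_derive_parabolic_dilation t0 f ft fx fxx x : C12 t0 f ft fx fxx -> t0 < 1 ->
  is_derive (fun s => s * f s (sqrt s * x)) 1 (f 1 x + ft 1 x + / 2 * x * fx 1 x).
Proof.
  intros HC H1.
  assert (F2 : filterdiff (fun u : R * R => f (fst u) (snd u)) (locally (1, x))
     (fun u => plus (scal (fst u) (ft 1 x)) (scal (snd u) (fx 1 x)))).
  { apply (is_derive_filterdiff f 1 x ft (fx 1 x)).
    - assert (Hp : 0 < 1 - t0) by lra.
      exists (mkposreal _ Hp); intros [u v] [Hu _]; simpl in *.
      apply (c12_t _ _ _ _ _ HC).
      unfold ball in Hu; simpl in Hu; unfold AbsRing_ball, abs, minus, plus, opp in Hu; simpl in Hu.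
      apply Rabs_def2 in Hu; lra.
    - apply (c12_x _ _ _ _ _ HC); lra.
    - apply (continuity_2d_pt_filterlim ft 1 x), (c12_cont_t _ _ _ _ _ HC); exact H1. }
  assert (Hsq : is_derive (fun s => sqrt s * x) 1 (/ 2 * x)).
  { auto_derive; [lra|rewrite sqrt_1; field]. }
  assert (K : is_derive (fun s => f s (sqrt s * x)) 1 (ft 1 x + / 2 * x * fx 1 x)).
  { unfold is_derive.
    eapply filterdiff_ext_lin.
    - apply (filterdiff_comp'_2 (fun s : R => s) (fun s => sqrt s * x) f 1
         (fun y => y) (fun y => scal y (/ 2 * x))
         (fun u v => plus (scal u (ft 1 x)) (scal v (fx 1 x)))).
      + apply filterdiff_id.
      + exact Hsq.
      + rewrite sqrt_1, Rmult_1_l; exact F2.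
    - intros y; unfold plus, scal; simpl; unfold mult; simpl; Req; ring. }
  evar_last.
  apply (is_derive_mult (K := R_AbsRing) (fun s => s) (fun s => f s (sqrt s * x)));
    [apply (is_derive_id (K := R_AbsRing))|exact K|intros; apply Rmult_comm].
  unfold plus, mult, one; simpl; rewrite sqrt_1, !Rmult_1_l; Req; ring.
Qed.

Lemma RInt_0_opp_even (f : R -> R) x : (forall y, continuous f y) -> (forall y, f (- y) = f y) ->
  RInt f 0 (- x) = - RInt f 0 x.
Proof.
  intros c He.
  pose proof (RInt_reflect f x 0 c) as E; rewrite Ropp_0 in E; rewrite <- E.
  rewrite (RInt_ext _ f) by (intros; apply He).
  rewrite <- (opp_RInt_swap (V := R_CompleteNormedModule)) by (apply ex_RInt_cont; exact c).
  reflexivity.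
Qed.

Lemma RInt_0_opp_odd (f : R -> R) x : (forall y, continuous f y) -> (forall y, f (- y) = - f y) ->
  RInt f 0 (- x) = RInt f 0 x.
Proof.
  intros c Ho.
  pose proof (RInt_reflect f x 0 c) as E; rewrite Ropp_0 in E; rewrite <- E.
  rewrite (RInt_ext _ (fun y => -1 * f y)) by (intros; rewrite Ho; Req; ring).
  rewrite RInt_scal_R by (apply ex_RInt_cont; exact c).
  rewrite <- (opp_RInt_swap (V := R_CompleteNormedModule)) by (apply ex_RInt_cont; exact c).
  unfold opp; simpl; Req; ring.
Qed.

Lemma is_derive_RInt_from0 (f : R -> R) x : (forall y, continuous f y) ->
  is_derive (fun y => RInt f 0 y) x (f x).
Proof.
  intros c; apply (is_derive_RInt (V := R_NormedModule) f (fun y => RInt f 0 y) 0 x); [|apply c].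
  exists (mkposreal 1 Rlt_0_1); intros y _.
  apply (RInt_correct (V := R_CompleteNormedModule)), ex_RInt_cont, c.
Qed.

Lemma continuous_even_lip (f : R -> R) x : (forall y, f (- y) = f y) ->
  (forall X, 0 <= X -> exists L, 0 < L /\ forall x y, 0 <= x <= y -> y <= X ->
     Rabs (f y - f x) <= L * (y - x)) -> continuous f x.
Proof.
  intros He Hlip.
  set (X := Rabs x + 1); pose proof (Rabs_pos x).
  destruct (Hlip X ltac:(unfold X; lra)) as (L & HL & H0).
  assert (K : forall u v, Rabs u <= X -> Rabs v <= X -> Rabs (f u - f v) <= L * Rabs (u - v)).
  { assert (Ea : forall u, f u = f (Rabs u)).
    { intros u; unfold Rabs; destruct (Rcase_abs u); [rewrite He|]; reflexivity. }
    intros u v Hu Hv; rewrite (Ea u), (Ea v).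
    apply Rle_trans with (L * Rabs (Rabs u - Rabs v));
      [|apply Rmult_le_compat_l; [lra|apply Rabs_triang_inv2]].
    pose proof (Rabs_pos u); pose proof (Rabs_pos v).
    destruct (Rle_dec (Rabs u) (Rabs v)) as [h|h].
    - rewrite Rabs_minus_sym, (Rabs_minus_sym (Rabs u)), (Rabs_pos_eq (Rabs v - Rabs u)) by lra.
      apply H0; lra.
    - rewrite (Rabs_pos_eq (Rabs u - Rabs v)) by lra; apply H0; lra. }
  apply continuity_pt_filterlim; intros e Hep.
  exists (Rmin 1 (e / L)); split; [apply Rmin_glb_lt; [lra|apply Rdiv_lt_0_compat; lra]|].
  intros y [_ Hy]; unfold dist in *; simpl in *; unfold R_dist in *.
  pose proof (Rmin_l 1 (e / L)); pose proof (Rmin_r 1 (e / L)).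
  assert (Rabs y <= X).
  { unfold X; replace y with (x + (y - x)) by ring; pose proof (Rabs_triang x (y - x)); lra. }
  eapply Rle_lt_trans; [apply K; unfold X in *; lra|].
  apply Rlt_le_trans with (L * (e / L)); [apply Rmult_lt_compat_l; lra|right; field; lra].
Qed.

Lemma is_derive_exp_sq x : is_derive (fun x => exp (x ^ 2 / 2)) x (x * exp (x ^ 2 / 2)).
Proof. auto_derive; [exact I|]; unfold Rdiv; simpl; field. Qed.

Lemma is_derive_exp_opp_sq x : is_derive (fun x => exp (- x ^ 2 / 2)) x (- x * exp (- x ^ 2 / 2)).
Proof. auto_derive; [exact I|]; unfold Rdiv; simpl; field. Qed.

Lemma abs_growth (f f' : R -> R) (X K : R) : 0 <= K -> 
  (forall x, 0 <= x <= X -> is_derive f x (f' x)) ->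
  (forall x, 0 <= x <= X -> Rabs (f' x) <= K) ->
  forall x y, 0 <= x <= y -> y <= X -> Rabs (f y - f x) <= K * (y - x).
Proof.
  intros HK Hd Hb x y Hxy HyX; apply Rabs_le; split.
  - enough (- f y <= - f x + K * (y - x)) by lra.
    apply (mvt_le (fun x => - f x) (fun x => - f' x)); [lra| |].
    + intros z Hz; apply (is_derive_opp (V := R_NormedModule) f); apply Hd; lra.
    + intros z Hz; specialize (Hb z ltac:(lra)); apply Rabs_le_between in Hb; lra.
  - enough (f y <= f x + K * (y - x)) by lra.
    apply (mvt_le f f'); [lra| |].
    + intros z Hz; apply Hd; lra.
    + intros z Hz; specialize (Hb z ltac:(lra)); apply Rabs_le_between in Hb; lra.
Qed.

Lemma exp_sq_bounds X x : 0 <= x <= X -> 1 <= exp (x ^ 2 / 2) <= exp (X ^ 2 / 2).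
Proof.
  intros Hx; split; [rewrite <- exp_0|]; apply exp_le_compat; nra.
Qed.

(* Integrates a second-order inequality written with the integrating factor [exp (x^2/2)]. *)
Lemma double_growth (X E : R) (g g1 p p1 : R -> R) : 0 <= X -> 0 <= E ->
  (forall x, 0 <= x <= X -> is_derive g x (g1 x)) ->
  (forall x, 0 <= x <= X -> p x = exp (x ^ 2 / 2) * g1 x) -> p 0 = 0 ->
  (forall x, 0 <= x <= X -> is_derive p x (exp (x ^ 2 / 2) * p1 x)) ->
  (forall x, 0 <= x <= X -> Rabs (p1 x) <= E) ->
  forall x y, 0 <= x <= y -> y <= X -> Rabs (g y - g x) <= exp (X ^ 2 / 2) * E * X * (y - x).
Proof.
  intros HX HE Hg Hp p0 Hp1 Hb.
  pose proof (exp_pos (X ^ 2 / 2)) as HM.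
  assert (HK : 0 <= exp (X ^ 2 / 2) * E) by (apply Rmult_le_pos; lra).
  apply (abs_growth g g1); [apply Rmult_le_pos; lra|exact Hg|].
  intros x Hx.
  assert (B := abs_growth p _ X (exp (X ^ 2 / 2) * E) HK Hp1).
  assert (Hp' : Rabs (p x - p 0) <= exp (X ^ 2 / 2) * E * (x - 0)).
  { apply B; [|lra|lra].
    intros z Hz; pose proof (exp_sq_bounds X z Hz).
    rewrite Rabs_mult, (Rabs_pos_eq (exp _)) by lra.
    apply Rmult_le_compat; [lra|apply Rabs_pos|lra|apply Hb; exact Hz]. }
  rewrite p0, !Rminus_0_r, Hp in Hp' by exact Hx.
  pose proof (exp_sq_bounds X x Hx).
  rewrite Rabs_mult, (Rabs_pos_eq (exp _)) in Hp' by lra.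
  pose proof (Rabs_pos (g1 x)).
  assert (exp (X ^ 2 / 2) * E * x <= exp (X ^ 2 / 2) * E * X) by (apply Rmult_le_compat_l; lra).
  nra.
Qed.

Section Limit.
Variables (V : R -> R -> R -> R) (Vinf : R -> R -> R).
Hypothesis HV : forall lam, 0 < lam -> Vsol (V lam) lam.
Hypothesis hVinf : forall t x, 0 < t -> is_lim (fun lam => V lam t x) p_infty (Vinf t x).

Lemma V_mono l1 l2 t x : 0 < l1 <= l2 -> 0 < t -> V l1 t x <= V l2 t x.
Proof. intros; eapply Vsol_mono; eauto; try apply HV; lra. Qed.

Lemma Vinf_approx t x eta : 0 < t -> 0 < eta ->
  exists L, 0 < L /\ forall lam, L <= lam -> Rabs (V lam t x - Vinf t x) < eta.
Proof.
  intros Ht He; pose proof (hVinf t x Ht) as H; apply is_lim_spec in H.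
  destruct (H (mkposreal _ He)) as [M HM].
  exists (Rmax 1 (M + 1)); split; [eapply Rlt_le_trans; [|apply Rmax_l]; lra|].
  intros lam Hl; apply HM; pose proof (Rmax_r 1 (M + 1)); lra.
Qed.

Lemma V_le_Vinf lam t x : 0 < lam -> 0 < t -> V lam t x <= Vinf t x.
Proof.
  intros Hl Ht; apply Rnot_lt_le; intros h.
  destruct (Vinf_approx t x (V lam t x - Vinf t x) Ht ltac:(lra)) as (L & HL & H).
  specialize (H (Rmax lam L) (Rmax_r _ _)); apply Rabs_def2 in H.
  pose proof (V_mono lam (Rmax lam L) t x (conj Hl (Rmax_l _ _)) Ht); lra.
Qed.

Lemma Vinf_le t x B : 0 < t -> (forall lam, 0 < lam -> V lam t x <= B) -> Vinf t x <= B.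
Proof.
  intros Ht HB; apply Rnot_lt_le; intros h.
  destruct (Vinf_approx t x (Vinf t x - B) Ht ltac:(lra)) as (L & HL & H).
  specialize (H L (Rle_refl L)); apply Rabs_def2 in H; specialize (HB L HL); lra.
Qed.

Lemma V_dilation lam s t x : 0 < lam -> 0 < s -> 0 < t ->
  s ^ 2 * V lam (s ^ 2 * t) (s * x) = V (s * lam) t x.
Proof.
  intros Hl Hs Ht.
  assert (0 < s * lam) by (apply Rmult_lt_0_compat; lra).
  exact (Vsol_unique _ _ (s * lam) t x (Vsol_scale _ _ s Hs (HV lam Hl)) (HV _ H) ltac:(lra) Ht).
Qed.

(** Scaling maps the mass [lam] to [s] times [lam], and both sweep out all positive masses. *)
Lemma Vinf_dilation s t x : 0 < s -> 0 < t ->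
  s ^ 2 * Vinf (s ^ 2 * t) (s * x) = Vinf t x.
Proof.
  intros Hs Ht.
  assert (H2 : 0 < s ^ 2) by (apply pow_lt; lra).
  assert (Ht2 : 0 < s ^ 2 * t) by (apply Rmult_lt_0_compat; lra).
  apply Rle_antisym.
  - apply Rmult_le_reg_l with (/ s ^ 2); [apply Rinv_0_lt_compat; lra|].
    rewrite <- Rmult_assoc, Rinv_l, Rmult_1_l by lra.
    apply Vinf_le; auto; intros lam Hl.
    assert (0 < s * lam) by (apply Rmult_lt_0_compat; lra).
    apply Rmult_le_reg_l with (s ^ 2); [lra|].
    rewrite <- Rmult_assoc, Rinv_r, Rmult_1_l by lra.
    rewrite V_dilation by assumption; apply V_le_Vinf; assumption.
  - apply Vinf_le; auto; intros lam Hl.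
    assert (Hl' : 0 < lam / s) by (apply Rdiv_lt_0_compat; lra).
    replace lam with (s * (lam / s)) by (field; lra).
    rewrite <- V_dilation by assumption.
    apply Rmult_le_compat_l; [lra|]; apply V_le_Vinf; assumption.
Qed.

Lemma Vinf_ss t x : 0 < t -> Vinf t x = ss 1 (fun y => Vinf 1 y) t x.
Proof.
  intros Ht; pose proof (sqrt_lt_R0 t Ht) as Hs.
  unfold ss; rewrite Rpower_m1 by exact Ht.
  assert (E : sqrt t ^ 2 = t) by (simpl; rewrite Rmult_1_r; apply sqrt_sqrt; lra).
  rewrite <- (Vinf_dilation (sqrt t) 1 (x / sqrt t)) by lra.
  rewrite E; replace (sqrt t * (x / sqrt t)) with x by (field; lra).
  rewrite Rmult_1_r; field; lra.
Qed.

Lemma V_even lam t x : 0 < lam -> 0 < t -> V lam t (- x) = V lam t x.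
Proof.
  intros Hl Ht.
  exact (Vsol_unique _ _ lam t x (Vsol_reflect _ _ (HV lam Hl)) (HV _ Hl) ltac:(lra) Ht).
Qed.

Lemma Vinf_even t x : 0 < t -> Vinf t (- x) = Vinf t x.
Proof.
  intros Ht; apply Rle_antisym; apply Vinf_le; auto; intros lam Hl.
  - rewrite V_even by assumption; apply V_le_Vinf; assumption.
  - rewrite <- V_even by assumption; apply V_le_Vinf; assumption.
Qed.

Lemma V_profile_bounds lam x : 0 < lam -> 0 <= V lam 1 x <= CG.
Proof.
  intros Hl; split; [apply (Vsol_pos _ lam); [apply HV; exact Hl|lra]|].
  eapply Rle_trans; [apply (Vsol_upper _ lam); [apply HV; exact Hl|lra|lra]|].
  rewrite Rinv_1, Rmult_1_l; unfold gq; pose proof CG_pos.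
  rewrite <- (Rmult_1_r CG) at 2; apply Rmult_le_compat_l; [lra|].
  eapply Rle_trans; [apply (exp_le_compat _ 0)|rewrite exp_0; lra].
  pose proof (pow2_ge_0 (x / sqrt 1)); lra.
Qed.

Lemma Vinf_upper x : Vinf 1 x <= gq CG (7 / 16) x.
Proof.
  apply Vinf_le; [lra|]; intros lam Hl.
  eapply Rle_trans; [apply (Vsol_upper _ lam); [apply HV; exact Hl|lra|lra]|].
  rewrite Rinv_1, sqrt_1, Rmult_1_l; unfold Rdiv; rewrite Rinv_1, Rmult_1_r; lra.
Qed.

Lemma Vinf_lower x : exp (- / gmass) * heat 1 x <= Vinf 1 x.
Proof.
  eapply Rle_trans; [|apply (V_le_Vinf 1); lra].
  eapply Rle_trans; [|apply (Vsol_lower _ 1); [apply HV|..]; lra].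
  rewrite sqrt_1; right; do 2 f_equal; unfold Rdiv; rewrite !Rmult_1_l, Rmult_1_r; reflexivity.
Qed.

Lemma Vinf_profile_bounds x : 0 < Vinf 1 x <= CG.
Proof.
  split; [|apply Vinf_le; [lra|intros; apply V_profile_bounds; assumption]].
  eapply Rlt_le_trans; [|apply Vinf_lower].
  apply Rmult_lt_0_compat; [apply exp_pos|apply heat_pos; lra].
Qed.

(* [r] is twice the logarithmic [lam]-derivative of [V lam 1 x]: it is nonnegative by
   monotonicity and bounded by an increment by concavity. *)
Lemma V_profile_ode lam : 0 < lam -> exists g1 g2 r : R -> R,
  (forall x, is_derive (fun y => V lam 1 y) x (g1 x)) /\
  (forall x, is_derive g1 x (g2 x)) /\ g1 0 = 0 /\
  (forall x, g2 x = - x * g1 x + V lam 1 x ^ 2 - 2 * V lam 1 x + r x) /\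
  (forall x, 0 <= r x <= 2 * (V lam 1 x - V (lam / 2) 1 x)).
Proof.
  intros Hl.
  destruct (HV lam Hl) as (Vt & Vx & Vxx & HC & Hp & He & Htr).
  exists (fun x => Vx 1 x), (fun x => Vxx 1 x),
    (fun x => 2 * (V lam 1 x + Vt 1 x + / 2 * x * Vx 1 x)).
  assert (D1 : forall x, is_derive (fun y => V lam 1 y) x (Vx 1 x))
    by (intros; apply (c12_x _ _ _ _ _ HC); lra).
  assert (Ew : forall s x, 0 < s -> s * V lam s (sqrt s * x) = V (sqrt s * lam) 1 x).
  { intros s x Hs; rewrite <- V_dilation; [|lra|apply sqrt_lt_R0; lra|lra].
    replace (sqrt s ^ 2) with s by (simpl; rewrite Rmult_1_r; symmetry; apply sqrt_sqrt; lra).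
    rewrite Rmult_1_r; reflexivity. }
  refine (conj _ (conj _ (conj _ (conj _ (fun x => conj _ _))))).
  - exact D1.
  - intros; apply (c12_xx _ _ _ _ _ HC); lra.
  - assert (E : Vx 1 0 = - Vx 1 0); [|lra].
    assert (d : is_derive (fun y => V lam 1 y) 0 (- Vx 1 0)).
    { apply (is_derive_ext (fun y => V lam 1 (- y))); [intros; apply V_even; lra|].
      evar_last.
      apply (is_derive_comp (K := R_AbsRing) (V := R_NormedModule) (fun y => V lam 1 y) (fun y => - y)).
      rewrite Ropp_0; apply D1.
      apply (is_derive_opp (V := R_NormedModule) (fun y => y)), (is_derive_id (K := R_AbsRing)).
      unfold scal, opp, one; simpl; unfold mult; simpl; Req; ring. }
    rewrite <- (is_derive_unique _ _ _ (D1 0)) at 1; apply is_derive_unique; exact d.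
  (* The time derivative hidden in [r] is eliminated with the evolution equation. *)
  - intros x; rewrite (He 1 x) by lra; field.
  - enough (0 <= V lam 1 x + Vt 1 x + / 2 * x * Vx 1 x) by lra.
    apply (is_derive_right_ge0 _ _ _ (is_derive_parabolic_dilation _ _ _ _ _ x HC Rlt_0_1)).
    intros s Hs; rewrite !Ew by lra; apply V_mono; [|lra].
    rewrite sqrt_1, Rmult_1_l; split; [lra|].
    assert (1 <= sqrt s) by (rewrite <- sqrt_1; apply sqrt_le_1; lra); nra.
  - set (dl := V lam 1 x - V (lam / 2) 1 x).
    enough (0 <= dl - (V lam 1 x + Vt 1 x + / 2 * x * Vx 1 x)) by lra.
    (* [2 dl sqrt s] has derivative [dl] at 1, so it is enough that the difference does not fall
       below its value at 1 for [s >= 1]. *)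
    apply (is_derive_right_ge0 (fun s => 2 * dl * sqrt s - s * V lam s (sqrt s * x)) 1).
    + apply (is_derive_minus (V := R_NormedModule) (fun s => 2 * dl * sqrt s) (fun s => s * V lam s (sqrt s * x))).
      auto_derive; [lra|rewrite sqrt_1; field].
      apply (is_derive_parabolic_dilation _ _ _ _ _ x HC Rlt_0_1).
    + intros s Hs; rewrite !Ew by lra; rewrite sqrt_1, Rmult_1_l.
      assert (h : 1 <= sqrt s) by (rewrite <- sqrt_1; apply sqrt_le_1; lra).
      set (w := sqrt s) in *.
      (* [th] writes [lam] as a convex combination of [lam / 2] and [w] times [lam]; concavity then
         bounds the slope after [lam] by the slope before it. *)
      set (th := 1 - (/ 2) / (w - / 2)).
      assert (hth : 0 < (/ 2) / (w - / 2) <= 1).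
      { split; [apply Rdiv_lt_0_compat; lra|].
        apply Rmult_le_reg_r with (w - / 2); [lra|]; unfold Rdiv; rewrite Rmult_assoc, Rinv_l by lra; lra. }
      assert (c := Vsol_concave (V (lam / 2)) (V (w * lam)) (V lam) (lam / 2) (w * lam) th 1 x
        (HV (lam / 2) ltac:(lra)) (HV (w * lam) ltac:(nra)) ltac:(lra) ltac:(nra) ltac:(unfold th; lra)).
      replace (th * (lam / 2) + (1 - th) * (w * lam)) with lam in c by (unfold th; field; lra).
      specialize (c (HV lam Hl) ltac:(lra)).
      fold dl in c |- *; replace (V (lam / 2) 1 x) with (V lam 1 x - dl) in c by (unfold dl; ring).
      assert (c2 : (1 - th) * (V (w * lam) 1 x - V lam 1 x) <= th * dl) by lra.
      assert (c3 : V (w * lam) 1 x - V lam 1 x <= 2 * (w - 1) * dl).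
      { apply Rmult_le_reg_l with (1 - th); [unfold th; lra|].
        eapply Rle_trans; [exact c2|right]; unfold th; field; lra. }
      lra.
Qed.

(** Every term of the profile equation is bounded through [CG], independently of [lam]; the
    resulting equicontinuity is what the passage to [Vinf] needs. *)
Lemma V_profile_lip X : 0 <= X -> exists L, 0 < L /\ forall lam x y, 0 < lam ->
  0 <= x <= y -> y <= X -> Rabs (V lam 1 y - V lam 1 x) <= L * (y - x).
Proof.
  intros HX; pose proof CG_pos as HC.
  exists (exp (X ^ 2 / 2) * (CG ^ 2 + 4 * CG) * X + 1); split.
  { assert (0 <= exp (X ^ 2 / 2) * (CG ^ 2 + 4 * CG) * X); [|lra].
    apply Rmult_le_pos; [|lra]; apply Rmult_le_pos; [left; apply exp_pos|nra]. }
  intros lam x y Hl Hxy HyX.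
  destruct (V_profile_ode lam Hl) as (g1 & g2 & r & D1 & D2 & z & E & Hr).
  apply Rle_trans with (exp (X ^ 2 / 2) * (CG ^ 2 + 4 * CG) * X * (y - x)); [|nra].
  apply (double_growth X (CG ^ 2 + 4 * CG) (fun x => V lam 1 x) g1 (fun x => exp (x ^ 2 / 2) * g1 x)
    (fun x => V lam 1 x ^ 2 - 2 * V lam 1 x + r x)); auto; [nra| | |].
  - rewrite z; ring.
  - intros s _; evar_last.
    apply (is_derive_mult (K := R_AbsRing) (fun x => exp (x ^ 2 / 2)) g1);
      [apply is_derive_exp_sq|apply D2|intros; apply Rmult_comm].
    unfold plus, mult; simpl; unfold mult; simpl; rewrite (E s); simpl; field.
  - intros s _; pose proof (V_profile_bounds lam s Hl); specialize (Hr s).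
    pose proof (V_profile_bounds (lam / 2) s ltac:(lra)).
    apply Rabs_le; nra.
Qed.

Lemma Vinf_profile_lip X : 0 <= X -> exists L, 0 < L /\ forall x y,
  0 <= x <= y -> y <= X -> Rabs (Vinf 1 y - Vinf 1 x) <= L * (y - x).
Proof.
  intros HX; destruct (V_profile_lip X HX) as (L & HL & H); exists L; split; [exact HL|].
  intros x y Hxy HyX; apply Rabs_le; split.
  - enough (Vinf 1 x <= Vinf 1 y + L * (y - x)) by lra.
    apply Vinf_le; [lra|]; intros lam Hl.
    specialize (H lam x y Hl Hxy HyX); apply Rabs_le_between in H.
    pose proof (V_le_Vinf lam 1 y Hl Rlt_0_1); lra.
  - enough (Vinf 1 y <= Vinf 1 x + L * (y - x)) by lra.
    apply Vinf_le; [lra|]; intros lam Hl.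
    specialize (H lam x y Hl Hxy HyX); apply Rabs_le_between in H.
    pose proof (V_le_Vinf lam 1 x Hl Rlt_0_1); lra.
Qed.

Lemma continuous_Vinf_profile x : continuous (fun y => Vinf 1 y) x.
Proof.
  apply continuous_even_lip; [intros; apply Vinf_even; lra|].
  intros X HX; apply Vinf_profile_lip; exact HX.
Qed.

(** Pointwise convergence of equi-Lipschitz functions is uniform on compact intervals. The grid of
    step [h] is treated by induction: [eta/2] is spent at a node, [eta/4] between nodes. *)
Lemma V_profile_uniform X eta : 0 <= X -> 0 < eta ->
  exists L, 0 < L /\ forall lam x, L <= lam -> 0 <= x <= X -> Vinf 1 x - V lam 1 x <= eta.
Proof.
  intros HX He.
  destruct (V_profile_lip X HX) as (K & HK & HV1); destruct (Vinf_profile_lip X HX) as (K2 & HK2 & HV2).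
  set (h := eta / (4 * (K + K2))).
  assert (Hh : 0 < h) by (apply Rdiv_lt_0_compat; lra).
  assert (grid : forall n : nat, exists L, 0 < L /\ forall lam x, L <= lam -> 0 <= x <= X ->
     x <= INR n * h -> Vinf 1 x - V lam 1 x <= eta).
  { induction n as [|n IH].
    - destruct (Vinf_approx 1 0 eta Rlt_0_1 He) as (L & HL & H); exists L; split; [exact HL|].
      intros lam x Hl Hx Hxn; simpl in Hxn; replace x with 0 by lra.
      specialize (H lam Hl); apply Rabs_def2 in H; lra.
    - destruct IH as (L1 & HL1 & H1).
      destruct (Rle_dec (INR n * h) X) as [hn|hn].
      + destruct (Vinf_approx 1 (INR n * h) (eta / 2) Rlt_0_1 ltac:(lra)) as (L2 & HL2 & H2).
        exists (Rmax L1 L2); split; [eapply Rlt_le_trans; [exact HL1|apply Rmax_l]|].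
        intros lam x Hl Hx Hxn.
        pose proof (Rmax_l L1 L2); pose proof (Rmax_r L1 L2).
        destruct (Rle_dec x (INR n * h)) as [hx|hx]; [apply H1; lra|].
        rewrite S_INR in Hxn.
        assert (hn0 : 0 <= INR n * h) by (apply Rmult_le_pos; [apply pos_INR|lra]).
        specialize (H2 lam ltac:(lra)); apply Rabs_def2 in H2.
        specialize (HV1 lam (INR n * h) x ltac:(lra) ltac:(lra) ltac:(lra)).
        specialize (HV2 (INR n * h) x ltac:(lra) ltac:(lra)).
        apply Rabs_le_between in HV1; apply Rabs_le_between in HV2.
        assert ((K + K2) * (x - INR n * h) <= (K + K2) * h) by (apply Rmult_le_compat_l; lra).
        assert ((K + K2) * h = eta / 4) by (unfold h; field; lra).
        lra.
      + exists L1; split; [exact HL1|]; intros lam x Hl Hx _; apply H1; lra. }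
  destruct (INR_unbounded (X / h)) as [n Hn].
  destruct (grid n) as (L & HL & H); exists L; split; [exact HL|].
  intros lam x Hl Hx; apply H; auto.
  assert (X <= INR n * h); [|lra].
  replace X with (X / h * h) by (field; lra); apply Rmult_le_compat_r; lra.
Qed.

(** * The profile equation in integral form *)

Definition Finh (r : R) : R := exp (r ^ 2 / 2) * (Vinf 1 r ^ 2 - 2 * Vinf 1 r).
Definition FQ (x : R) : R := RInt Finh 0 x.
(** What the derivative of the profile must be: [F'' + x F' = F^2 - 2 F] integrated from [F'(0) = 0]
    with the factor [exp (x^2/2)]. It makes sense before differentiability is known. *)
Definition F1 (x : R) : R := exp (- x ^ 2 / 2) * FQ x.
Definition F2 (x : R) : R := - x * F1 x + Vinf 1 x ^ 2 - 2 * Vinf 1 x.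

Lemma continuous_Finh x : continuous Finh x.
Proof.
  apply cont_mult; [apply cont_ex_derive; auto_derive; exact I|].
  apply cont_minus; [apply cont_pow|apply cont_mult; [apply cont_const|]]; apply continuous_Vinf_profile.
Qed.

Lemma is_derive_FQ x : is_derive FQ x (Finh x).
Proof. apply is_derive_RInt_from0, continuous_Finh. Qed.

Lemma exp_sq_cancel x : exp (- x ^ 2 / 2) * exp (x ^ 2 / 2) = 1.
Proof. rewrite <- exp_plus; replace (- x ^ 2 / 2 + x ^ 2 / 2) with 0 by field; apply exp_0. Qed.

Lemma is_derive_F1 x : is_derive F1 x (F2 x).
Proof.
  evar_last.
  apply (is_derive_mult (K := R_AbsRing) (fun x => exp (- x ^ 2 / 2)) FQ);
    [apply is_derive_exp_opp_sq|apply is_derive_FQ|intros; apply Rmult_comm].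
  unfold plus, mult; simpl; unfold mult; simpl; unfold F2, F1, Finh.
  pose proof (exp_sq_cancel x) as E; simpl in E |- *.
  rewrite <- (Rmult_assoc (exp _) (exp _)), E; field.
Qed.

Lemma continuous_F2 x : continuous F2 x.
Proof.
  apply cont_minus; [apply cont_plus|].
  - apply cont_mult; [apply cont_ex_derive; auto_derive; exact I|eapply cont_is_derive, is_derive_F1].
  - apply cont_pow, continuous_Vinf_profile.
  - apply cont_mult; [apply cont_const|apply continuous_Vinf_profile].
Qed.

Lemma FQ_odd x : FQ (- x) = - FQ x.
Proof.
  apply RInt_0_opp_even; [apply continuous_Finh|].
  intros y; unfold Finh; rewrite Vinf_even by lra.
  replace ((- y) ^ 2) with (y ^ 2) by ring; reflexivity.
Qed.

Lemma F1_odd x : F1 (- x) = - F1 x.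
Proof. unfold F1; rewrite FQ_odd; replace ((- x) ^ 2) with (x ^ 2) by ring; ring. Qed.

(** The profile of [V lam] solves the same equation up to an error that is uniformly small on
    [[0, X]] for large [lam]; [double_growth] turns this into closeness to the twice integrated
    equation. *)
Lemma Vinf_profile_integral_pos x : 0 <= x -> Vinf 1 x = Vinf 1 0 + RInt F1 0 x.
Proof.
  intros Hx; pose proof CG_pos as HC.
  set (X := x).
  set (K := exp (X ^ 2 / 2) * (2 * CG + 4) * X * X + 2).
  assert (HK : 0 < K).
  { assert (0 <= exp (X ^ 2 / 2) * (2 * CG + 4) * X * X); [|unfold K; lra].
    apply Rmult_le_pos; [|exact Hx]; apply Rmult_le_pos; [|exact Hx];
    apply Rmult_le_pos; [left; apply exp_pos|lra]. }
  enough (main : forall eta, 0 < eta -> Rabs (Vinf 1 x - (Vinf 1 0 + RInt F1 0 x)) <= K * eta).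
  { apply Rminus_diag_uniq.
    destruct (Req_dec (Vinf 1 x - (Vinf 1 0 + RInt F1 0 x)) 0) as [e|n]; [exact e|].
    pose proof (Rabs_pos_lt _ n) as P.
    specialize (main (Rabs (Vinf 1 x - (Vinf 1 0 + RInt F1 0 x)) / (2 * K))
      ltac:(apply Rdiv_lt_0_compat; lra)).
    replace (K * (Rabs (Vinf 1 x - (Vinf 1 0 + RInt F1 0 x)) / (2 * K)))
      with (Rabs (Vinf 1 x - (Vinf 1 0 + RInt F1 0 x)) / 2) in main by (field; lra).
    lra. }
  intros eta He.
  destruct (V_profile_uniform X eta Hx He) as (L & HL & HU).
  (* Twice the threshold, because the bound on [r] involves [V (lam / 2)] as well. *)
  set (lam := 2 * L); assert (Hl : 0 < lam) by (unfold lam; lra).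
  destruct (V_profile_ode lam Hl) as (g1 & g2 & r & D1 & D2 & z & E & Hr).
  assert (cF1 : forall y, continuous F1 y) by (intros; eapply cont_is_derive, is_derive_F1).
  pose (f := fun y => V lam 1 y - RInt F1 0 y).
  assert (G : Rabs (f x - f 0) <= exp (X ^ 2 / 2) * ((2 * CG + 4) * eta) * X * (x - 0)).
  { apply (double_growth X ((2 * CG + 4) * eta) f (fun x => g1 x - F1 x)
      (fun x => exp (x ^ 2 / 2) * g1 x - FQ x)
      (fun x => V lam 1 x ^ 2 - 2 * V lam 1 x + r x - (Vinf 1 x ^ 2 - 2 * Vinf 1 x))); try (unfold X; lra).
    - apply Rmult_le_pos; lra.
    - intros y _; apply (is_derive_minus (V := R_NormedModule) (fun y => V lam 1 y) (fun y => RInt F1 0 y));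
        [apply D1|apply is_derive_RInt_from0; exact cF1].
    - intros y _; unfold F1; pose proof (exp_sq_cancel y).
      replace (exp (y ^ 2 / 2) * (g1 y - exp (- y ^ 2 / 2) * FQ y))
        with (exp (y ^ 2 / 2) * g1 y - exp (- y ^ 2 / 2) * exp (y ^ 2 / 2) * FQ y) by ring.
      rewrite H; ring.
    - rewrite z; unfold FQ; rewrite RInt_point; unfold zero; simpl; ring.
    - intros s _; evar_last.
      apply (is_derive_minus (V := R_NormedModule) (fun x => exp (x ^ 2 / 2) * g1 x) FQ).
      apply (is_derive_mult (K := R_AbsRing) (fun x => exp (x ^ 2 / 2)) g1);
        [apply is_derive_exp_sq|apply D2|intros; apply Rmult_comm].
      apply is_derive_FQ.
      unfold minus, opp, plus, mult; simpl; unfold mult; simpl; rewrite (E s); unfold Finh; simpl; field.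
    - intros s Hs; pose proof (V_profile_bounds lam s Hl); specialize (Hr s).
      pose proof (Vinf_profile_bounds s).
      pose proof (V_le_Vinf lam 1 s Hl Rlt_0_1).
      pose proof (HU lam s ltac:(unfold lam; lra) Hs).
      pose proof (HU (lam / 2) s ltac:(unfold lam; lra) Hs).
      set (a := V lam 1 s) in *; set (c := Vinf 1 s) in *.
      replace (a ^ 2 - 2 * a + r s - (c ^ 2 - 2 * c)) with ((c - a) * (2 - (a + c)) + r s) by ring.
      assert ((c - a) * (a + c) <= eta * (2 * CG)) by (apply Rmult_le_compat; lra).
      assert (0 <= (c - a) * (a + c)) by (apply Rmult_le_pos; lra).
      apply Rabs_le; lra. }
  unfold f in G; rewrite RInt_point in G; unfold zero in G; simpl in G.
  apply Rabs_le_between in G.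
  pose proof (V_le_Vinf lam 1 x Hl Rlt_0_1); pose proof (V_le_Vinf lam 1 0 Hl Rlt_0_1).
  pose proof (HU lam x ltac:(unfold lam; lra) ltac:(unfold X; lra)).
  pose proof (HU lam 0 ltac:(unfold lam; lra) ltac:(unfold X; lra)).
  replace (exp (X * (X * 1) / 2) * ((2 * CG + 4) * eta) * X * (x - 0))
    with ((K - 2) * eta) in G by (unfold K, X; simpl; ring).
  apply Rabs_le; lra.
Qed.

Lemma Vinf_profile_integral x : Vinf 1 x = Vinf 1 0 + RInt F1 0 x.
Proof.
  destruct (Rle_dec 0 x) as [h|h]; [apply Vinf_profile_integral_pos; exact h|].
  rewrite <- Vinf_even, (Vinf_profile_integral_pos (- x)) by lra; f_equal.
  apply RInt_0_opp_odd; [intros; eapply cont_is_derive, is_derive_F1|apply F1_odd].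
Qed.

Lemma is_derive_Vinf_profile x : is_derive (fun y => Vinf 1 y) x (F1 x).
Proof.
  apply (is_derive_ext (fun y => Vinf 1 0 + RInt F1 0 y)); [intros; symmetry; apply Vinf_profile_integral|].
  evar_last.
  apply (is_derive_plus (V := R_NormedModule) (fun _ => Vinf 1 0) (fun y => RInt F1 0 y)).
  apply (is_derive_const (V := R_NormedModule)).
  apply is_derive_RInt_from0; intros; eapply cont_is_derive, is_derive_F1.
  unfold plus, zero; simpl; ring.
Qed.
End Limit.

(** * The eigenvalue equation as an initial value problem *)

(** In the norm weighted by [exp (- k x)] an integration gains a factor [1/k]; this makes the Picard
    map a contraction on intervals of any length. *)
Lemma exp_weight_growth (f f' : R -> R) (X A k : R) : 0 < k -> f 0 = 0 -> 0 <= A ->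
  (forall x, 0 <= x <= X -> is_derive f x (f' x)) ->
  (forall x, 0 <= x <= X -> Rabs (f' x) <= A * exp (k * x)) ->
  forall x, 0 <= x <= X -> Rabs (f x) <= A / k * exp (k * x).
Proof.
  intros Hk f0 HA Hd Hb x Hx.
  assert (HAk : 0 <= A / k) by (apply Rdiv_le_0_compat; lra).
  pose (w := fun z => A / k * exp (k * z)).
  assert (Dw : forall z, is_derive w z (A * exp (k * z))).
  { intros z; unfold w; auto_derive; [exact I|field; lra]. }
  assert (w0 : w 0 = A / k) by (unfold w; rewrite Rmult_0_r, exp_0; ring).
  apply Rabs_le; fold (w x); split.
  - enough (w 0 + f 0 <= w x + f x) by lra.
    apply (mvt_incr (fun z => w z + f z) (fun z => A * exp (k * z) + f' z)); [lra| |].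
    + intros z Hz; apply (is_derive_plus (V := R_NormedModule) w f); [apply Dw|apply Hd; lra].
    + intros z Hz; specialize (Hb z ltac:(lra)); apply Rabs_le_between in Hb; lra.
  - enough (w 0 - f 0 <= w x - f x) by lra.
    apply (mvt_incr (fun z => w z - f z) (fun z => A * exp (k * z) - f' z)); [lra| |].
    + intros z Hz; apply (is_derive_minus (V := R_NormedModule) w f); [apply Dw|apply Hd; lra].
    + intros z Hz; specialize (Hb z ltac:(lra)); apply Rabs_le_between in Hb; lra.
Qed.

Lemma bounded_on (f : R -> R) a b : a <= b -> (forall x, continuous f x) ->
  exists M, 0 < M /\ forall x, a <= x <= b -> Rabs (f x) <= M.
Proof.
  intros Hab c.
  destruct (continuity_ab_maj (fun x => Rabs (f x)) a b Hab) as [m [Hm _]].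
  { intros x _; apply continuity_pt_filterlim, (cont_comp f Rabs); [apply c|].
    apply continuity_pt_filterlim, Rcontinuity_abs. }
  exists (Rabs (f m) + 1); split; [pose proof (Rabs_pos (f m)); lra|].
  intros x Hx; specialize (Hm x Hx); lra.
Qed.

Lemma positive_on (f : R -> R) a b : a <= b -> (forall x, continuous f x) ->
  (forall x, a <= x <= b -> 0 < f x) -> exists c, 0 < c /\ forall x, a <= x <= b -> c <= f x.
Proof.
  intros Hab c Hp.
  destruct (continuity_ab_min f a b Hab) as [m [Hm Hmab]].
  { intros x _; apply continuity_pt_filterlim, c. }
  exists (f m); split; auto.
Qed.

Section ODE.
Variables (F : R -> R) (B : R).
Hypothesis (cF : forall x, continuous F x) (bF : forall x, 0 <= F x <= B)
  (eF : forall x, F (- x) = F x).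

(** The equation [L^F u = - mu u] solved for the second derivative; fixing the even solution with
    [u 0 = 1] leaves [mu] as the only shooting parameter. *)
Definition sol (mu : R) (u u1 : R -> R) : Prop :=
  (forall x, is_derive u x (u1 x)) /\
  (forall x, is_derive u1 x (x * u1 x + 2 * (F x - mu) * u x)) /\
  u 0 = 1 /\ u1 0 = 0 /\ (forall x, u (- x) = u x).

(** * Existence of the even solution by Picard iteration *)

Section Picard.
Variable mu : R.

Definition pinh (u : R -> R) (r : R) : R := 2 * exp (- r ^ 2 / 2) * (F r - mu) * u r.
Definition pin (u : R -> R) (y : R) : R := RInt (pinh u) 0 y.
Definition pT1 (u : R -> R) (y : R) : R := exp (y ^ 2 / 2) * pin u y.
(** The equation in the form [(exp (- x^2/2) u')' = 2 exp (- x^2/2) (F - mu) u], integrated twice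
    from 0; its fixed points are the solutions. *)
Definition pT (u : R -> R) (x : R) : R := 1 + RInt (pT1 u) 0 x.

Definition ceven (u : R -> R) : Prop := (forall x, continuous u x) /\ (forall x, u (- x) = u x).

Lemma continuous_pinh u x : (forall x, continuous u x) -> continuous (pinh u) x.
Proof.
  intros c; apply cont_mult; [|apply c]; apply cont_mult.
  - apply cont_ex_derive; auto_derive; exact I.
  - apply cont_minus; [apply cF|apply cont_const].
Qed.

Lemma is_derive_pin u x : (forall x, continuous u x) -> is_derive (pin u) x (pinh u x).
Proof. intros c; apply (is_derive_RInt_from0 (pinh u)); intros; apply continuous_pinh; exact c. Qed.

Lemma is_derive_pT1 u x : (forall x, continuous u x) ->
  is_derive (pT1 u) x (x * pT1 u x + 2 * (F x - mu) * u x).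
Proof.
  intros c; evar_last.
  apply (is_derive_mult (K := R_AbsRing) (fun y => exp (y ^ 2 / 2)) (pin u));
    [apply is_derive_exp_sq|apply is_derive_pin; exact c|intros; apply Rmult_comm].
  unfold plus, mult; simpl; unfold mult; simpl; unfold pT1, pinh.
  pose proof (exp_sq_cancel x) as E; simpl in E |- *.
  replace (exp (x * (x * 1) / 2) * (2 * exp (- (x * (x * 1)) / 2) * (F x - mu) * u x))
    with (exp (- (x * (x * 1)) / 2) * exp (x * (x * 1) / 2) * (2 * (F x - mu) * u x)) by ring.
  rewrite E; ring.
Qed.

Lemma is_derive_pT u x : (forall x, continuous u x) -> is_derive (pT u) x (pT1 u x).
Proof.
  intros c; evar_last.
  apply (is_derive_plus (V := R_NormedModule) (fun _ => 1) (fun x => RInt (pT1 u) 0 x)).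
  apply (is_derive_const (V := R_NormedModule)).
  apply is_derive_RInt_from0; intros; eapply cont_is_derive, is_derive_pT1; exact c.
  unfold plus, zero; simpl; ring.
Qed.

Lemma ceven_pT u : ceven u -> ceven (pT u).
Proof.
  intros [c e]; split; [intros; eapply cont_is_derive, is_derive_pT; exact c|].
  intros x; unfold pT; f_equal.
  apply RInt_0_opp_odd; [intros; eapply cont_is_derive, is_derive_pT1; exact c|].
  intros y; unfold pT1, pin.
  rewrite RInt_0_opp_even; [|intros; apply continuous_pinh; exact c|].
  - replace ((- y) ^ 2) with (y ^ 2) by ring; ring.
  - intros r; unfold pinh; rewrite eF, e; replace ((- r) ^ 2) with (r ^ 2) by ring; reflexivity.
Qed.

Definition pK (X : R) : R := 2 * (B + Rabs mu) * exp (X ^ 2 / 2).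
(** Two integrations in the weighted norm give the contraction factor [pK / pk^2], at most 1/2 for
    this weight. *)
Definition pk (X : R) : R := 2 * pK X + 1.

Lemma pK_ge0 X : 0 <= pK X.
Proof.
  unfold pK; pose proof (exp_pos (X ^ 2 / 2)); pose proof (Rabs_pos mu); pose proof (bF 0).
  apply Rmult_le_pos; lra.
Qed.

Lemma exp_opp_sq_le1 x : 0 < exp (- x ^ 2 / 2) <= 1.
Proof.
  split; [apply exp_pos|]; rewrite <- exp_0; apply exp_le_compat; pose proof (pow2_ge_0 x); lra.
Qed.

Lemma pinh_bound w x A : Rabs (w x) <= A -> Rabs (pinh w x) <= 2 * (B + Rabs mu) * A.
Proof.
  intros Hw; unfold pinh; pose proof (exp_opp_sq_le1 x); pose proof (bF x); pose proof (Rabs_pos mu).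
  rewrite !Rabs_mult, (Rabs_pos_eq 2), (Rabs_pos_eq (exp _)) by lra.
  assert (Rabs (F x - mu) <= B + Rabs mu).
  { unfold Rminus; eapply Rle_trans; [apply Rabs_triang|]; rewrite Rabs_Ropp, (Rabs_pos_eq (F x)); lra. }
  pose proof (Rabs_pos (F x - mu)).
  apply Rmult_le_compat; [|apply Rabs_pos| |exact Hw].
  - apply Rmult_le_pos; [lra|exact H3].
  - apply Rmult_le_compat; try lra.
Qed.

Lemma pT_contract X e w1 w2 : 0 <= X -> 0 <= e ->
  (forall x, continuous w1 x) -> (forall x, continuous w2 x) ->
  (forall x, 0 <= x <= X -> Rabs (w1 x - w2 x) <= e * exp (pk X * x)) ->
  forall x, 0 <= x <= X -> Rabs (pT w1 x - pT w2 x) <= e / 2 * exp (pk X * x).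
Proof.
  intros HX He c1 c2 Hw.
  pose proof (pK_ge0 X) as HK.
  assert (Hk : 0 < pk X) by (unfold pk; lra).
  pose proof (Rabs_pos mu); pose proof (bF 0).
  set (m := 2 * (B + Rabs mu)).
  assert (Hm : 0 <= m) by (unfold m; lra).
  assert (P : forall x, 0 <= x <= X -> Rabs (pin w1 x - pin w2 x) <= m * e / pk X * exp (pk X * x)).
  { apply (exp_weight_growth (fun x => pin w1 x - pin w2 x) (fun x => pinh w1 x - pinh w2 x)); auto.
    - unfold pin; rewrite !RInt_point; unfold zero; simpl; ring.
    - apply Rmult_le_pos; lra.
    - intros x Hx; apply (is_derive_minus (V := R_NormedModule) (pin w1) (pin w2)); apply is_derive_pin; auto.
    - intros x Hx.
      replace (pinh w1 x - pinh w2 x) with (pinh (fun y => w1 y - w2 y) x) by (unfold pinh; ring).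
      rewrite Rmult_assoc; apply (pinh_bound (fun y => w1 y - w2 y)); apply Hw; exact Hx. }
  intros x Hx.
  apply Rle_trans with (exp (X ^ 2 / 2) * (m * e / pk X) / pk X * exp (pk X * x)).
  - revert x Hx.
    apply (exp_weight_growth (fun x => pT w1 x - pT w2 x) (fun x => pT1 w1 x - pT1 w2 x)); auto.
    + unfold pT; rewrite !RInt_point; unfold zero; simpl; ring.
    + apply Rmult_le_pos; [left; apply exp_pos|]; apply Rdiv_le_0_compat; [apply Rmult_le_pos; lra|lra].
    + intros x Hx; apply (is_derive_minus (V := R_NormedModule) (pT w1) (pT w2)); apply is_derive_pT; auto.
    + intros x Hx; specialize (P x Hx); pose proof (exp_sq_bounds X x Hx).
      replace (pT1 w1 x - pT1 w2 x) with (exp (x ^ 2 / 2) * (pin w1 x - pin w2 x)) by (unfold pT1; ring).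
      rewrite Rabs_mult, (Rabs_pos_eq (exp _)) by lra.
      rewrite Rmult_assoc; apply Rmult_le_compat; [lra|apply Rabs_pos|lra|exact P].
  - apply Rmult_le_compat_r; [left; apply exp_pos|].
    replace (exp (X ^ 2 / 2) * (m * e / pk X) / pk X) with (e * (pK X / (pk X * pk X)))
      by (unfold pK, m; field; lra).
    unfold Rdiv at 2; apply Rmult_le_compat_l; [lra|].
    apply Rmult_le_reg_r with (pk X * pk X); [nra|].
    unfold Rdiv; rewrite Rmult_assoc, Rinv_l by nra; unfold pk; nra.
Qed.

Fixpoint pv (n : nat) : R -> R := match n with O => fun _ => 1 | S n => pT (pv n) end.

Lemma ceven_pv n : ceven (pv n).
Proof.
  induction n as [|n IH]; [split; intros; [apply cont_const|reflexivity]|].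
  apply ceven_pT; exact IH.
Qed.

Lemma pv_step X n : 0 <= X -> forall x, 0 <= x <= X ->
  Rabs (pv (S n) x - pv n x) <= (/ 2) ^ n * exp (pk X * x).
Proof.
  intros HX; induction n as [|n IH].
  - intros x Hx; pose proof (pK_ge0 X).
    assert (1 <= exp (pk X * x)).
    { rewrite <- exp_0; apply exp_le_compat; apply Rmult_le_pos; [unfold pk|]; lra. }
    (* [pT] sends 0 to the constant 1, so the first step is also an instance of the contraction. *)
    assert (K := pT_contract X 1 (fun _ => 1) (fun _ => 0) HX ltac:(lra)
      (fun x => cont_const 1 x) (fun x => cont_const 0 x)).
    assert (Hz : pT (fun _ => 0) x = 1).
    { unfold pT; rewrite (RInt_ext _ (fun _ => 0)).
      rewrite RInt_const_R; ring.
      intros y _; unfold pT1, pin; rewrite (RInt_ext _ (fun _ => 0)).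
      rewrite RInt_const_R; Req; ring.
      intros r _; unfold pinh; Req; ring. }
    change (Rabs (pT (fun _ => 1) x - 1) <= (/ 2) ^ 0 * exp (pk X * x)); rewrite <- Hz at 1.
    eapply Rle_trans; [apply K; [|exact Hx]|simpl; lra].
    intros y Hy; rewrite Rminus_0_r, Rabs_R1, Rmult_1_l.
    rewrite <- exp_0; apply exp_le_compat; apply Rmult_le_pos; [unfold pk|]; lra.
  - intros x Hx.
    replace ((/ 2) ^ S n) with ((/ 2) ^ n / 2) by (simpl; field).
    change (Rabs (pT (pv (S n)) x - pT (pv n) x) <= (/ 2) ^ n / 2 * exp (pk X * x)).
    apply (pT_contract X); auto; try apply ceven_pv.
    apply pow_le; lra.
Qed.

Lemma pv_cauchy X n m x : 0 <= X -> 0 <= x <= X ->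
  Rabs (pv (n + m) x - pv n x) <= 2 * (/ 2) ^ n * exp (pk X * x).
Proof.
  intros HX Hx.
  assert (K : Rabs (pv (n + m) x - pv n x) <= (2 * (/ 2) ^ n - 2 * (/ 2) ^ (n + m)) * exp (pk X * x)).
  { induction m as [|m IH].
    - rewrite Nat.add_0_r, Rminus_diag, Rabs_R0, Rminus_diag, Rmult_0_l; lra.
    - rewrite Nat.add_succ_r.
      replace (pv (S (n + m)) x - pv n x) with ((pv (S (n + m)) x - pv (n + m) x) + (pv (n + m) x - pv n x)) by ring.
      eapply Rle_trans; [apply Rabs_triang|].
      pose proof (pv_step X (n + m) HX x Hx).
      replace ((/ 2) ^ S (n + m)) with ((/ 2) ^ (n + m) / 2) by (simpl; field).
      lra. }
  eapply Rle_trans; [exact K|]; apply Rmult_le_compat_r; [left; apply exp_pos|].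
  assert (0 <= (/ 2) ^ (n + m)) by (apply pow_le; lra); lra.
Qed.

Definition pu (x : R) : R := real (Lim_seq (fun n => pv n x)).

Lemma pow_half_small e : 0 < e -> exists N, forall n, (N <= n)%nat -> (/ 2) ^ n < e.
Proof.
  intros He; destruct (pow_lt_1_zero (/ 2) ltac:(rewrite Rabs_pos_eq; lra) e He) as [N HN].
  exists N; intros n Hn; specialize (HN n Hn); apply Rabs_def2 in HN; lra.
Qed.

Lemma pu_lim_pos x : 0 <= x -> is_lim_seq (fun n => pv n x) (pu x).
Proof.
  intros Hx; apply Lim_seq_correct'.
  apply ex_lim_seq_cauchy_corr; intros [e He]; simpl.
  set (M := exp (pk x * x)); assert (HM : 0 < M) by apply exp_pos.
  destruct (pow_half_small (e / (4 * M))) as [N HN]; [apply Rdiv_lt_0_compat; lra|].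
  exists N; intros n m Hn Hm.
  specialize (HN N (le_n N)).
  replace (pv n x - pv m x) with ((pv n x - pv N x) - (pv m x - pv N x)) by ring.
  unfold Rminus at 1; eapply Rle_lt_trans; [apply Rabs_triang|]; rewrite Rabs_Ropp.
  pose proof (pv_cauchy x N (n - N) x Hx ltac:(lra)) as H1.
  pose proof (pv_cauchy x N (m - N) x Hx ltac:(lra)) as H2.
  replace (N + (n - N))%nat with n in H1 by lia.
  replace (N + (m - N))%nat with m in H2 by lia.
  fold M in H1, H2.
  assert ((/ 2) ^ N * M < e / (4 * M) * M) by (apply Rmult_lt_compat_r; lra).
  replace (e / (4 * M) * M) with (e / 4) in H by (field; lra).
  lra.
Qed.

Lemma pu_even x : pu (- x) = pu x.
Proof.
  unfold pu; f_equal; apply Lim_seq_ext; intros n; apply ceven_pv.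
Qed.

Lemma pu_approx X n x : 0 <= X -> 0 <= x <= X ->
  Rabs (pu x - pv n x) <= 2 * (/ 2) ^ n * exp (pk X * x).
Proof.
  intros HX Hx; set (K := 2 * (/ 2) ^ n * exp (pk X * x)).
  pose proof (pu_lim_pos x (proj1 Hx)) as L.
  apply (is_lim_seq_incr_n _ n) in L.
  apply Rabs_le; split.
  - enough (pv n x - K <= pu x) by lra.
    apply (is_lim_seq_le (fun _ => pv n x - K) (fun k => pv (k + n) x) (Finite _) (Finite _));
      [|apply is_lim_seq_const|exact L].
    intros k; pose proof (pv_cauchy X n k x HX Hx) as H; rewrite Nat.add_comm in H.
    apply Rabs_le_between in H; unfold K; lra.
  - enough (pu x <= pv n x + K) by lra.
    apply (is_lim_seq_le (fun k => pv (k + n) x) (fun _ => pv n x + K) (Finite _) (Finite _));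
      [|exact L|apply is_lim_seq_const].
    intros k; pose proof (pv_cauchy X n k x HX Hx) as H; rewrite Nat.add_comm in H.
    apply Rabs_le_between in H; unfold K; lra.
Qed.

Lemma pv_lip X : 0 <= X -> exists L, 0 < L /\ forall n x y, 0 <= x <= y -> y <= X ->
  Rabs (pv n y - pv n x) <= L * (y - x).
Proof.
  intros HX; set (M := 3 * exp (pk X * X)).
  pose proof (Rabs_pos mu); pose proof (bF 0); pose proof (exp_pos (pk X * X)).
  assert (Hk : 0 < pk X) by (pose proof (pK_ge0 X); unfold pk; lra).
  assert (bM : forall n x, 0 <= x <= X -> Rabs (pv n x) <= M).
  { intros n x Hx; pose proof (pv_cauchy X 0 n x HX Hx) as H2; simpl in H2.
    assert (h1 : exp (pk X * x) <= exp (pk X * X)) by (apply exp_le_compat, Rmult_le_compat_l; lra).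
    assert (h2 : 1 <= exp (pk X * X)).
    { rewrite <- exp_0; apply exp_le_compat; apply Rmult_le_pos; lra. }
    apply Rabs_le_between in H2; apply Rabs_le; unfold M; lra. }
  set (P := 2 * (B + Rabs mu) * M).
  assert (HP : 0 <= P) by (unfold P, M; apply Rmult_le_pos; lra).
  exists (exp (X ^ 2 / 2) * (P * X) + 1); split.
  { assert (0 <= exp (X ^ 2 / 2) * (P * X)); [|lra].
    apply Rmult_le_pos; [left; apply exp_pos|apply Rmult_le_pos; lra]. }
  intros n x y Hxy Hy.
  destruct n as [|n].
  { change (Rabs (1 - 1) <= (exp (X ^ 2 / 2) * (P * X) + 1) * (y - x)); rewrite Rminus_diag, Rabs_R0; apply Rmult_le_pos; [|lra].
    assert (0 <= exp (X ^ 2 / 2) * (P * X)); [|lra].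
    apply Rmult_le_pos; [left; apply exp_pos|apply Rmult_le_pos; lra]. }
  apply Rle_trans with (exp (X ^ 2 / 2) * (P * X) * (y - x)); [|lra].
  assert (cn : forall x, continuous (pv n) x) by apply ceven_pv.
  apply (abs_growth (pv (S n)) (pT1 (pv n)) X); auto.
  - apply Rmult_le_pos; [left; apply exp_pos|apply Rmult_le_pos; lra].
  - intros z _; apply is_derive_pT; exact cn.
  - intros z Hz; unfold pT1; pose proof (exp_sq_bounds X z Hz).
    rewrite Rabs_mult, (Rabs_pos_eq (exp _)) by lra.
    apply Rmult_le_compat; [lra|apply Rabs_pos|lra|].
    assert (Q : Rabs (pin (pv n) z - pin (pv n) 0) <= P * (z - 0)).
    { apply (abs_growth (pin (pv n)) (pinh (pv n)) X); auto; try lra.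
      - intros r _; apply is_derive_pin; exact cn.
      - intros r Hr; apply pinh_bound, bM; exact Hr. }
    replace (pin (pv n) 0) with 0 in Q by (unfold pin; rewrite RInt_point; reflexivity).
    rewrite !Rminus_0_r in Q; eapply Rle_trans; [exact Q|apply Rmult_le_compat_l; lra].
Qed.

Lemma continuous_pu x : continuous pu x.
Proof.
  apply continuous_even_lip; [apply pu_even|].
  intros X HX; destruct (pv_lip X HX) as (L & HL & H); exists L; split; [exact HL|].
  intros a b Hab Hb.
  pose proof (pu_lim_pos a ltac:(lra)) as La; pose proof (pu_lim_pos b ltac:(lra)) as Lb.
  pose proof (is_lim_seq_minus' _ _ _ _ Lb La) as Ld.
  apply Rabs_le; split.
  - apply (is_lim_seq_le (fun _ => - (L * (b - a))) (fun n => pv n b - pv n a) (Finite _) (Finite _));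
      [|apply is_lim_seq_const|exact Ld].
    intros n; specialize (H n a b Hab Hb); apply Rabs_le_between in H; lra.
  - apply (is_lim_seq_le (fun n => pv n b - pv n a) (fun _ => L * (b - a)) (Finite _) (Finite _));
      [|exact Ld|apply is_lim_seq_const].
    intros n; specialize (H n a b Hab Hb); apply Rabs_le_between in H; lra.
Qed.

Lemma pu_fix x : pu x = pT pu x.
Proof.
  enough (K : forall x, 0 <= x -> pu x = pT pu x).
  { destruct (Rle_dec 0 x) as [h|h]; [apply K; exact h|].
    rewrite <- (proj2 (ceven_pT pu (conj continuous_pu pu_even)) x), <- pu_even; apply K; lra. }
  clear x; intros x Hx.
  assert (L1 := pu_lim_pos x Hx); apply is_lim_seq_incr_1 in L1.
  set (M := exp (pk x * x)); assert (HM : 0 < M) by apply exp_pos.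
  assert (L2 : is_lim_seq (fun n => pv (S n) x) (pT pu x)).
  { apply is_lim_seq_spec; intros [e He]; simpl.
    destruct (pow_half_small (e / M)) as [N HN]; [apply Rdiv_lt_0_compat; lra|].
    exists N; intros n Hn; specialize (HN n Hn).
    pose proof (pT_contract x (2 * (/ 2) ^ n) (pv n) pu Hx) as C.
    eapply Rle_lt_trans; [apply C; [|apply ceven_pv|apply continuous_pu| |lra]|].
    - assert (0 <= (/ 2) ^ n) by (apply pow_le; lra); lra.
    - intros y Hy; rewrite Rabs_minus_sym; apply pu_approx; auto.
    - fold M; replace (2 * (/ 2) ^ n / 2) with ((/ 2) ^ n) by field.
      apply Rlt_le_trans with (e / M * M); [apply Rmult_lt_compat_r; lra|right; field; lra]. }
  apply is_lim_seq_unique in L1; apply is_lim_seq_unique in L2.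
  rewrite L1 in L2; injection L2; auto.
Qed.

Lemma sol_exists : exists u u1, sol mu u u1.
Proof.
  exists pu, (pT1 pu); repeat apply conj.
  - intros x; apply (is_derive_ext (pT pu)); [intros; symmetry; apply pu_fix|].
    apply is_derive_pT, continuous_pu.
  - intros x; apply is_derive_pT1, continuous_pu.
  - rewrite pu_fix; unfold pT; rewrite RInt_point; unfold zero; simpl; ring.
  - unfold pT1, pin; rewrite RInt_point; unfold zero; simpl; ring.
  - apply pu_even.
Qed.
End Picard.

(** The energy [u^2 + u1^2] cannot decay faster than [exp (- K x)], and it equals 1 at 0. *)
Lemma sol_energy_lower mu u u1 x1 : sol mu u u1 -> 0 <= x1 -> ~ (u x1 = 0 /\ u1 x1 = 0).
Proof.
  intros (D & D1 & i0 & i1 & _) Hx [z z1].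
  pose proof (Rabs_pos mu); pose proof (bF 0).
  set (K := 1 + 2 * (B + Rabs mu) + 2 * x1).
  pose (E := fun x => (u x ^ 2 + u1 x ^ 2) * exp (K * x)).
  assert (H1 : E 0 <= E x1).
  { apply (mvt_incr E (fun x => (2 * u x * u1 x + 2 * u1 x * (x * u1 x + 2 * (F x - mu) * u x)
        + K * (u x ^ 2 + u1 x ^ 2)) * exp (K * x))); auto.
    - intros x _; unfold E; evar_last.
      apply (is_derive_mult (K := R_AbsRing) (fun x => u x ^ 2 + u1 x ^ 2) (fun x => exp (K * x)));
        [|auto_derive; [exact I|reflexivity]|intros; apply Rmult_comm].
      apply (is_derive_plus (V := R_NormedModule) (fun x => u x ^ 2) (fun x => u1 x ^ 2));
        apply (is_derive_pow _ 2); [apply D|apply D1].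
      unfold plus, mult; simpl; unfold mult; simpl; Req; ring.
    - intros x Hx'; apply Rmult_le_pos; [|left; apply exp_pos].
      pose proof (bF x).
      assert (hF : Rabs (1 + 2 * (F x - mu)) <= 1 + 2 * (B + Rabs mu)).
      { apply Rabs_le; pose proof (Rle_abs mu); pose proof (Rle_abs (- mu)); rewrite Rabs_Ropp in *; lra. }
      set (a := 1 + 2 * (F x - mu)) in *.
      replace (2 * u x * u1 x + 2 * u1 x * (x * u1 x + 2 * (F x - mu) * u x))
        with (2 * a * (u x * u1 x) + 2 * x * u1 x ^ 2) by (unfold a; ring).
      assert (h2 : Rabs (2 * (u x * u1 x)) <= u x ^ 2 + u1 x ^ 2).
      { apply Rabs_le; pose proof (pow2_ge_0 (u x + u1 x)); pose proof (pow2_ge_0 (u x - u1 x)); lra. }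
      assert (h3 : Rabs (a * (2 * (u x * u1 x))) <= (1 + 2 * (B + Rabs mu)) * (u x ^ 2 + u1 x ^ 2)).
      { rewrite Rabs_mult; apply Rmult_le_compat; auto; apply Rabs_pos. }
      apply Rabs_le_between in h3.
      pose proof (pow2_ge_0 (u x)); pose proof (pow2_ge_0 (u1 x)).
      assert (0 <= x * u1 x ^ 2) by (apply Rmult_le_pos; lra).
      assert (0 <= 2 * x1 * (u x ^ 2 + u1 x ^ 2)) by (apply Rmult_le_pos; lra).
      unfold K; lra. }
  unfold E in H1; rewrite i0, i1, z, z1, Rmult_0_r, exp_0 in H1; lra.
Qed.

(** Gronwall for the energy of the difference, driven by the forcing [- 2 (nu - mu) u]. The
    derivative is controlled too, because the shooting perturbs a Wronskian. *)
Lemma sol_continuous_dependence mu u u1 X eta : sol mu u u1 -> 0 <= X -> 0 < eta ->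
  exists d, 0 < d /\ forall nu w w1, sol nu w w1 -> Rabs (nu - mu) < d ->
    forall x, 0 <= x <= X -> Rabs (w x - u x) <= eta /\ Rabs (w1 x - u1 x) <= eta.
Proof.
  intros (D & D1 & i0 & i1 & _) HX He.
  pose proof (Rabs_pos mu); pose proof (bF 0).
  destruct (bounded_on u 0 X HX) as (M & HM & bu); [intros; eapply cont_is_derive, D|].
  set (K := 2 + 2 * (B + (Rabs mu + 1)) + 2 * X).
  set (G := 4 * M ^ 2 * X * exp (K * X) + 1).
  assert (HG : 1 <= G).
  { assert (0 <= 4 * M ^ 2 * X * exp (K * X)); [|unfold G; lra].
    apply Rmult_le_pos; [|left; apply exp_pos]; apply Rmult_le_pos; [pose proof (pow2_ge_0 M)|]; lra. }
  exists (Rmin 1 (eta / G)); split; [apply Rmin_glb_lt; [lra|apply Rdiv_lt_0_compat; lra]|].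
  intros nu w w1 (W & W1 & j0 & j1 & _) Hnu x Hx.
  pose proof (Rmin_l 1 (eta / G)); pose proof (Rmin_r 1 (eta / G)).
  set (e := nu - mu) in *.
  pose (E := fun x => ((w x - u x) ^ 2 + (w1 x - u1 x) ^ 2) * exp (- K * x)).
  assert (HK : 0 <= K) by (unfold K; lra).
  assert (H3 : E x <= E 0 + 4 * e ^ 2 * M ^ 2 * (x - 0)).
  { apply (mvt_le E (fun x => (2 * (w x - u x) * (w1 x - u1 x)
       + 2 * (w1 x - u1 x) * ((x * w1 x + 2 * (F x - nu) * w x) - (x * u1 x + 2 * (F x - mu) * u x))
        - K * ((w x - u x) ^ 2 + (w1 x - u1 x) ^ 2)) * exp (- K * x))); [lra| |].
    - intros z _; unfold E; evar_last.
      apply (is_derive_mult (K := R_AbsRing) (fun x => (w x - u x) ^ 2 + (w1 x - u1 x) ^ 2) (fun x => exp (- K * x)));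
        [|auto_derive; [exact I|reflexivity]|intros; apply Rmult_comm].
      apply (is_derive_plus (V := R_NormedModule) (fun x => (w x - u x) ^ 2) (fun x => (w1 x - u1 x) ^ 2));
        [apply (is_derive_pow (fun x => w x - u x) 2)|apply (is_derive_pow (fun x => w1 x - u1 x) 2)].
      apply (is_derive_minus (V := R_NormedModule) w u); [apply W|apply D].
      apply (is_derive_minus (V := R_NormedModule) w1 u1); [apply W1|apply D1].
      unfold minus, opp, plus, mult; simpl; unfold mult; simpl; Req; ring.
    - intros z Hz.
      set (p := w z - u z); set (p1 := w1 z - u1 z).
      replace ((z * w1 z + 2 * (F z - nu) * w z) - (z * u1 z + 2 * (F z - mu) * u z))
        with (z * p1 + 2 * (F z - nu) * p - 2 * e * u z) by (unfold p, p1, e; ring).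
      specialize (bu z ltac:(lra)); pose proof (bF z) as bz.
      assert (hnu : Rabs nu <= Rabs mu + 1).
      { replace nu with (mu + e) by (unfold e; ring); pose proof (Rabs_triang mu e); lra. }
      assert (hF : Rabs (1 + 2 * (F z - nu)) <= 1 + 2 * (B + (Rabs mu + 1))).
      { apply Rabs_le; pose proof (Rle_abs nu); pose proof (Rle_abs (- nu)); rewrite Rabs_Ropp in *; lra. }
      set (a := 1 + 2 * (F z - nu)) in *.
      assert (h2 : Rabs (2 * (p * p1)) <= p ^ 2 + p1 ^ 2).
      { apply Rabs_le; pose proof (pow2_ge_0 (p + p1)); pose proof (pow2_ge_0 (p - p1)); lra. }
      assert (h3 : Rabs (a * (2 * (p * p1))) <= (1 + 2 * (B + (Rabs mu + 1))) * (p ^ 2 + p1 ^ 2)).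
      { rewrite Rabs_mult; apply Rmult_le_compat; auto; apply Rabs_pos. }
      apply Rabs_le_between in h3.
      pose proof (pow2_ge_0 p); pose proof (pow2_ge_0 p1).
      assert (h4 : z * p1 ^ 2 <= X * (p ^ 2 + p1 ^ 2)) by (apply Rmult_le_compat; lra).
      assert (h5 : - (4 * e * u z * p1) <= p1 ^ 2 + 4 * e ^ 2 * M ^ 2).
      { assert ((e * u z) ^ 2 <= e ^ 2 * M ^ 2).
        { rewrite Rpow_mult_distr; apply Rmult_le_compat_l; [apply pow2_ge_0|].
          apply pow_maj_Rabs; exact bu. }
        pose proof (pow2_ge_0 (p1 + 2 * (e * u z))); lra. }
      assert (h6 : 2 * p * p1 + 2 * p1 * (z * p1 + 2 * (F z - nu) * p - 2 * e * u z) - K * (p ^ 2 + p1 ^ 2)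
               <= 4 * e ^ 2 * M ^ 2).
      { replace (2 * p * p1 + 2 * p1 * (z * p1 + 2 * (F z - nu) * p - 2 * e * u z))
          with (a * (2 * (p * p1)) + 2 * (z * p1 ^ 2) + - (4 * e * u z * p1)) by (unfold a; ring).
        unfold K; lra. }
      assert (he : 0 < exp (- K * z) <= 1).
      { split; [apply exp_pos|]; rewrite <- exp_0; apply exp_le_compat.
        assert (0 <= K * z) by (apply Rmult_le_pos; lra); lra. }
      assert (0 <= 4 * e ^ 2 * M ^ 2) by (pose proof (pow2_ge_0 e); pose proof (pow2_ge_0 M); nra).
      nra. }
  unfold E in H3; rewrite i0, i1, j0, j1, Rmult_0_r, exp_0, Rminus_0_r in H3.
  set (S := (w x - u x) ^ 2 + (w1 x - u1 x) ^ 2) in *.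
  assert (H4 : S <= e ^ 2 * G).
  { assert (E1 : exp (- K * x) * exp (K * x) = 1).
    { rewrite <- exp_plus; replace (- K * x + K * x) with 0 by ring; apply exp_0. }
    assert (H5 : S * exp (- K * x) * exp (K * x) <= 4 * e ^ 2 * M ^ 2 * x * exp (K * x)).
    { apply Rmult_le_compat_r; [left; apply exp_pos|]; lra. }
    rewrite Rmult_assoc, E1, Rmult_1_r in H5.
    assert (x * exp (K * x) <= X * exp (K * X)).
    { apply Rmult_le_compat; [lra|left; apply exp_pos|lra|].
      apply exp_le_compat, Rmult_le_compat_l; lra. }
    assert (0 <= 4 * e ^ 2 * M ^ 2) by (pose proof (pow2_ge_0 e); pose proof (pow2_ge_0 M); nra).
    pose proof (pow2_ge_0 e); unfold G; nra. }
  assert (H6 : e ^ 2 * G <= eta ^ 2).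
  { assert (h : Rabs e * G <= eta).
    { replace eta with (eta / G * G) by (field; lra); apply Rmult_le_compat_r; lra. }
    rewrite <- (pow2_abs e); pose proof (Rabs_pos e).
    assert ((Rabs e * G) ^ 2 <= eta ^ 2) by (apply pow_incr; nra).
    assert (Rabs e ^ 2 * G <= Rabs e ^ 2 * G * G).
    { assert (0 <= Rabs e ^ 2 * G) by (apply Rmult_le_pos; [apply pow2_ge_0|lra]); nra. }
    replace ((Rabs e * G) ^ 2) with (Rabs e ^ 2 * G * G) in H7 by ring; lra. }
  pose proof (pow2_ge_0 (w x - u x)); pose proof (pow2_ge_0 (w1 x - u1 x)).
  assert (Q : forall c, c ^ 2 <= eta ^ 2 -> Rabs c <= eta).
  { intros c Hc; apply Rabs_le; nra. }
  unfold S in H4; split; apply Q; lra.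
Qed.
End ODE.

(** * Sturm comparison and the ground state *)

Lemma first_zero (f : R -> R) a b : (forall x, continuous f x) -> a <= b -> 0 < f a -> f b <= 0 ->
  exists c, a < c <= b /\ f c = 0 /\ forall x, a <= x < c -> 0 < f x.
Proof.
  intros c Hab Ha Hb.
  pose (E := fun x => a <= x <= b /\ forall y, a <= y <= x -> 0 < f y).
  assert (near : forall x, 0 < f x -> exists d, 0 < d /\ forall y, Rabs (y - x) < d -> 0 < f y).
  { intros x Hx; pose proof (c x) as cx; apply continuity_pt_filterlim in cx.
    destruct (cx (f x) Hx) as [d [Hd H]]; exists d; split; [exact Hd|].
    intros y Hy; destruct (Req_dec x y) as [<-|n]; [exact Hx|].
    assert (h : Rabs (f y - f x) < f x) by (apply H; split; [split; [exact I|exact n]|exact Hy]).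
    apply Rabs_def2 in h; lra. }
  destruct (completeness E) as [m [Hub Hlub]].
  { exists b; intros x [Hx _]; lra. }
  { exists a; split; [lra|]; intros y Hy; replace y with a by lra; exact Ha. }
  assert (Ham : a <= m) by (apply Hub; split; [lra|]; intros y Hy; replace y with a by lra; exact Ha).
  assert (Hmb : m <= b) by (apply Hlub; intros x [Hx _]; lra).
  assert (Hin : forall x, a <= x < m -> 0 < f x).
  { intros x Hx; apply Rnot_le_lt; intros h.
    assert (m <= x); [|lra].
    apply Hlub; intros y [Hy Hpos]; apply Rnot_lt_le; intros hy.
    specialize (Hpos x ltac:(lra)); lra. }
  assert (Hm0 : f m = 0).
  { destruct (Rtotal_order (f m) 0) as [h|[h|h]]; [|exact h|].
    - destruct (Req_dec a m) as [<-|n]; [lra|].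
      pose proof (c m) as cm; apply continuity_pt_filterlim in cm.
      destruct (cm (- f m) ltac:(lra)) as [d [Hd H]].
      set (y := Rmax a (m - d / 2)).
      assert (a <= y) by apply Rmax_l.
      assert (m - d / 2 <= y) by apply Rmax_r.
      assert (y < m) by (apply Rmax_lub_lt; lra).
      specialize (Hin y ltac:(lra)).
      assert (hy : Rabs (f y - f m) < - f m).
      { apply H; split; [split; [exact I|lra]|]; unfold dist; simpl; unfold R_dist; apply Rabs_def1; lra. }
      apply Rabs_def2 in hy; lra.
    - exfalso; destruct (near m h) as (d & Hd & H).
      destruct (Rle_dec b (m + d / 2)) as [hb|hb].
      + specialize (H b); rewrite Rabs_pos_eq in H by lra; specialize (H ltac:(lra)); lra.
      + assert (m + d / 2 <= m); [|lra].
        apply Hub; split; [lra|]; intros y Hy.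
        destruct (Rlt_dec y m) as [hy|hy]; [apply Hin; lra|].
        apply H; rewrite Rabs_pos_eq; lra. }
  exists m; split; [|split; [exact Hm0|exact Hin]].
  split; [|exact Hmb]; destruct Ham as [h|h]; [exact h|subst m; lra].
Qed.

Section Sturm.
Variables (h h1 k k1 a b : R -> R) (y0 : R).
Hypothesis (Dh : forall y, is_derive h y (h1 y))
  (Dh1 : forall y, is_derive h1 y (y * h1 y + 2 * a y * h y))
  (Dk : forall y, is_derive k y (k1 y))
  (Dk1 : forall y, is_derive k1 y (y * k1 y + 2 * b y * k y))
  (kp : forall y, y0 <= y -> 0 < k y).

(** The Wronskian in self-adjoint form: the weight cancels the first-order terms of the two
    equations. *)
Definition wr (y : R) : R := exp (- y ^ 2 / 2) * (h1 y * k y - h y * k1 y).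

Lemma is_derive_wr y : is_derive wr y (2 * exp (- y ^ 2 / 2) * (a y - b y) * (h y * k y)).
Proof.
  evar_last.
  apply (is_derive_mult (K := R_AbsRing) (fun y => exp (- y ^ 2 / 2)) (fun y => h1 y * k y - h y * k1 y));
    [apply is_derive_exp_opp_sq| |intros; apply Rmult_comm].
  apply (is_derive_minus (V := R_NormedModule) (fun y => h1 y * k y) (fun y => h y * k1 y)).
  apply (is_derive_mult (K := R_AbsRing) h1 k); [apply Dh1|apply Dk|intros; apply Rmult_comm].
  apply (is_derive_mult (K := R_AbsRing) h k1); [apply Dh|apply Dk1|intros; apply Rmult_comm].
  unfold minus, opp, plus, mult; simpl; unfold mult; simpl; Req; ring.
Qed.

Lemma is_derive_quot y : k y <> 0 ->
  is_derive (fun y => h y / k y) y ((h1 y * k y - h y * k1 y) / k y ^ 2).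
Proof.
  intros Hk; evar_last; [apply (is_derive_div h k); [apply Dh|apply Dk|exact Hk]|reflexivity].
Qed.

Hypothesis (ab : forall y, y0 <= y -> b y <= a y) (h0 : 0 < h y0) (w0 : 0 <= wr y0).

Lemma wr_incr_until c : y0 <= c -> (forall y, y0 <= y <= c -> 0 <= h y) -> wr y0 <= wr c.
Proof.
  intros Hc Hh; eapply mvt_incr; [exact Hc|intros; apply is_derive_wr|].
  intros y Hy; pose proof (exp_pos (- y ^ 2 / 2)); pose proof (ab y ltac:(lra)); pose proof (kp y ltac:(lra)).
  specialize (Hh y Hy).
  apply Rmult_le_pos; [apply Rmult_le_pos; lra|apply Rmult_le_pos; lra].
Qed.

(** As long as [h] is nonnegative the Wronskian increases from a nonnegative value, so [h/k]
    increases; it cannot descend from a positive value to 0. *)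
Lemma sturm_positive y : y0 <= y -> 0 < h y.
Proof.
  intros Hy; apply Rnot_le_lt; intros n.
  destruct (first_zero h y0 y) as (c & Hc & hc & Hpos); auto.
  { intros; eapply cont_is_derive, Dh. }
  assert (Hnn : forall z, y0 <= z <= c -> 0 <= h z).
  { intros z Hz; destruct (Req_dec z c) as [->|nz]; [lra|left; apply Hpos; lra]. }
  assert (h y0 / k y0 <= h c / k c).
  { apply (mvt_incr (fun y => h y / k y) (fun y => (h1 y * k y - h y * k1 y) / k y ^ 2)); [lra| |].
    - intros z Hz; apply is_derive_quot; pose proof (kp z ltac:(lra)); lra.
    - intros z Hz; pose proof (kp z ltac:(lra)); apply Rdiv_le_0_compat; [|apply pow_lt; apply kp; lra].
      assert (W : wr y0 <= wr z) by (apply wr_incr_until; [lra|intros; apply Hnn; lra]).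
      unfold wr at 2 in W; pose proof (exp_pos (- z ^ 2 / 2)); nra. }
  rewrite hc in H; unfold Rdiv at 2 in H; rewrite Rmult_0_l in H.
  assert (0 < h y0 / k y0) by (apply Rdiv_lt_0_compat; [exact h0|apply kp; lra]).
  lra.
Qed.

Lemma wr_ge y : y0 <= y -> wr y0 <= wr y.
Proof. intros Hy; apply wr_incr_until; auto; intros z Hz; left; apply sturm_positive; lra. Qed.

Hypothesis ab_strict : forall y, y0 < y -> b y < a y.
Variable M : R.
Hypothesis HM : forall u v, u <= v -> RInt (fun y => h y ^ 2 * exp (- y ^ 2 / 2)) u v <= M.

(* With [c] a lower bound of the Wronskian, [h^2 exp (-y^2/2) >= c (2 + (k/h)')] by AM-GM. *)
Lemma sturm_not_L2 : False.
Proof.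
  set (y1 := y0 + 1); set (c := wr y1).
  assert (Hc : 0 < c).
  { destruct (MVT_gen wr y0 y1 (fun y => 2 * exp (- y ^ 2 / 2) * (a y - b y) * (h y * k y))) as [z [Hz E]].
    - intros; apply is_derive_wr.
    - intros; apply continuity_pt_filterlim; eapply cont_is_derive, is_derive_wr.
    - unfold y1 in Hz; rewrite Rmin_left, Rmax_right in Hz by lra.
      destruct (Req_dec z y0) as [zy|n].
      + assert (Hlt : wr y0 <= wr (y0 + / 2)) by (apply wr_ge; lra).
        destruct (MVT_gen wr (y0 + / 2) y1 (fun y => 2 * exp (- y ^ 2 / 2) * (a y - b y) * (h y * k y))) as [x [Hx E2]].
        * intros; apply is_derive_wr.
        * intros; apply continuity_pt_filterlim; eapply cont_is_derive, is_derive_wr.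
        * unfold y1 in Hx; rewrite Rmin_left, Rmax_right in Hx by lra.
          assert (0 < 2 * exp (- x ^ 2 / 2) * (a x - b x) * (h x * k x)).
          { pose proof (exp_pos (- x ^ 2 / 2)); pose proof (ab_strict x ltac:(lra)).
            pose proof (sturm_positive x ltac:(lra)); pose proof (kp x ltac:(lra)).
            apply Rmult_lt_0_compat; apply Rmult_lt_0_compat; lra. }
          unfold c, y1 in *; lra.
      + assert (0 < 2 * exp (- z ^ 2 / 2) * (a z - b z) * (h z * k z)).
        { pose proof (exp_pos (- z ^ 2 / 2)); pose proof (ab_strict z ltac:(lra)).
          pose proof (sturm_positive z ltac:(lra)); pose proof (kp z ltac:(lra)).
          apply Rmult_lt_0_compat; apply Rmult_lt_0_compat; lra. }
        unfold c, y1 in *; lra. }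
  assert (Wc : forall y, y1 <= y -> c <= wr y).
  { intros y Hy; unfold c, y1; apply mvt_incr with (2 := fun z _ => is_derive_wr z); [exact Hy|].
    intros z Hz; pose proof (exp_pos (- z ^ 2 / 2)); pose proof (ab z ltac:(unfold y1 in *; lra)).
    pose proof (sturm_positive z ltac:(unfold y1 in *; lra)); pose proof (kp z ltac:(unfold y1 in *; lra)).
    apply Rmult_le_pos; [apply Rmult_le_pos; lra|apply Rmult_le_pos; lra]. }
  set (f := fun y => h y ^ 2 * exp (- y ^ 2 / 2)).
  assert (cf : forall y, continuous f y).
  { intros y; apply cont_mult; [apply cont_pow; eapply cont_is_derive, Dh|].
    eapply cont_is_derive, is_derive_exp_opp_sq. }
  assert (Growth : forall Y, y1 <= Y -> 2 * c * (Y - y1) - c * (k y1 / h y1) <= RInt f y1 Y).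
  { intros Y HY.
    assert (hp : forall y, y1 <= y -> 0 < h y) by (intros; apply sturm_positive; unfold y1 in *; lra).
    assert (Hinc : RInt f 0 y1 - c * (2 * (y1 - y1) + k y1 / h y1)
                   <= RInt f 0 Y - c * (2 * (Y - y1) + k Y / h Y)).
    { apply (mvt_incr (fun Y => RInt f 0 Y - c * (2 * (Y - y1) + k Y / h Y))
        (fun y => f y - c * (2 + (k1 y * h y - k y * h1 y) / h y ^ 2))); [exact HY| |].
      - intros y Hy; specialize (hp y ltac:(lra)).
        apply (is_derive_minus (V := R_NormedModule) (fun Y => RInt f 0 Y) (fun Y => c * (2 * (Y - y1) + k Y / h Y))).
        apply is_derive_RInt_from0; exact cf.
        apply (is_derive_scal (fun Y => 2 * (Y - y1) + k Y / h Y) y c).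
        apply (is_derive_plus (V := R_NormedModule) (fun Y => 2 * (Y - y1)) (fun Y => k Y / h Y)).
        auto_derive; [exact I|ring].
        evar_last; [apply (is_derive_div k h); [apply Dk|apply Dh|lra]|reflexivity].
      - intros y Hy; specialize (hp y ltac:(lra)); specialize (Wc y ltac:(lra)).
        pose proof (exp_pos (- y ^ 2 / 2)) as He.
        assert (fp : 0 < f y) by (apply Rmult_lt_0_compat; [apply pow_lt|]; lra).
        replace ((k1 y * h y - k y * h1 y) / h y ^ 2) with (- (wr y / f y))
          by (unfold wr, f; field; split; lra).
        assert (c / f y <= wr y / f y)
          by (apply Rmult_le_compat_r; [left; apply Rinv_0_lt_compat; exact fp|exact Wc]).
        assert (0 <= (f y - c) ^ 2 / f y) by (apply Rdiv_le_0_compat; [apply pow2_ge_0|exact fp]).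
        replace ((f y - c) ^ 2 / f y) with (f y - c * (2 - c / f y)) in H0 by (field; lra).
        nra. }
    assert (Ch : RInt f 0 Y = RInt f 0 y1 + RInt f y1 Y).
    { symmetry; apply (RInt_Chasles (V := R_CompleteNormedModule) f 0 y1 Y); apply ex_RInt_cont; exact cf. }
    rewrite Ch in Hinc.
    assert (0 < k Y / h Y) by (apply Rdiv_lt_0_compat; [apply kp; unfold y1 in *; lra|apply hp; exact HY]).
    nra. }
  assert (HM0 : 0 <= M).
  { eapply Rle_trans; [|apply (HM y1 y1); lra]; rewrite RInt_point; unfold zero; simpl; lra. }
  assert (q0 : 0 < k y1 / h y1).
  { apply Rdiv_lt_0_compat; [apply kp|apply sturm_positive]; unfold y1; lra. }
  set (q := k y1 / h y1) in *.
  (* The point where the linear lower bound [2 c (Y - y1) - c q] of the integral reaches [M + 1]. *)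
  set (Y := y1 + (M + 1 + c * q) / (2 * c)).
  assert (HY : y1 <= Y).
  { assert (0 < (M + 1 + c * q) / (2 * c)); [|unfold Y; lra].
    apply Rdiv_lt_0_compat; [|lra]; assert (0 < c * q) by (apply Rmult_lt_0_compat; lra); lra. }
  specialize (Growth Y HY); pose proof (HM y1 Y HY) as HMY; fold f in HMY.
  replace (2 * c * (Y - y1)) with (M + 1 + c * q) in Growth by (unfold Y; field; lra).
  lra.
Qed.
End Sturm.

(** * Square integrability against the normal law *)

Lemma gauss_exp x : exp (- x ^ 2 / 2) = sqrt (2 * PI) * gauss x.
Proof.
  assert (0 < sqrt (2 * PI)) by (apply sqrt_lt_R0; pose proof PI_RGT_0; lra).
  unfold gauss; field; lra.
Qed.

(** The integrand is nonnegative, so every finite piece sits inside an interval whose integral is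
    within 1 of the limit. *)
Lemma in_L2m_bound h : in_L2m h -> (forall x, continuous h x) -> exists M, forall u v, u <= v ->
  RInt (fun y => h y ^ 2 * exp (- y ^ 2 / 2)) u v <= M.
Proof.
  intros [l Hl] ch.
  set (f := fun x => h x ^ 2 * gauss x) in *.
  assert (sp : 0 < sqrt (2 * PI)) by (apply sqrt_lt_R0; pose proof PI_RGT_0; lra).
  assert (cf : forall x, continuous f x).
  { intros x; apply cont_mult; [apply cont_pow, ch|].
    apply cont_ex_derive; unfold gauss; auto_derive; lra. }
  assert (fp : forall x, 0 <= f x).
  { intros x; apply Rmult_le_pos; [apply pow2_ge_0|].
    unfold gauss; apply Rlt_le, Rdiv_lt_0_compat; [apply exp_pos|exact sp]. }
  assert (Hloc : locally l (fun v => v < l + 1)).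
  { exists (mkposreal 1 Rlt_0_1); intros v Hv.
    unfold ball in Hv; simpl in Hv; unfold AbsRing_ball, abs, minus, plus, opp in Hv; simpl in Hv.
    apply Rabs_def2 in Hv; lra. }
  destruct (Hl _ Hloc) as [Q1 Q2 [m1 H1] [m2 H2] HQ].
  exists (sqrt (2 * PI) * (l + 1)); intros u v Huv.
  set (aa := Rmin u (m1 - 1)); set (bb := Rmax v (m2 + 1)).
  assert (aa <= u) by apply Rmin_l; assert (aa <= m1 - 1) by apply Rmin_r.
  assert (v <= bb) by apply Rmax_l; assert (m2 + 1 <= bb) by apply Rmax_r.
  destruct (HQ aa bb (H1 aa ltac:(lra)) (H2 bb ltac:(lra))) as [z [Hz Hzl]]; simpl in Hz.
  apply (is_RInt_unique (V := R_CompleteNormedModule)) in Hz.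
  assert (ex : forall a b, ex_RInt f a b) by (intros; apply ex_RInt_cont; exact cf).
  rewrite <- (RInt_Chasles (V := R_CompleteNormedModule) f aa u bb),
          <- (RInt_Chasles (V := R_CompleteNormedModule) f u v bb) in Hz by auto.
  unfold plus in Hz; simpl in Hz.
  assert (0 <= RInt f aa u) by (apply RInt_ge_0; auto).
  assert (0 <= RInt f v bb) by (apply RInt_ge_0; auto).
  rewrite (RInt_ext _ (fun y => sqrt (2 * PI) * f y)).
  2: { intros y _; rewrite gauss_exp; unfold f; Req; ring. }
  rewrite RInt_scal_R by auto.
  apply Rmult_le_compat_l; [lra|]; simpl in *; lra.
Qed.

(** Squaring [exp (x^2/16)] leaves the weight [exp (- 3/8 x^2)], dominated by a multiple of
    [1/(1 + x^2)]; evenness reduces the two-sided limit to a single supremum. *)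
Lemma in_L2m_of_growth h C : (forall x, continuous h x) -> (forall x, h (- x) = h x) ->
  (forall x, Rabs (h x) <= C * exp (x ^ 2 / 16)) -> in_L2m h.
Proof.
  intros ch eh bh.
  set (f := fun x => h x ^ 2 * gauss x).
  assert (sp : 0 < sqrt (2 * PI)) by (apply sqrt_lt_R0; pose proof PI_RGT_0; lra).
  assert (cf : forall x, continuous f x).
  { intros x; apply cont_mult; [apply cont_pow, ch|].
    apply cont_ex_derive; unfold gauss; auto_derive; lra. }
  assert (fp : forall x, 0 <= f x).
  { intros x; apply Rmult_le_pos; [apply pow2_ge_0|].
    unfold gauss; apply Rlt_le, Rdiv_lt_0_compat; [apply exp_pos|exact sp]. }
  assert (ef : forall x, f (- x) = f x).
  { intros x; unfold f, gauss; rewrite eh; replace ((- x) ^ 2) with (x ^ 2) by ring; reflexivity. }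
  set (K := C ^ 2 / sqrt (2 * PI) * (8 / 3)).
  assert (HK : 0 <= K).
  { unfold K; apply Rmult_le_pos; [|lra]; apply Rdiv_le_0_compat; [apply pow2_ge_0|exact sp]. }
  assert (fb : forall x, f x <= K * / (1 + x ^ 2)).
  { intros x; unfold f, gauss.
    assert (h2 : h x ^ 2 <= (C * exp (x ^ 2 / 16)) ^ 2) by (apply pow_maj_Rabs, bh).
    apply Rle_trans with ((C * exp (x ^ 2 / 16)) ^ 2 * (exp (- x ^ 2 / 2) / sqrt (2 * PI))).
    - apply Rmult_le_compat_r; [apply Rlt_le, Rdiv_lt_0_compat; [apply exp_pos|exact sp]|exact h2].
    - replace ((C * exp (x ^ 2 / 16)) ^ 2 * (exp (- x ^ 2 / 2) / sqrt (2 * PI)))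
        with (C ^ 2 / sqrt (2 * PI) * (exp (x ^ 2 / 16) * exp (x ^ 2 / 16) * exp (- x ^ 2 / 2))) by (field; lra).
      rewrite <- !exp_plus; unfold K; rewrite Rmult_assoc.
      apply Rmult_le_compat_l; [apply Rdiv_le_0_compat; [apply pow2_ge_0|exact sp]|].
      replace (x ^ 2 / 16 + x ^ 2 / 16 + - x ^ 2 / 2) with (- (3 / 8 * x ^ 2)) by field.
      rewrite exp_Ropp; pose proof (exp_ineq1_le (3 / 8 * x ^ 2)); pose proof (pow2_ge_0 x).
      replace (8 / 3 * / (1 + x ^ 2)) with (/ (3 / 8 * (1 + x ^ 2))) by (field; lra).
      apply Rinv_le_contravar; lra. }
  assert (ex : forall a b, ex_RInt f a b) by (intros; apply ex_RInt_cont; exact cf).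
  assert (Ab : forall Y, 0 <= Y -> RInt f 0 Y <= K * (PI / 2)).
  { intros Y HY; apply Rle_trans with (RInt (fun x => K * / (1 + x ^ 2)) 0 Y).
    - apply RInt_le; auto; apply ex_RInt_cont; intros; apply cont_ex_derive; auto_derive; nra.
    - rewrite (is_RInt_unique _ _ _ (K * atan Y - K * atan 0)).
      + rewrite atan_0; pose proof (atan_bound Y); nra.
      + apply (is_RInt_derive (V := R_CompleteNormedModule) (fun x => K * atan x)).
        * intros x _; auto_derive; [exact I|field; nra].
        * intros x _; apply cont_ex_derive; auto_derive; nra. }
  assert (mono : forall a b, 0 <= a <= b -> RInt f 0 a <= RInt f 0 b).
  { intros a b Hab; rewrite <- (RInt_Chasles (V := R_CompleteNormedModule) f 0 a b) by auto.
    assert (0 <= RInt f a b) by (apply RInt_ge_0; auto; lra); unfold plus; simpl in *; lra. }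
  destruct (completeness (fun v => exists Y, 0 <= Y /\ v = RInt f 0 Y)) as [l [Hu Hlub]].
  { exists (K * (PI / 2)); intros v [Y [HY ->]]; apply Ab; exact HY. }
  { exists (RInt f 0 0), 0; split; [lra|reflexivity]. }
  exists (2 * l); intros P [e HP].
  assert (HY : exists Y0, 0 <= Y0 /\ l - e / 2 < RInt f 0 Y0).
  { destruct (Classical_Prop.classic (exists Y0, 0 <= Y0 /\ l - e / 2 < RInt f 0 Y0)) as [H|N]; [exact H|].
    exfalso; pose proof (cond_pos e); assert (l <= l - e / 2); [|lra].
    apply Hlub; intros v [Y [HY ->]]; apply Rnot_lt_le; intros h'; apply N; eauto. }
  destruct HY as (Y0 & HY0 & Hap).
  apply (Filter_prod _ _ _ (fun a => a < - Y0) (fun b => Y0 < b)).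
  - exists (- Y0); auto.
  - exists Y0; auto.
  - intros a b Ha Hb; exists (RInt f a b); split.
    + apply (RInt_correct (V := R_CompleteNormedModule)); auto.
    + apply HP.
      assert (E : RInt f a b = RInt f 0 (- a) + RInt f 0 b).
      { rewrite <- (RInt_Chasles (V := R_CompleteNormedModule) f a 0 b) by auto.
        rewrite <- (opp_RInt_swap (V := R_CompleteNormedModule) f 0 a) by auto.
        rewrite RInt_0_opp_even by auto; unfold plus, opp; simpl; reflexivity. }
      rewrite E.
      pose proof (mono Y0 (- a) ltac:(lra)); pose proof (mono Y0 b ltac:(lra)).
      assert (RInt f 0 (- a) <= l) by (apply Hu; exists (- a); split; [lra|reflexivity]).
      assert (RInt f 0 b <= l) by (apply Hu; exists b; split; [lra|reflexivity]).
      unfold ball; simpl; unfold AbsRing_ball, abs, minus, plus, opp; simpl.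
      apply Rabs_def1; simpl in *; lra.
Qed.

(** * Shooting for the positive ground state *)

Section Ground.
Variables (F : R -> R) (B lam0 : R).
Hypothesis (cF : forall x, continuous F x) (bF : forall x, 0 <= F x <= B)
  (eF : forall x, F (- x) = F x) (Hlow : lowest_eigenvalue_LF F lam0).

Lemma sol_odd_derivative mu u u1 : sol F mu u u1 -> forall x, u1 (- x) = - u1 x.
Proof.
  intros (D & _ & _ & _ & e) x.
  assert (d : is_derive u x (- u1 (- x))).
  { apply (is_derive_ext (fun y => u (- y))); [intros; apply e|].
    evar_last.
    apply (is_derive_comp (K := R_AbsRing) (V := R_NormedModule) u (fun y => - y)); [apply D|].
    apply (is_derive_opp (V := R_NormedModule) (fun y => y)), (is_derive_id (K := R_AbsRing)).
    unfold scal, opp, one; simpl; unfold mult; simpl; Req; ring. }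
  apply is_derive_unique in d; rewrite (is_derive_unique _ _ _ (D x)) in d; lra.
Qed.

(** Compared with a positive solution for a larger parameter, an eigenfunction for [lam0] would
    leave [L^2(m)]. Its sign and parity are unknown, so the comparison starts where it does not
    vanish; a change of sign and a reflection make it positive there with a nonnegative
    Wronskian. *)
Lemma positive_sol_le mu u u1 : sol F mu u u1 -> (forall x, 0 <= x -> 0 < u x) -> mu <= lam0.
Proof.
  intros Hs Hp; apply Rnot_lt_le; intros Hmu.
  pose proof (sol_odd_derivative _ _ _ Hs) as o1.
  destruct Hs as (D & D1 & i0 & i1 & e).
  assert (up : forall x, 0 < u x).
  { intros x; destruct (Rle_dec 0 x); [auto|]; rewrite <- e; apply Hp; lra. }
  destruct Hlow as [(h & HC2 & HL2 & [x1 Hx1] & Heq) _].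
  assert (Dh : forall x, is_derive h x (Derive h x)) by (intros; apply Derive_correct, HC2).
  assert (Dh1 : forall x, is_derive (Derive h) x (x * Derive h x + 2 * (F x - lam0) * h x)).
  { intros x; evar_last; [apply Derive_correct, HC2|].
    specialize (Heq x); unfold LF in Heq; simpl in Heq.
    change (Derive (fun x => Derive h x) x = x * Derive h x + 2 * (F x - lam0) * h x).
    change (Derive (fun x => Derive (fun x0 => h x0) x) x) with (Derive (fun x => Derive h x) x) in Heq.
    lra. }
  destruct (in_L2m_bound h HL2) as [M HM]; [intros; eapply cont_is_derive, Dh|].
  assert (main : forall (h h1 : R -> R) y0, (forall x, is_derive h x (h1 x)) ->
     (forall x, is_derive h1 x (x * h1 x + 2 * (F x - lam0) * h x)) ->
     (forall a b, a <= b -> RInt (fun y => h y ^ 2 * exp (- y ^ 2 / 2)) a b <= M) ->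
     0 < h y0 -> 0 <= h1 y0 * u y0 - h y0 * u1 y0 -> False).
  { intros q q1 y0 Dq Dq1 Mq hq wq.
    apply (sturm_not_L2 q q1 u u1 (fun x => F x - lam0) (fun x => F x - mu) y0 Dq Dq1 D D1) with M; auto.
    - intros; lra.
    - unfold wr; apply Rmult_le_pos; [left; apply exp_pos|exact wq].
    - intros; lra. }
  assert (sgn : forall (h h1 : R -> R), (forall x, is_derive h x (h1 x)) ->
     (forall x, is_derive h1 x (x * h1 x + 2 * (F x - lam0) * h x)) ->
     (forall a b, a <= b -> RInt (fun y => h y ^ 2 * exp (- y ^ 2 / 2)) a b <= M) ->
     0 < h x1 -> False).
  { intros q q1 Dq Dq1 Mq hq.
    destruct (Rle_dec 0 (q1 x1 * u x1 - q x1 * u1 x1)) as [w|w]; [exact (main q q1 x1 Dq Dq1 Mq hq w)|].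

    assert (Dop : forall (g : R -> R) l x, is_derive g (- x) l -> is_derive (fun y => g (- y)) x (- l)).
    { intros g l x Hg; evar_last.
      apply (is_derive_comp (K := R_AbsRing) (V := R_NormedModule) g (fun y => - y)); [exact Hg|].
      apply (is_derive_opp (V := R_NormedModule) (fun y => y)), (is_derive_id (K := R_AbsRing)).
      unfold scal, opp, one; simpl; unfold mult; simpl; Req; ring. }
    apply (main (fun x => q (- x)) (fun x => - q1 (- x)) (- x1)).
    - intros x; apply Dop, Dq.
    - intros x; evar_last.
      apply (is_derive_opp (V := R_NormedModule) (fun x => q1 (- x))), Dop, Dq1.
      rewrite eF; unfold opp; simpl; Req; ring.
    - intros a b Hab.
      assert (E : RInt (fun y => q (- y) ^ 2 * exp (- y ^ 2 / 2)) a b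
                  = RInt (fun z => q z ^ 2 * exp (- z ^ 2 / 2)) (- b) (- a)).
      { rewrite <- (RInt_reflect (fun z => q z ^ 2 * exp (- z ^ 2 / 2))).
        - apply RInt_ext; intros y _; replace ((- y) ^ 2) with (y ^ 2) by ring; reflexivity.
        - intros y; apply cont_mult; [apply cont_pow; eapply cont_is_derive, Dq|].
          eapply cont_is_derive, is_derive_exp_opp_sq. }
      rewrite E; apply Mq; lra.
    - rewrite Ropp_involutive; exact hq.
    - rewrite Ropp_involutive, e, o1; lra. }
  destruct (Rtotal_order (h x1) 0) as [n|[n|n]]; [|contradiction|exact (sgn h (Derive h) Dh Dh1 HM n)].
  apply (sgn (fun x => - h x) (fun x => - Derive h x)).
  - intros x; apply (is_derive_opp (V := R_NormedModule) h), Dh.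
  - intros x; evar_last; [apply (is_derive_opp (V := R_NormedModule) (Derive h)), Dh1|].
    unfold opp; simpl; Req; ring.
  - intros a b Hab; rewrite (RInt_ext _ (fun y => h y ^ 2 * exp (- y ^ 2 / 2))); [apply HM; exact Hab|].
    intros; Req; ring.
  - lra.
Qed.

(** A comparison function solving the equation with potential [1/16 - 7/128 y^2], which eventually
    falls below every [F - nu]; its growth is slow enough for [L^2(m)] and for the barriers. *)
Definition kx (y : R) : R := exp (y ^ 2 / 16).
Definition kx1 (y : R) : R := y / 8 * kx y.

Lemma is_derive_kx y : is_derive kx y (kx1 y).
Proof. unfold kx1, kx; auto_derive; [exact I|]; unfold Rdiv; simpl; field. Qed.

Lemma is_derive_kx1 y : is_derive kx1 y (y * kx1 y + 2 * (/ 16 - 7 / 128 * y ^ 2) * kx y).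
Proof.
  unfold kx1, kx; auto_derive; [exact I|]; unfold Rdiv; simpl; field.
Qed.

Lemma kx_pos y : 0 < kx y.
Proof. apply exp_pos. Qed.

Definition has_positive_sol (mu : R) : Prop := exists u u1, sol F mu u u1 /\ forall x, 0 <= x -> 0 < u x.

Lemma has_positive_sol_0 : has_positive_sol 0.
Proof.
  destruct (sol_exists F B cF bF eF 0) as (u & u1 & Hs); exists u, u1; split; [exact Hs|].
  destruct Hs as (D & D1 & i0 & i1 & e).
  apply (sturm_positive u u1 (fun _ => 1) (fun _ => 0) (fun x => F x - 0) (fun _ => 0) 0 D D1).
  - intros; apply (is_derive_const (V := R_NormedModule)).
  - intros y; evar_last; [apply (is_derive_const (V := R_NormedModule))|unfold zero; simpl; ring].
  - intros; lra.
  - intros y _; pose proof (bF y); lra.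
  - rewrite i0; lra.
  - unfold wr; rewrite i0, i1; lra.
Qed.

(* Shooting: the supremum of the parameters with a positive even solution is the eigenvalue. *)
Lemma ground_state : exists u u1 C, sol F lam0 u u1 /\ (forall x, 0 < u x) /\
  0 < C /\ (forall x, u x <= C * exp (x ^ 2 / 16)).
Proof.
  destruct (completeness has_positive_sol) as [mu [Hub Hlub]].
  { exists lam0; intros x (u & u1 & Hs & Hp); exact (positive_sol_le x u u1 Hs Hp). }
  { exists 0; exact has_positive_sol_0. }
  assert (Hmu0 : 0 <= mu) by (apply Hub, has_positive_sol_0).
  destruct (sol_exists F B cF bF eF mu) as (u & u1 & Hs).
  (* A negative value would persist for nearby parameters, some of which have positive solutions. *)
  assert (Hnn : forall x, 0 <= x -> 0 <= u x).
  { intros x Hx; apply Rnot_lt_le; intros n.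
    destruct (sol_continuous_dependence F B bF mu u u1 x (- u x / 2) Hs Hx ltac:(lra)) as (d & Hd & Hc).
    assert (Hex : exists nu, has_positive_sol nu /\ mu - d < nu).
    { destruct (Classical_Prop.classic (exists nu, has_positive_sol nu /\ mu - d < nu)) as [H|N]; [exact H|].
      exfalso; assert (mu <= mu - d); [|lra].
      apply Hlub; intros nu Hnu; apply Rnot_lt_le; intros h'; apply N; eauto. }
    destruct Hex as (nu & Hnu & Hd2); pose proof (Hub nu Hnu).
    destruct Hnu as (w & w1 & Hw & Hwp).
    destruct (Hc nu w w1 Hw) with (x := x) as [H1 _]; [apply Rabs_def1; lra|lra|].
    specialize (Hwp x Hx); apply Rabs_le_between in H1; lra. }
  assert (Hpos : forall x, 0 <= x -> 0 < u x).
  (* A zero would be a minimum of [u], hence a double zero. *)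
  { intros x Hx; destruct (Hnn x Hx) as [h|h]; [exact h|exfalso].
    apply (sol_energy_lower F B bF mu u u1 x Hs Hx); split; [auto|].
    destruct Hs as (D & D1 & i0 & i1 & e).
    assert (u0 : forall y, u x <= u y).
    { intros y; rewrite <- h; destruct (Rle_dec 0 y); [auto|rewrite <- e; apply Hnn; lra]. }
    assert (g1 : 0 <= u1 x) by (apply (is_derive_right_ge0 u x); auto).
    assert (g2 : 0 <= - u1 x); [|lra].
    apply (is_derive_right_ge0 (fun s => u (- s)) (- x)); [|intros; rewrite Ropp_involutive; apply u0].
    evar_last.
    apply (is_derive_comp (K := R_AbsRing) (V := R_NormedModule) u (fun y => - y));
      [rewrite Ropp_involutive; apply D|].
    apply (is_derive_opp (V := R_NormedModule) (fun y => y)), (is_derive_id (K := R_AbsRing)).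
    unfold scal, opp, one; simpl; unfold mult; simpl; Req; ring. }
  assert (Hle : mu <= lam0) by (apply (positive_sol_le mu u u1); auto).
  set (y2 := 20 * (mu + 2)).
  assert (Hy2 : 0 <= y2) by (unfold y2; lra).
  assert (kcond : forall nu y, nu <= mu + 1 -> y2 <= y -> / 16 - 7 / 128 * y ^ 2 <= F y - nu).
  { intros nu y Hnu Hy; pose proof (bF y).
    assert (20 * y <= y ^ 2) by (unfold y2 in Hy; nra).
    unfold y2 in Hy; lra. }
  (* If [u/kx] increased at some [Y >= y2], this would persist for a parameter [nu > mu], and Sturm
     comparison beyond [Y] would keep that solution positive, against the choice of [mu]. *)
  assert (HC : forall y, y2 <= y -> u1 y * kx y - u y * kx1 y <= 0).
  { intros Y HY; apply Rnot_lt_le; intros n.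
    destruct (positive_on u 0 Y ltac:(lra)) as (c & Hc & cu).
    { intros; eapply cont_is_derive, (proj1 Hs). }
    { intros x Hx; apply Hpos; lra. }
    set (p := u1 Y * kx Y - u Y * kx1 Y) in *.
    pose proof (kx_pos Y) as Hk.
    assert (Hk1 : 0 <= kx1 Y) by (unfold kx1; apply Rmult_le_pos; lra).
    (* The first bound keeps the perturbed solution positive on [[0, Y]], the second keeps at least
       half of the Wronskian [p]. *)
    set (eta := Rmin (c / 2) (p / (2 * (kx Y + kx1 Y)))).
    assert (He : 0 < eta) by (apply Rmin_glb_lt; [lra|apply Rdiv_lt_0_compat; lra]).
    assert (e1 : eta <= c / 2) by apply Rmin_l.
    assert (e2 : eta <= p / (2 * (kx Y + kx1 Y))) by apply Rmin_r.
    assert (e3 : eta * (kx Y + kx1 Y) <= p / 2).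
    { replace (p / 2) with (p / (2 * (kx Y + kx1 Y)) * (kx Y + kx1 Y)) by (field; lra).
      apply Rmult_le_compat_r; lra. }
    destruct (sol_continuous_dependence F B bF mu u u1 Y eta Hs ltac:(lra) He) as (d & Hd & Hcd).
    set (nu := mu + Rmin (d / 2) 1).
    assert (hn : 0 < Rmin (d / 2) 1) by (apply Rmin_glb_lt; lra).
    pose proof (Rmin_l (d / 2) 1); pose proof (Rmin_r (d / 2) 1).
    destruct (sol_exists F B cF bF eF nu) as (w & w1 & Hw).
    assert (Hclose := Hcd nu w w1 Hw ltac:(unfold nu; apply Rabs_def1; lra)).
    assert (wpos : forall x, 0 <= x <= Y -> 0 < w x).
    { intros x Hx; destruct (Hclose x Hx) as [H1 _]; specialize (cu x Hx).
      apply Rabs_le_between in H1; lra. }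
    enough (has_positive_sol nu) by (pose proof (Hub nu H1); unfold nu in *; lra).
    exists w, w1; split; [exact Hw|].
    intros x Hx; destruct (Rle_dec x Y) as [hx|hx]; [apply wpos; lra|].
    destruct (Hw) as (D & D1 & _ & _ & _).
    apply (sturm_positive w w1 kx kx1 (fun x => F x - nu) (fun y => / 16 - 7 / 128 * y ^ 2) Y D D1
      is_derive_kx is_derive_kx1).
    - intros; apply kx_pos.
    - intros y Hy; apply kcond; unfold nu; lra.
    - apply wpos; lra.
    - unfold wr; apply Rmult_le_pos; [left; apply exp_pos|].
      destruct (Hclose Y ltac:(lra)) as [H1 H2]; apply Rabs_le_between in H1; apply Rabs_le_between in H2.
      unfold p in *; nra.
    - lra. }
  destruct Hs as (D & D1 & i0 & i1 & e).
  assert (cu : forall x, continuous u x) by (intros; eapply cont_is_derive, D).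
  destruct (bounded_on u 0 y2 Hy2 cu) as (M & HM & bu).
  assert (Hb : forall x, 0 <= x -> u x <= M * kx x).
  { assert (k1 : forall x, 1 <= kx x).
    { intros x; unfold kx; rewrite <- exp_0; apply exp_le_compat; pose proof (pow2_ge_0 x); lra. }
    intros x Hx; destruct (Rle_dec x y2) as [h|h].
    - specialize (bu x ltac:(lra)); apply Rabs_le_between in bu; specialize (k1 x); nra.
    - assert (q : - (u y2 / kx y2) <= - (u x / kx x)).
      { apply (mvt_incr (fun y => - (u y / kx y)) (fun y => - ((u1 y * kx y - u y * kx1 y) / kx y ^ 2))); [lra| |].
        - intros z Hz; apply (is_derive_opp (V := R_NormedModule) (fun y => u y / kx y)).
          apply is_derive_quot; [exact D|exact is_derive_kx|pose proof (kx_pos z); lra].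
        - intros z Hz; specialize (HC z ltac:(lra)); pose proof (kx_pos z).
          assert (0 <= - (u1 z * kx z - u z * kx1 z) / kx z ^ 2)
            by (apply Rdiv_le_0_compat; [lra|apply pow_lt; lra]).
          unfold Rdiv in *; lra. }
      assert (u y2 / kx y2 <= M).
      { specialize (bu y2 ltac:(lra)); apply Rabs_le_between in bu; specialize (k1 y2).
        apply Rmult_le_reg_r with (kx y2); [lra|]; unfold Rdiv; rewrite Rmult_assoc, Rinv_l by lra; nra. }
      pose proof (kx_pos x).
      replace (u x) with (u x / kx x * kx x) by (field; lra).
      apply Rmult_le_compat_r; lra. }
  assert (upos : forall x, 0 < u x).
  { intros x; destruct (Rle_dec 0 x); [auto|rewrite <- e; apply Hpos; lra]. }
  assert (ub : forall x, u x <= M * exp (x ^ 2 / 16)).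
  { intros x; destruct (Rle_dec 0 x) as [h|h]; [apply Hb; exact h|].
    rewrite <- e; replace (x ^ 2) with ((- x) ^ 2) by ring; apply Hb; lra. }
  assert (Eig : is_eigenvalue_LF F mu).
  { assert (Du : forall x, Derive u x = u1 x) by (intros; apply is_derive_unique, D).
    assert (Du2 : forall x, Derive (fun x => Derive u x) x = x * u1 x + 2 * (F x - mu) * u x).
    { intros x; rewrite (Derive_ext _ u1) by exact Du; apply is_derive_unique, D1. }
    exists u; split; [|split; [|split]].
    - intros x; split; [exists (u1 x); apply D|split].
      + apply (ex_derive_ext u1); [intros; symmetry; apply Du|]; eexists; apply D1.
      + apply (continuous_ext (fun x => x * u1 x + 2 * (F x - mu) * u x)); [intros; symmetry; apply Du2|].
        apply cont_plus; apply cont_mult.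
        * apply cont_id.
        * eapply cont_is_derive, D1.
        * apply cont_mult; [apply cont_const|]; apply cont_minus; [apply cF|apply cont_const].
        * apply cu.
    - apply (in_L2m_of_growth u M cu e); intros x; rewrite Rabs_pos_eq by (left; apply upos); apply ub.
    - exists 0; rewrite i0; lra.
    - intros x; unfold LF; simpl.
      change (Derive (fun x0 => Derive (fun x1 => u x1) x0) x) with (Derive (fun x => Derive u x) x).
      rewrite Du2, Du; field. }
  assert (Emu : mu = lam0) by (apply Rle_antisym; [exact Hle|apply (proj2 Hlow); exact Eig]).
  subst mu; exists u, u1, M; repeat apply conj; auto.
Qed.
End Ground.

(** * Barriers *)

Lemma cont_div (f g : R -> R) x : continuous f x -> continuous g x -> g x <> 0 ->
  continuous (fun y => f y / g y) x.
Proof.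
  intros cf cg n; apply cont_mult; [exact cf|].
  apply (cont_comp g Rinv); [exact cg|]; apply cont_ex_derive; auto_derive; exact n.
Qed.

Lemma is_derive_sq_over_sum (A B A1 B1 : R -> R) x : A x + B x <> 0 ->
  is_derive A x (A1 x) -> is_derive B x (B1 x) ->
  is_derive (fun y => A y ^ 2 / (A y + B y)) x
    (((A x ^ 2 + 2 * A x * B x) * A1 x - A x ^ 2 * B1 x) / (A x + B x) ^ 2).
Proof.
  intros n HA HB; evar_last.
  apply (is_derive_div (fun y => A y ^ 2) (fun y => A y + B y)); [| |exact n].
  apply (is_derive_pow A 2); exact HA.
  apply (is_derive_plus (V := R_NormedModule) A B); [exact HA|exact HB].
  unfold plus; simpl; field; exact n.
Qed.

Section SqOverSum.
Variables (t0 : R) (A At Ax Axx B Bt Bx Bxx : R -> R -> R).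
Hypothesis (HA : C12 t0 A At Ax Axx) (HB : C12 t0 B Bt Bx Bxx)
  (Ap : forall t x, t0 < t -> 0 < A t x) (Bp : forall t x, t0 < t -> 0 < B t x).

(** [A - sq = A B / (A + B)] is at most [B], and [sq] stays positive where [A - B] need not. *)
Definition sq (t x : R) : R := A t x ^ 2 / (A t x + B t x).
Definition sqd (A1 B1 : R -> R -> R) (t x : R) : R :=
  ((A t x ^ 2 + 2 * A t x * B t x) * A1 t x - A t x ^ 2 * B1 t x) / (A t x + B t x) ^ 2.
Definition sq_xx (t x : R) : R :=
  sqd Axx Bxx t x + 2 * (B t x * Ax t x - A t x * Bx t x) ^ 2 / (A t x + B t x) ^ 3.

Lemma sq_den t x : t0 < t -> A t x + B t x <> 0.
Proof. intros Ht; pose proof (Ap t x Ht); pose proof (Bp t x Ht); lra. Qed.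

Lemma C12_sq : C12 t0 sq (sqd At Bt) (sqd Ax Bx) sq_xx.
Proof.
  destruct HA as [a1 a2 a3 a4 a5 a6]; destruct HB as [b1 b2 b3 b4 b5 b6].
  split; intros t x Ht; pose proof (sq_den t x Ht) as n.
  - apply (is_derive_sq_over_sum (fun s => A s x) (fun s => B s x) (fun s => At s x) (fun s => Bt s x)); auto.
  - apply (is_derive_sq_over_sum (fun y => A t y) (fun y => B t y) (fun y => Ax t y) (fun y => Bx t y)); auto.
  - unfold sqd; evar_last.
    apply (is_derive_div (fun y => (A t y ^ 2 + 2 * A t y * B t y) * Ax t y - A t y ^ 2 * Bx t y)
      (fun y => (A t y + B t y) ^ 2)); [| |apply pow_nonzero; exact n].
    apply (is_derive_minus (V := R_NormedModule) (fun y => (A t y ^ 2 + 2 * A t y * B t y) * Ax t y)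
      (fun y => A t y ^ 2 * Bx t y)).
    apply (is_derive_mult (K := R_AbsRing) (fun y => A t y ^ 2 + 2 * A t y * B t y) (fun y => Ax t y));
      [|apply a3; exact Ht|intros; apply Rmult_comm].
    apply (is_derive_plus (V := R_NormedModule) (fun y => A t y ^ 2) (fun y => 2 * A t y * B t y)).
    apply (is_derive_pow (fun y => A t y) 2); apply a2; exact Ht.
    apply (is_derive_mult (K := R_AbsRing) (fun y => 2 * A t y) (fun y => B t y));
      [|apply b2; exact Ht|intros; apply Rmult_comm].
    apply (is_derive_scal (fun y => A t y) x 2); apply a2; exact Ht.
    apply (is_derive_mult (K := R_AbsRing) (fun y => A t y ^ 2) (fun y => Bx t y));
      [|apply b3; exact Ht|intros; apply Rmult_comm].
    apply (is_derive_pow (fun y => A t y) 2); apply a2; exact Ht.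
    apply (is_derive_pow (fun y => A t y + B t y) 2).
    apply (is_derive_plus (V := R_NormedModule) (fun y => A t y) (fun y => B t y)); [apply a2|apply b2]; exact Ht.
    unfold minus, opp, plus, mult; simpl; unfold mult; simpl; unfold sq_xx, sqd; field; exact n.
  - apply (continuity_2d_div (fun t x => A t x ^ 2) (fun t x => A t x + B t x)); auto.
    apply continuity_2d_pow; auto. apply continuity_2d_pt_plus; auto.
  - apply (continuity_2d_div (fun t x => (A t x ^ 2 + 2 * A t x * B t x) * At t x - A t x ^ 2 * Bt t x)
      (fun t x => (A t x + B t x) ^ 2)); [| |apply pow_nonzero; exact n].
    + apply continuity_2d_pt_minus; apply continuity_2d_pt_mult; auto; [|apply continuity_2d_pow; auto].
      apply continuity_2d_pt_plus; [apply continuity_2d_pow; auto|].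
      apply continuity_2d_pt_mult; auto; apply continuity_2d_pt_mult; auto; apply continuity_2d_pt_const.
    + apply (continuity_2d_pow (fun t x => A t x + B t x)); apply continuity_2d_pt_plus; auto.
  - assert (cA : continuous (fun y => A t y) x) by (eapply cont_is_derive, a2; exact Ht).
    assert (cB : continuous (fun y => B t y) x) by (eapply cont_is_derive, b2; exact Ht).
    assert (cAx : continuous (fun y => Ax t y) x) by (eapply cont_is_derive, a3; exact Ht).
    assert (cBx : continuous (fun y => Bx t y) x) by (eapply cont_is_derive, b3; exact Ht).
    assert (cS : continuous (fun y => A t y + B t y) x) by (apply cont_plus; auto).
    apply cont_plus.
    + apply (cont_div (fun y => (A t y ^ 2 + 2 * A t y * B t y) * Axx t y - A t y ^ 2 * Bxx t y)
        (fun y => (A t y + B t y) ^ 2)); [|apply cont_pow; exact cS|apply pow_nonzero; exact n].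
      apply cont_minus; apply cont_mult; auto; [|apply cont_pow; auto].
      apply cont_plus; [apply cont_pow; auto|].
      apply cont_mult; auto; apply cont_mult; auto; apply cont_const.
    + apply (cont_div (fun y => 2 * (B t y * Ax t y - A t y * Bx t y) ^ 2) (fun y => (A t y + B t y) ^ 3));
        [|apply cont_pow; exact cS|apply pow_nonzero; exact n].
      apply cont_mult; [apply cont_const|].
      apply (cont_pow (fun y => B t y * Ax t y - A t y * Bx t y)).
      apply cont_minus; apply cont_mult; auto.
Qed.

(* The Hessian of [A^2/(A+B)] is nonnegative, and the reaction terms cancel exactly. *)
Lemma sq_subsolution :
  (forall t x, t0 < t -> At t x = / 2 * Axx t x - / 2 * A t x ^ 2) ->
  (forall t x, t0 < t -> / 2 * Bxx t x - A t x * B t x <= Bt t x) ->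
  forall t x, t0 < t -> sqd At Bt t x <= / 2 * sq_xx t x - / 2 * sq t x ^ 2.
Proof.
  intros EA EB t x Ht; specialize (EA t x Ht); specialize (EB t x Ht).
  pose proof (Ap t x Ht) as pa; pose proof (Bp t x Ht) as pb.
  unfold sq_xx, sqd, sq; rewrite EA.
  set (a := A t x) in *; set (b := B t x) in *; set (bt := Bt t x) in *.
  set (axx := Axx t x) in *; set (bxx := Bxx t x) in *; set (ax := Ax t x); set (bx := Bx t x).
  apply Rminus_le_0.
  replace (_ - _) with ((a ^ 2 * (bt - (/ 2 * bxx - a * b))) / (a + b) ^ 2
     + (b * ax - a * bx) ^ 2 / (a + b) ^ 3) by (field; lra).
  apply Rplus_le_le_0_compat; apply Rdiv_le_0_compat.
  - apply Rmult_le_pos; [apply pow2_ge_0|lra].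
  - apply pow_lt; lra.
  - apply pow2_ge_0.
  - apply pow_lt; lra.
Qed.
End SqOverSum.

Lemma Rpower_pos t a : 0 < Rpower t a.
Proof. apply exp_pos. Qed.

Lemma Rpower_succ_neg t b : 0 < t -> Rpower t (- (b + 1)) = Rpower t (- b) / t.
Proof.
  intros Ht; replace (- (b + 1)) with (- b + - (1)) by ring.
  rewrite Rpower_plus, Rpower_m1 by exact Ht; reflexivity.
Qed.

Lemma Rpower_neg_anti s t b : 0 < s <= t -> 0 <= b -> Rpower t (- b) <= Rpower s (- b).
Proof.
  intros Hst Hb; unfold Rpower; apply exp_le_compat.
  assert (ln s <= ln t) by (destruct (proj2 Hst) as [h|h]; [left; apply ln_increasing; lra|subst; lra]).
  nra.
Qed.

(** * The two bounds for mass one *)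

Section Final.
Variables (V : R -> R -> R -> R) (Vinf : R -> R -> R) (lam0 : R).
Hypothesis HV : forall lam, 0 < lam -> Vsol (V lam) lam.
Hypothesis hVinf : forall t x, 0 < t -> is_lim (fun lam => V lam t x) p_infty (Vinf t x).

Let F (x : R) : R := Vinf 1 x.
Let DF := is_derive_Vinf_profile V Vinf HV hVinf.
Let DF1 := is_derive_F1 V Vinf HV hVinf.
Let CF2 := continuous_F2 V Vinf HV hVinf.

Lemma F_bounds x : 0 <= F x <= CG.
Proof. pose proof (Vinf_profile_bounds V Vinf HV hVinf x); unfold F; lra. Qed.

Lemma C12_Vinf : C12 0 (ss 1 F) (ss_t 1 F (F1 Vinf)) (ss_x 1 (F1 Vinf)) (ss_xx 1 (F2 Vinf)).
Proof. apply C12_ss; [apply DF|apply DF1|apply CF2]. Qed.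

Lemma Vinf_pde t x : 0 < t -> ss_t 1 F (F1 Vinf) t x
  = / 2 * ss_xx 1 (F2 Vinf) t x - / 2 * ss 1 F t x ^ 2.
Proof.
  intros Ht; unfold ss_t, ss_xx, ss, F2, F; rewrite Rpower_m1 by exact Ht.
  set (y := x / sqrt t); field; lra.
Qed.

Variables (h h1 : R -> R) (C0 : R).
Hypothesis (Hsol : sol F lam0 h h1) (hp : forall x, 0 < h x) (HC0 : 0 < C0)
  (hb : forall x, h x <= C0 * exp (x ^ 2 / 16)).

(** By the profile equation, [exp (x^2/2) F] solves the eigenvalue equation with potential
    [(F - 1)/2]. If [lam0 < 1/2] this potential lies below [F - lam0], and Sturm comparison would
    put the ground state outside [L^2(m)]. *)
Lemma half_le_lam0 : / 2 <= lam0.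
Proof.
  apply Rnot_lt_le; intros n.
  destruct Hsol as (D & D1 & i0 & i1 & e).
  assert (ch : forall x, continuous h x) by (intros; eapply cont_is_derive, D).
  destruct (in_L2m_bound h) as [M HM]; auto.
  { apply (in_L2m_of_growth h C0); auto; intros; rewrite Rabs_pos_eq; [apply hb|left; apply hp]. }
  assert (Fpos : forall y, 0 < F y) by apply (Vinf_profile_bounds V Vinf HV hVinf).
  apply (sturm_not_L2 h h1 (fun x => exp (x ^ 2 / 2) * F x) (fun x => exp (x ^ 2 / 2) * (F1 Vinf x + x * F x))
    (fun x => F x - lam0) (fun x => (F x - 1) / 2) 0 D D1) with M; auto.
  - intros y; evar_last.
    apply (is_derive_mult (K := R_AbsRing) (fun x => exp (x ^ 2 / 2)) F);
      [apply is_derive_exp_sq|apply DF|intros; apply Rmult_comm].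
    unfold plus, mult; simpl; Req; ring.
  - intros y; evar_last.
    apply (is_derive_mult (K := R_AbsRing) (fun x => exp (x ^ 2 / 2)) (fun x => F1 Vinf x + x * F x));
      [apply is_derive_exp_sq| |intros; apply Rmult_comm].
    apply (is_derive_plus (V := R_NormedModule) (F1 Vinf) (fun x => x * F x)); [apply DF1|].
    apply (is_derive_mult (K := R_AbsRing) (fun x => x) F);
      [apply (is_derive_id (K := R_AbsRing))|apply DF|intros; apply Rmult_comm].
    unfold plus, mult, one; simpl; unfold F2; fold (F y); Req; field.
  - intros; apply Rmult_lt_0_compat; [apply exp_pos|apply Fpos].
  - intros y _; specialize (Fpos y); lra.
  - unfold wr, F1, FQ; rewrite RInt_point, i0, i1; unfold zero; simpl; right; ring.
  - intros y _; specialize (Fpos y); lra.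
Qed.

Let b : R := / 2 + lam0.

Definition psi (y : R) : R := exp (- y ^ 2 / 2) * h y.
Definition psi1 (y : R) : R := exp (- y ^ 2 / 2) * (h1 y - y * h y).
Definition psi2 (y : R) : R :=
  exp (- y ^ 2 / 2) * (- y * h1 y + (2 * (F y - lam0) - 1 + y ^ 2) * h y).

Lemma is_derive_psi y : is_derive psi y (psi1 y).
Proof.
  destruct Hsol as (D & D1 & _); evar_last.
  apply (is_derive_mult (K := R_AbsRing) (fun y => exp (- y ^ 2 / 2)) h);
    [apply is_derive_exp_opp_sq|apply D|intros; apply Rmult_comm].
  unfold plus, mult, psi1; simpl; Req; ring.
Qed.

Lemma is_derive_psi1 y : is_derive psi1 y (psi2 y).
Proof.
  destruct Hsol as (D & D1 & _); evar_last.
  apply (is_derive_mult (K := R_AbsRing) (fun y => exp (- y ^ 2 / 2)) (fun y => h1 y - y * h y));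
    [apply is_derive_exp_opp_sq| |intros; apply Rmult_comm].
  apply (is_derive_minus (V := R_NormedModule) h1 (fun y => y * h y)); [apply D1|].
  apply (is_derive_mult (K := R_AbsRing) (fun x => x) h);
    [apply (is_derive_id (K := R_AbsRing))|apply D|intros; apply Rmult_comm].
  unfold minus, opp, plus, mult, one, psi2; simpl; unfold mult; simpl; Req; ring.
Qed.

Lemma continuous_psi2 y : continuous psi2 y.
Proof.
  destruct Hsol as (D & D1 & _).
  apply cont_mult; [eapply cont_is_derive, is_derive_exp_opp_sq|].
  apply cont_plus; apply cont_mult.
  - apply cont_ex_derive; auto_derive; exact I.
  - eapply cont_is_derive, D1.
  - apply cont_plus; [apply cont_minus; [apply cont_mult|]|apply cont_pow, cont_id]; try apply cont_const.
    apply cont_minus; [eapply cont_is_derive, DF|apply cont_const].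
  - eapply cont_is_derive, D.
Qed.

Lemma psi_pos y : 0 < psi y.
Proof. apply Rmult_lt_0_compat; [apply exp_pos|apply hp]. Qed.

Lemma psi_upper y : psi y <= exp (- y ^ 2 / 2) * (C0 * exp (y ^ 2 / 16)).
Proof. apply Rmult_le_compat_l; [left; apply exp_pos|apply hb]. Qed.

Lemma psi_bounded y : psi y <= C0.
Proof.
  eapply Rle_trans; [apply psi_upper|].
  replace (exp (- y ^ 2 / 2) * (C0 * exp (y ^ 2 / 16)))
    with (C0 * (exp (- y ^ 2 / 2) * exp (y ^ 2 / 16))) by ring.
  rewrite <- exp_plus; rewrite <- (Rmult_1_r C0) at 2.
  apply Rmult_le_compat_l; [lra|].
  rewrite <- exp_0; apply exp_le_compat; pose proof (pow2_ge_0 y); lra.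
Qed.

Lemma C12_H : C12 0 (ss b psi) (ss_t b psi psi1) (ss_x b psi1) (ss_xx b psi2).
Proof. apply C12_ss; [apply is_derive_psi|apply is_derive_psi1|apply continuous_psi2]. Qed.

Lemma H_pde t x : 0 < t ->
  ss_t b psi psi1 t x = / 2 * ss_xx b psi2 t x - ss 1 F t x * ss b psi t x.
Proof.
  intros Ht; unfold ss_t, ss_xx, ss; rewrite (Rpower_m1 t Ht).
  set (y := x / sqrt t); unfold psi, psi1, psi2, b; field; lra.
Qed.

Variable M : R.
(** What the supersolution inequality for [N] needs besides the nonnegative term with [F]. With the
    power [b + 1] the Gaussian of rate 3/8 contributes the coefficient in brackets; [psi] balances
    the equation for the power [b], so one more power turns [- M psi] into [+ M psi]. *)
Hypothesis (HM : 0 < M) (HMpsi : forall y,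
  0 <= (3 / 32 * y ^ 2 + 3 / 8 - (lam0 + 3 / 2)) * gq 1 (3 / 8) y + M * psi y).

Let kap (y : R) : R := 1 * gq 1 (3 / 8) y + - M * psi y.
Let kap1 (y : R) : R := 1 * gq1 1 (3 / 8) y + - M * psi1 y.
Let kap2 (y : R) : R := 1 * gq2 1 (3 / 8) y + - M * psi2 y.

Lemma C12_N : C12 0 (ss (b + 1) kap) (ss_t (b + 1) kap kap1) (ss_x (b + 1) kap1) (ss_xx (b + 1) kap2).
Proof.
  assert (K : forall (u v : R -> R) (z lu lv : R), is_derive u z lu -> is_derive v z lv ->
    is_derive (fun y => 1 * u y + - M * v y) z (1 * lu + - M * lv)).
  { intros u v z lu lv Hu Hv.
    apply (is_derive_plus (V := R_NormedModule) (fun y => 1 * u y) (fun y => - M * v y)).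
    apply (is_derive_scal u z 1); exact Hu. apply (is_derive_scal v z (- M)); exact Hv. }
  apply C12_ss; intros y.
  - apply (K (gq 1 (3 / 8)) psi); [apply is_derive_gq|apply is_derive_psi].
  - apply (K (gq1 1 (3 / 8)) psi1); [apply is_derive_gq1|apply is_derive_psi1].
  - apply cont_plus; apply cont_mult; try apply cont_const; [apply continuous_gq2|apply continuous_psi2].
Qed.

Lemma N_pde t x : 0 < t -> / 2 * ss_xx (b + 1) kap2 t x - ss 1 F t x * ss (b + 1) kap t x
  <= ss_t (b + 1) kap kap1 t x.
Proof.
  intros Ht; unfold ss_t, ss_xx, ss; rewrite (Rpower_m1 t Ht).
  set (y := x / sqrt t); set (r := Rpower t (- (b + 1))).
  assert (rp : 0 < r) by apply Rpower_pos.
  pose proof (HMpsi y) as Hy; pose proof (F_bounds y) as [F0 _].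
  apply Rminus_le_0.
  replace (_ - _) with (r / t * (((3 / 32 * y ^ 2 + 3 / 8 - (lam0 + 3 / 2)) * gq 1 (3 / 8) y + M * psi y)
    + F y * gq 1 (3 / 8) y)).
  - apply Rmult_le_pos; [apply Rlt_le, Rdiv_lt_0_compat; lra|].
    apply Rplus_le_le_0_compat; [exact Hy|]; apply Rmult_le_pos; [exact F0|].
    unfold gq; rewrite Rmult_1_l; left; apply exp_pos.
  - unfold kap, kap1, kap2, gq1, gq2, psi, psi1, psi2, b; field; lra.
Qed.

Lemma gq_bounds a y : 0 <= a -> 0 < gq 1 a y <= 1.
Proof.
  intros Ha; unfold gq; rewrite Rmult_1_l; split; [apply exp_pos|].
  rewrite <- exp_0; apply exp_le_compat; pose proof (pow2_ge_0 y); nra.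
Qed.

Lemma upper_unit : exists C, 0 < C /\ forall t x, 1 <= t ->
  Vinf t x - V 1 t x <= C * Rpower t (- b).
Proof.
  pose proof gmass_pos as Hg; pose proof CG_pos as HCG.
  (* Chosen so that [CG^2 / C] is [exp (- / gmass) / gmass], the amplitude of the lower bound of
     [V 1] at time 1. *)
  set (C := CG ^ 2 * gmass * exp (/ gmass)).
  assert (HC : 0 < C).
  { unfold C; apply Rmult_lt_0_compat; [apply Rmult_lt_0_compat; [apply pow_lt; lra|lra]|apply exp_pos]. }
  exists (C * ((M + 1) * C0 + 1)); split.
  { apply Rmult_lt_0_compat; [exact HC|]; assert (0 < (M + 1) * C0) by (apply Rmult_lt_0_compat; lra); lra. }
  (* The [M + 1] copies of [H] leave exactly one [psi] at time 1 beside the [- M psi] inside [N].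
     [U] is positive already beyond [t0 = M/(M + 1) < 1], so the comparison can start at time 1. *)
  set (U := fun t x => C * (M + 1) * ss b psi t x + C * ss (b + 1) kap t x).
  assert (EU : forall t x, 0 < t -> U t x
     = C * Rpower t (- b) * ((M + 1 - M / t) * psi (x / sqrt t) + / t * gq 1 (3 / 8) (x / sqrt t))).
  { intros t x Ht; unfold U, ss, kap; rewrite (Rpower_succ_neg t b Ht).
    set (y := x / sqrt t); field; lra. }
  set (t0 := M / (M + 1)).
  assert (Ht0 : 0 < t0 < 1).
  { unfold t0; split; [apply Rdiv_lt_0_compat; lra|].
    apply Rmult_lt_reg_r with (M + 1); [lra|]; unfold Rdiv; rewrite Rmult_assoc, Rinv_l by lra; lra. }
  assert (Up : forall t x, t0 < t -> 0 < U t x).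
  { intros t x Ht; rewrite EU by lra.
    apply Rmult_lt_0_compat; [apply Rmult_lt_0_compat; [exact HC|apply Rpower_pos]|].
    pose proof (psi_pos (x / sqrt t)); pose proof (gq_bounds (3 / 8) (x / sqrt t) ltac:(lra)).
    assert (it : 0 < / t) by (apply Rinv_0_lt_compat; lra).
    assert (hm : M / t <= M + 1).
    { apply Rmult_le_reg_r with t; [lra|]; unfold Rdiv; rewrite Rmult_assoc, Rinv_l, Rmult_1_r by lra.
      replace M with (t0 * (M + 1)) at 1 by (unfold t0; field; lra).
      rewrite Rmult_comm; apply Rmult_le_compat_l; lra. }
    assert (0 <= (M + 1 - M / t) * psi (x / sqrt t)) by (apply Rmult_le_pos; lra).
    assert (0 < / t * gq 1 (3 / 8) (x / sqrt t)) by (apply Rmult_lt_0_compat; lra).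
    lra. }
  assert (Ap : forall t x, t0 < t -> 0 < ss 1 F t x).
  { intros t x Ht; unfold ss; apply Rmult_lt_0_compat; [apply Rpower_pos|].
    apply (Vinf_profile_bounds V Vinf HV hVinf). }
  pose proof (C12_weaken 0 t0 _ _ _ _ ltac:(lra) C12_Vinf) as cA.
  pose proof (C12_weaken 0 t0 _ _ _ _ ltac:(lra)
    (C12_lin (C * (M + 1)) C _ _ _ _ _ _ _ _ _ C12_H C12_N)) as cU.
  fold U in cU.
  pose proof (C12_sq _ _ _ _ _ _ _ _ _ cA cU Ap Up) as cS.
  destruct (HV 1 Rlt_0_1) as (Vt & Vx & Vxx & cV & Vp & Ve & Vtr).
  pose proof (C12_lin 1 (-1) _ _ _ _ _ _ _ _ _ cS (C12_weaken 0 t0 _ _ _ _ ltac:(lra) cV)) as cD.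
  set (Ut := fun t x => C * (M + 1) * ss_t b psi psi1 t x + C * ss_t (b + 1) kap kap1 t x) in *.
  set (Ux := fun t x => C * (M + 1) * ss_x b psi1 t x + C * ss_x (b + 1) kap1 t x) in *.
  set (Uxx := fun t x => C * (M + 1) * ss_xx b psi2 t x + C * ss_xx (b + 1) kap2 t x) in *.
  assert (sub := fun e1 e2 => sq_subsolution t0 (ss 1 F) (ss_t 1 F (F1 Vinf)) (ss_x 1 (F1 Vinf))
    (ss_xx 1 (F2 Vinf)) U Ut Ux Uxx Ap Up e1 e2).
  assert (e1 : forall t x, t0 < t -> ss_t 1 F (F1 Vinf) t x
     = / 2 * ss_xx 1 (F2 Vinf) t x - / 2 * ss 1 F t x ^ 2) by (intros; apply Vinf_pde; lra).
  assert (e2 : forall t x, t0 < t -> / 2 * Uxx t x - ss 1 F t x * U t x <= Ut t x).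
  { intros t x Ht; pose proof (H_pde t x ltac:(lra)) as e3; pose proof (N_pde t x ltac:(lra)) as e4.
    unfold U, Ut, Uxx; rewrite e3.
    apply (Rmult_le_compat_l C) in e4; lra. }
  specialize (sub e1 e2).
  intros t x Ht.
  assert (le : sq (ss 1 F) U t x <= V 1 t x).
  { enough (1 * sq (ss 1 F) U t x + -1 * V 1 t x <= 0) by lra.
    revert x; apply (comparison_from _ _ _ _ _ cD) with 1; [|lra|].
    - intros s x Hs Hpos; pose proof (sub s x Hs) as Hsub.
      rewrite (Ve s x) by lra; pose proof (Vp s x ltac:(lra)); nra.
    - intros x.
      pose proof (Vsol_lower (V 1) 1 1 x (HV 1 Rlt_0_1) Rlt_0_1 Rlt_0_1) as lowV.
      enough (sq (ss 1 F) U 1 x <= 1 * exp (- (1 / gmass) * sqrt 1) * heat 1 x) by lra.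
      unfold sq; rewrite EU by lra.
      unfold ss; rewrite Rpower_m1, Rinv_1, sqrt_1 by lra.
      assert (E1 : Rpower 1 (- b) = 1) by (unfold Rpower; rewrite ln_1, Rmult_0_r; apply exp_0).
      rewrite E1; replace (x / 1) with x by field.
      pose proof (psi_pos x) as pp; pose proof (Vinf_upper V Vinf HV hVinf x) as fu; fold (F x) in fu.
      pose proof (Vinf_profile_bounds V Vinf HV hVinf x) as [fp _]; fold (F x) in fp.
      pose proof (gq_bounds (3 / 8) x ltac:(lra)) as [gp _].
      replace (M + 1 - M / 1) with 1 by field; rewrite !Rmult_1_r, !Rmult_1_l.
      unfold heat; replace (- x ^ 2 / (2 * 1)) with (- x ^ 2 / 2) by field; rewrite sqrt_1, Rmult_1_r.
      apply Rle_trans with (gq CG (7 / 16) x ^ 2 / (C * gq 1 (3 / 8) x)).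
      + assert (0 < C * gq 1 (3 / 8) x) by (apply Rmult_lt_0_compat; lra).
        assert (0 < C * psi x) by (apply Rmult_lt_0_compat; lra).
        apply Rmult_le_compat; [apply pow2_ge_0|left; apply Rinv_0_lt_compat; lra|apply pow_incr; lra|].
        apply Rinv_le_contravar; lra.
      + right; unfold C, gq.
        replace ((CG * exp (- (7 / 16) * x ^ 2)) ^ 2)
          with (CG ^ 2 * (exp (- (7 / 16) * x ^ 2) * exp (- (7 / 16) * x ^ 2))) by ring.
        rewrite <- exp_plus.
        replace (- (7 / 16) * x ^ 2 + - (7 / 16) * x ^ 2) with (- x ^ 2 / 2 + - (3 / 8) * x ^ 2) by field.
        rewrite exp_plus.
        replace (- (1 / gmass)) with (- / gmass) by (field; lra); rewrite exp_Ropp.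
        pose proof (exp_pos (- (3 / 8) * x ^ 2)); pose proof (exp_pos (/ gmass)).
        field; repeat split; lra. }
  rewrite (Vinf_ss V Vinf HV hVinf t x) by lra; fold F.
  apply Rle_trans with (ss 1 F t x - sq (ss 1 F) U t x).
  { change (fun y => Vinf 1 y) with F; lra. }
  pose proof (Ap t x ltac:(lra)) as pa; pose proof (Up t x ltac:(lra)) as pu.
  apply Rle_trans with (U t x).
  - unfold sq; set (a := ss 1 F t x) in *; set (u := U t x) in *.
    apply Rminus_le_0; replace (u - (a - a ^ 2 / (a + u))) with (u ^ 2 / (a + u)) by (field; lra).
    apply Rdiv_le_0_compat; [apply pow2_ge_0|lra].
  - rewrite EU by lra.
    replace (C * ((M + 1) * C0 + 1) * Rpower t (- b)) with (C * Rpower t (- b) * ((M + 1) * C0 + 1)) by ring.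
    apply Rmult_le_compat_l; [apply Rmult_le_pos; [lra|left; apply Rpower_pos]|].
    pose proof (psi_pos (x / sqrt t)); pose proof (psi_bounded (x / sqrt t)).
    pose proof (gq_bounds (3 / 8) (x / sqrt t) ltac:(lra)).
    assert (it : 0 < / t <= 1).
    { split; [apply Rinv_0_lt_compat; lra|]; rewrite <- Rinv_1; apply Rinv_le_contravar; lra. }
    assert (0 <= M / t) by (apply Rdiv_le_0_compat; lra).
    apply Rplus_le_compat; [|nra].
    apply Rle_trans with ((M + 1) * psi (x / sqrt t)); [apply Rmult_le_compat_r; lra|].
    apply Rmult_le_compat_l; lra.
Qed.

(** At time [r^2] the lower bound of [Vinf] has amplitude [exp (- / gmass) / (r^2 gmass)], the upper
    bound of [V 1] has [1/(r gmass)], and their profiles agree; this [r] makes the first twice the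
    second. *)
Lemma gap_initial r x : r = exp (- / gmass) / 2 ->
  exp (- (x / r) ^ 2 / 2) / (r * gmass) <= Vinf (r ^ 2) x - V 1 (r ^ 2) x.
Proof.
  intros Hr; pose proof gmass_pos as Hg; pose proof (exp_pos (- / gmass)) as He.
  assert (Hr0 : 0 < r) by lra.
  assert (Hr2 : 0 < r ^ 2) by (apply pow_lt; exact Hr0).
  assert (Hs : sqrt (r ^ 2) = r) by (apply sqrt_pow2; lra).
  pose proof (Vsol_le_heat (V 1) 1 (r ^ 2) x (HV 1 Rlt_0_1) ltac:(lra) Hr2) as h2.
  rewrite heat_ss in h2 by exact Hr2.
  unfold ss, gq in h2; rewrite Rpower_half, Hs in h2 by exact Hr2.
  rewrite (Vinf_ss V Vinf HV hVinf _ x Hr2); unfold ss; rewrite Rpower_m1, Hs by exact Hr2.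
  pose proof (Vinf_lower V Vinf HV hVinf (x / r)) as h3.
  rewrite heat_ss in h3 by lra.
  unfold ss, gq in h3; rewrite Rpower_half, sqrt_1, Rinv_1, Rmult_1_l in h3 by lra.
  replace (x / r / 1) with (x / r) in h3 by (field; lra).
  set (E := exp (- / 2 * (x / r) ^ 2)) in *.
  replace (exp (- (x / r) ^ 2 / 2)) with E by (unfold E; f_equal; field; lra).
  replace (exp (- / gmass)) with (2 * r) in h3 by lra.
  assert (ir : 0 < / r ^ 2) by (apply Rinv_0_lt_compat; exact Hr2).
  assert (/ r ^ 2 * (2 * r * (/ gmass * E)) <= / r ^ 2 * Vinf 1 (x / r)) by (apply Rmult_le_compat_l; lra).
  replace (/ r ^ 2 * (2 * r * (/ gmass * E))) with (2 * (E / (r * gmass))) in H by (field; lra).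
  replace (1 * (/ r * (/ gmass * E))) with (E / (r * gmass)) in h2 by (field; lra).
  lra.
Qed.

Lemma lower_unit K : 1 <= K -> exists c, 0 < c /\ forall t x, 1 <= t -> Rabs x <= K * sqrt t ->
  c * Rpower t (- b) <= Vinf t x - V 1 t x.
Proof.
  intros HK; pose proof gmass_pos as Hg; pose proof half_le_lam0 as Hlam.
  destruct (positive_on psi (- K) K ltac:(lra)) as (cK & HcK & cpsi).
  { intros; eapply cont_is_derive, is_derive_psi. }
  { intros; apply psi_pos. }
  (* On [[-K, K]] one has [psi >= 2 th], and the Gaussian is at most 1; so at times [t >= 1]
     subtracting [th N] leaves at least [th]. *)
  set (th := cK / 2).
  set (r := exp (- / gmass) / 2).
  assert (Hr : 0 < r < 1).
  { unfold r; pose proof (exp_pos (- / gmass)); split; [lra|].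
    assert (exp (- / gmass) <= 1); [|lra].
    rewrite <- exp_0; apply exp_le_compat.
    assert (0 < / gmass) by (apply Rinv_0_lt_compat; lra); lra. }
  set (t0 := r ^ 2); assert (Ht0 : 0 < t0 < 1) by (unfold t0; split; [apply pow_lt; lra|nra]).
  set (Bl := fun t x => 1 * ss b psi t x + - th * ss (b + 1) kap t x).
  assert (EB : forall t x, 0 < t -> Bl t x
     = Rpower t (- b) * ((1 + th * M / t) * psi (x / sqrt t) - th / t * gq 1 (3 / 8) (x / sqrt t))).
  { intros t x Ht; unfold Bl, ss, kap; rewrite (Rpower_succ_neg t b Ht).
    set (y := x / sqrt t); field; lra. }
  set (R0 := Rpower t0 (- b)); assert (HR0 : 0 < R0) by apply Rpower_pos.
  set (a := 1 + th * M / t0); set (d := th / t0).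
  assert (Hth : 0 < th) by (unfold th; lra).
  assert (Ha : 0 < a).
  { assert (0 < th * M / t0); [|unfold a; lra].
    apply Rdiv_lt_0_compat; [apply Rmult_lt_0_compat; lra|lra]. }
  assert (Hd : 0 < d) by (apply Rdiv_lt_0_compat; lra).
  (* The maximum of [a C0 w - d w^2] over [w], to be used with [w = exp (y^2/16)]; [e] then scales
     the barrier at time [t0] down to the gap found in [gap_initial]. *)
  set (Q := (a * C0) ^ 2 / (4 * d)).
  assert (HQ : 0 <= Q) by (apply Rdiv_le_0_compat; [apply pow2_ge_0|lra]).
  set (e := / (r * gmass) / (R0 * (Q + 1))).
  assert (Hrg : 0 < / (r * gmass)) by (apply Rinv_0_lt_compat, Rmult_lt_0_compat; lra).
  assert (He : 0 < e).
  { apply Rdiv_lt_0_compat; [exact Hrg|apply Rmult_lt_0_compat; lra]. }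
  destruct (HV 1 Rlt_0_1) as (Vt & Vx & Vxx & cV & Vp & Ve & Vtr).
  assert (Ht2 : 0 <= t0 / 2) by lra.
  pose proof (C12_lin 1 (-1) _ _ _ _ _ _ _ _ _ C12_Vinf cV) as cW.
  pose proof (C12_lin 1 (- th) _ _ _ _ _ _ _ _ _ C12_H C12_N) as cB.
  pose proof (C12_weaken 0 (t0 / 2) _ _ _ _ Ht2 (C12_lin e (-1) _ _ _ _ _ _ _ _ _ cB cW)) as cD.
  assert (Wpos : forall t x, 0 < t -> 0 <= ss 1 F t x - V 1 t x).
  { intros t x Ht; pose proof (V_le_Vinf V Vinf HV hVinf 1 t x Rlt_0_1 Ht) as w.
    rewrite (Vinf_ss V Vinf HV hVinf t x Ht) in w; change (fun y => Vinf 1 y) with F in w; lra. }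
  (* An upper bound for the barrier at times beyond [t0 / 2], required by [comparison_bounded]: the
     inequality for the difference is used without absorption. *)
  set (B0 := e * (Rpower (t0 / 2) (- b) * ((1 + th * M / (t0 / 2)) * C0))).
  assert (HB0 : 0 <= B0).
  { unfold B0; apply Rmult_le_pos; [lra|]; apply Rmult_le_pos; [left; apply Rpower_pos|].
    apply Rmult_le_pos; [|lra]; assert (0 <= th * M / (t0 / 2)); [|lra].
    apply Rdiv_le_0_compat; [apply Rmult_le_pos; lra|lra]. }
  assert (Dmain : forall t x, t0 <= t -> e * Bl t x <= ss 1 F t x - V 1 t x).
  { intros t x Ht.
    enough (e * Bl t x + -1 * (1 * ss 1 F t x + -1 * V 1 t x) <= 0) by lra.
    revert x; apply (comparison_bounded (t0 / 2) _ _ _ _ B0 cD Ht2 HB0) with t0; [| |lra|].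
    - clear t Ht; intros t x Ht; fold (Bl t x).
      assert (e * Bl t x <= B0); [|specialize (Wpos t x ltac:(lra)); lra].
      unfold B0; apply Rmult_le_compat_l; [lra|]; rewrite EB by lra.
      pose proof (psi_pos (x / sqrt t)); pose proof (psi_bounded (x / sqrt t)).
      pose proof (gq_bounds (3 / 8) (x / sqrt t) ltac:(lra)).
      assert (i1 : 0 < / t <= / (t0 / 2)) by (split; [apply Rinv_0_lt_compat|apply Rinv_le_contravar]; lra).
      assert (0 < th * M) by (apply Rmult_lt_0_compat; lra).
      assert (i2 : 0 <= th * M / t <= th * M / (t0 / 2)).
      { split; [apply Rdiv_le_0_compat; lra|apply Rmult_le_compat_l; lra]. }
      assert (i3 : 0 <= th / t * gq 1 (3 / 8) (x / sqrt t))
        by (apply Rmult_le_pos; [apply Rdiv_le_0_compat|]; lra).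
      apply Rle_trans with (Rpower t (- b) * ((1 + th * M / (t0 / 2)) * C0)).
      + apply Rmult_le_compat_l; [left; apply Rpower_pos|].
        apply Rle_trans with ((1 + th * M / t) * psi (x / sqrt t)); [lra|].
        apply Rmult_le_compat; lra.
      + apply Rmult_le_compat_r; [apply Rmult_le_pos; lra|].
        apply Rpower_neg_anti; [lra|unfold b; lra].
    - clear t Ht; intros t x Ht Hpos; assert (Ht' : 0 < t) by lra.
      rewrite (Ve t x Ht'), (Vinf_pde t x Ht'), (H_pde t x Ht').
      pose proof (N_pde t x Ht') as HN; specialize (Wpos t x Ht'); specialize (Vp t x Ht').
      set (A := ss 1 F t x) in *; set (v := V 1 t x) in *.
      set (Hh := ss b psi t x) in *; set (N := ss (b + 1) kap t x) in *.
      set (Nt := ss_t (b + 1) kap kap1 t x) in *; set (Nxx := ss_xx (b + 1) kap2 t x) in *.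
      (* With [W = A - v], the difference satisfies [D_t <= D_xx/2 - A D - W^2/2], and the last two
         terms have the right sign where [D > 0]. *)
      assert (E1 : e * th * (/ 2 * Nxx - A * N) <= e * th * Nt)
        by (apply Rmult_le_compat_l; [apply Rmult_le_pos; lra|exact HN]).
      assert (E2 : 0 <= A * (e * (1 * Hh + - th * N) + -1 * (1 * A + -1 * v)))
        by (apply Rmult_le_pos; lra).
      assert (E3 : 0 <= (A - v) ^ 2) by apply pow2_ge_0.
      nra.
    - intros x; fold (Bl t0 x).
      enough (e * Bl t0 x <= ss 1 F t0 x - V 1 t0 x) by lra.
      pose proof (gap_initial r x eq_refl) as G; fold t0 in G.
      rewrite (Vinf_ss V Vinf HV hVinf t0 x) in G by lra; change (fun y => Vinf 1 y) with F in G.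
      eapply Rle_trans; [|exact G].
      rewrite EB by lra; fold R0; fold a; fold d.
      replace (sqrt t0) with r by (unfold t0; symmetry; apply sqrt_pow2; lra).
      set (y := x / r); set (w := exp (y ^ 2 / 16)); set (g := exp (- y ^ 2 / 2)).
      assert (gp : 0 < g) by apply exp_pos.
      pose proof (psi_upper y) as pu; fold w in pu; fold g in pu.
      assert (Ew : gq 1 (3 / 8) y = g * w ^ 2).
      { unfold gq, g, w; replace (exp (y ^ 2 / 16) ^ 2) with (exp (y ^ 2 / 16) * exp (y ^ 2 / 16)) by ring.
        rewrite <- !exp_plus, Rmult_1_l; f_equal; field. }
      rewrite Ew.
      assert (q1 : a * psi y - d * (g * w ^ 2) <= g * Q).
      { apply Rle_trans with (g * (a * C0 * w - d * w ^ 2)).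
        - assert (a * psi y <= a * (g * (C0 * w))) by (apply Rmult_le_compat_l; lra); lra.
        - apply Rmult_le_compat_l; [lra|].
          apply Rminus_le_0; unfold Q.
          replace (_ - _) with ((a * C0 - 2 * d * w) ^ 2 / (4 * d)) by (field; lra).
          apply Rdiv_le_0_compat; [apply pow2_ge_0|lra]. }
      apply Rle_trans with (e * (R0 * (g * (Q + 1)))).
      + apply Rmult_le_compat_l; [lra|]; apply Rmult_le_compat_l; [lra|]; nra.
      + right; unfold e; field; repeat split; lra. }
  exists (e * th); split; [apply Rmult_lt_0_compat; lra|].
  intros t x Ht Hx.
  rewrite (Vinf_ss V Vinf HV hVinf t x) by lra; change (fun y => Vinf 1 y) with F.
  eapply Rle_trans; [|apply Dmain; lra].
  rewrite Rmult_assoc; apply Rmult_le_compat_l; [lra|]; rewrite EB by lra.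
  rewrite Rmult_comm; apply Rmult_le_compat_l; [left; apply Rpower_pos|].
  pose proof (sqrt_lt_R0 t ltac:(lra)) as Hs.
  set (y := x / sqrt t).
  assert (Hy : - K <= y <= K).
  { apply Rabs_le_between; unfold y, Rdiv; rewrite Rabs_mult, (Rabs_pos_eq (/ sqrt t)) by (left; apply Rinv_0_lt_compat; lra).
    apply Rmult_le_reg_r with (sqrt t); [lra|]; rewrite Rmult_assoc, Rinv_l, Rmult_1_r by lra; exact Hx. }
  pose proof (cpsi y Hy) as pc; pose proof (gq_bounds (3 / 8) y ltac:(lra)) as gb.
  assert (it : 0 < / t <= 1).
  { split; [apply Rinv_0_lt_compat; lra|]; rewrite <- Rinv_1; apply Rinv_le_contravar; lra. }
  assert (0 <= th * M / t) by (apply Rdiv_le_0_compat; [apply Rmult_le_pos; lra|lra]).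
  assert (0 <= th * M / t * psi y) by (apply Rmult_le_pos; lra).
  assert (th / t * gq 1 (3 / 8) y <= th * 1 * 1).
  { unfold Rdiv; apply Rmult_le_compat; try lra; [apply Rmult_le_pos; lra|apply Rmult_le_compat_l; lra]. }
  assert (cK = 2 * th) by (unfold th; field).
  lra.
Qed.
End Final.

(** On [[-Y, Y]] the positive minimum of [psi] lets [M psi] outweigh the negative part, at most
    [lam0 + 2]; beyond [Y] the quadratic term makes the coefficient nonnegative. *)
Lemma barrier_constant (lam0 : R) (psi : R -> R) : - 2 < lam0 -> (forall y, continuous psi y) ->
  (forall y, 0 < psi y) -> exists M, 0 < M /\ forall y,
  0 <= (3 / 32 * y ^ 2 + 3 / 8 - (lam0 + 3 / 2)) * gq 1 (3 / 8) y + M * psi y.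
Proof.
  intros Hl cp pp.
  set (Y := 11 * (lam0 + 2) + 1).
  destruct (positive_on psi (- Y) Y ltac:(unfold Y; lra) cp (fun y _ => pp y)) as (c & Hc & cc).
  exists ((lam0 + 2) / c); split; [apply Rdiv_lt_0_compat; lra|].
  intros y; pose proof (gq_bounds (3 / 8) y ltac:(lra)) as gb; pose proof (pp y) as py.
  assert (Mp : 0 < (lam0 + 2) / c) by (apply Rdiv_lt_0_compat; lra).
  destruct (Rle_dec (Rabs y) Y) as [hy|hy].
  - apply Rabs_le_between in hy; specialize (cc y hy).
    assert (lam0 + 2 <= (lam0 + 2) / c * psi y).
    { replace (lam0 + 2) with ((lam0 + 2) / c * c) at 1 by (field; lra).
      apply Rmult_le_compat_l; lra. }
    pose proof (pow2_ge_0 y); nra.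
  - assert (Y ^ 2 <= y ^ 2).
    { rewrite <- (pow2_abs y); apply pow_incr; unfold Y in *; lra. }
    assert (0 <= (lam0 + 2) / c * psi y) by (apply Rmult_le_pos; lra).
    assert (0 <= 3 / 32 * y ^ 2 + 3 / 8 - (lam0 + 3 / 2)) by (unfold Y in *; nra).
    assert (0 <= (3 / 32 * y ^ 2 + 3 / 8 - (lam0 + 3 / 2)) * gq 1 (3 / 8) y) by (apply Rmult_le_pos; lra).
    lra.
Qed.

(** Source of the exponent of [lam] in the theorem: [lam^2] from the amplitude and
    [(lam^2)^(-1/2-a)] from the time. *)
Lemma Rpower_dilation lam t a : 0 < lam -> 0 < t ->
  lam ^ 2 * Rpower (lam ^ 2 * t) (- (/ 2 + a)) = Rpower t (- / 2 - a) * Rpower lam (- (2 * a - 1)).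
Proof.
  intros Hl Ht; assert (0 < lam ^ 2) by (apply pow_lt; exact Hl).
  rewrite <- Rpower_mult_distr by assumption.
  assert (E : lam ^ 2 = Rpower lam 2) by (rewrite <- Rpower_pow by exact Hl; reflexivity).
  rewrite E, Rpower_mult.
  replace (- (2 * a - 1)) with (2 + 2 * - (/ 2 + a)) by field; rewrite Rpower_plus.
  replace (- / 2 - a) with (- (/ 2 + a)) by ring; ring.
Qed.

Theorem theorem1p4
  (V : R -> R -> R -> R) (Vinf : R -> R -> R) (lam0 : R)
  (hV : forall lam, 0 < lam -> is_V_lambda (V lam) lam)
  (hVinf : forall t x, 0 < t ->
     is_lim (fun lam => V lam t x) p_infty (Vinf t x))
  (hlam0 : lowest_eigenvalue_LF (fun x => Vinf 1 x) lam0) :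
  exists (Cbar : R) (Cund : R -> R),
    0 < Cbar /\ (forall K, 1 <= K -> 0 < Cund K) /\
    (forall t lam x, 0 < t -> 0 < lam ->
       Vinf t x - V lam t x
         <= Cbar * Rpower t (- / 2 - lam0) * Rpower lam (- (2 * lam0 - 1))) /\
    (forall K t lam x, 1 <= K -> 0 < t -> Rpower t (- / 2) <= lam ->
       Rabs x <= K * sqrt t ->
       Cund K * Rpower t (- / 2 - lam0) * Rpower lam (- (2 * lam0 - 1))
         <= Vinf t x - V lam t x).
Proof.
  assert (HV : forall lam, 0 < lam -> Vsol (V lam) lam)
    by (intros; apply Vsol_of_is_V_lambda, hV; assumption).
  destruct (ground_state (fun x => Vinf 1 x) CG lam0) as (h & h1 & C0 & Hs & hp & HC0 & hb); auto.
  { apply (continuous_Vinf_profile V Vinf HV hVinf). }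
  { intros x; pose proof (Vinf_profile_bounds V Vinf HV hVinf x); lra. }
  { intros x; apply (Vinf_even V Vinf HV hVinf); lra. }
  pose proof (half_le_lam0 V Vinf lam0 HV hVinf h h1 C0 Hs hp hb) as Hlam.
  destruct (barrier_constant lam0 (psi h)) as (M & HM & HMpsi); [lra| |apply (psi_pos h hp)|].
  { intros; eapply cont_is_derive, (is_derive_psi Vinf lam0 h h1 Hs). }
  destruct (upper_unit V Vinf lam0 HV hVinf h h1 C0 Hs hp HC0 hb M HM HMpsi) as (Cu & HCu & Hup).
  (* Stated for every real [K], with 0 as the value below 1, so that [functional_choice] yields the
     constant as a function of [K]. *)
  assert (Hlow : forall K, exists c, 1 <= K -> 0 < c /\ forall t x, 1 <= t -> Rabs x <= K * sqrt t ->
     c * Rpower t (- (/ 2 + lam0)) <= Vinf t x - V 1 t x).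
  { intros K; destruct (Rle_dec 1 K) as [hK|hK]; [|exists 0; intros; contradiction].
    destruct (lower_unit V Vinf lam0 HV hVinf h h1 C0 Hs hp HC0 hb M HM HMpsi K hK) as (c & Hc & H).
    exists c; auto. }
  apply functional_choice in Hlow; destruct Hlow as [Cund HCund].
  pose proof CG_pos as HCG.
  assert (dil : forall lam t x, 0 < lam -> 0 < t ->
    Vinf t x - V lam t x = lam ^ 2 * (Vinf (lam ^ 2 * t) (lam * x) - V 1 (lam ^ 2 * t) (lam * x))).
  { intros lam t x Hl Ht.
    pose proof (Vinf_dilation V Vinf HV hVinf lam t x Hl Ht) as e1.
    pose proof (V_dilation V HV 1 lam t x Rlt_0_1 Hl Ht) as e2; rewrite Rmult_1_r in e2.
    rewrite <- e1, <- e2; ring. }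
  assert (Hall : forall t x, 0 < t -> Vinf t x - V 1 t x <= (Cu + CG) * Rpower t (- (/ 2 + lam0))).
  { intros t x Ht; pose proof (Rpower_pos t (- (/ 2 + lam0))) as rp.
    destruct (Rle_dec 1 t) as [h'|h'].
    - specialize (Hup t x h'); nra.
    (* Before time 1 the gap is at most [CG / t], and [1/t <= t^(-1/2-lam0)] because
       [lam0 >= 1/2]. *)
    - assert (v0 : 0 <= V 1 t x) by (apply (Vsol_pos _ 1); [apply HV; lra|exact Ht]).
      assert (vi : Vinf t x <= CG * Rpower t (- (1))).
      { rewrite (Vinf_ss V Vinf HV hVinf t x Ht); unfold ss; rewrite Rmult_comm.
        apply Rmult_le_compat_r; [left; apply Rpower_pos|apply (Vinf_profile_bounds V Vinf HV hVinf)]. }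
      assert (rl : Rpower t (- (1)) <= Rpower t (- (/ 2 + lam0))).
      { unfold Rpower; apply exp_le_compat.
        assert (ln t < 0) by (rewrite <- ln_1; apply ln_increasing; lra); nra. }
      nra. }
  exists (Cu + CG), Cund; split; [lra|split; [intros K hK; apply (HCund K hK)|split]].
  - intros t lam x Ht Hl.
    assert (H2 : 0 < lam ^ 2) by (apply pow_lt; exact Hl).
    rewrite Rmult_assoc, <- (Rpower_dilation lam t lam0 Hl Ht), dil by assumption.
    specialize (Hall (lam ^ 2 * t) (lam * x) ltac:(apply Rmult_lt_0_compat; lra)).
    assert (lam ^ 2 * (Vinf (lam ^ 2 * t) (lam * x) - V 1 (lam ^ 2 * t) (lam * x))
      <= lam ^ 2 * ((Cu + CG) * Rpower (lam ^ 2 * t) (- (/ 2 + lam0)))) by (apply Rmult_le_compat_l; lra).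
    lra.
  - intros K t lam x hK Ht Hlt Hx.
    pose proof (sqrt_lt_R0 t Ht) as Hst.
    rewrite Rpower_half in Hlt by exact Ht.
    assert (Hl : 0 < lam) by (eapply Rlt_le_trans; [apply Rinv_0_lt_compat; exact Hst|exact Hlt]).
    assert (H2 : 0 < lam ^ 2) by (apply pow_lt; exact Hl).
    (* The assumed lower bound on [lam] says that the rescaled time [lam^2 t] is at least 1. *)
    assert (hl1 : 1 <= lam * sqrt t).
    { replace 1 with (/ sqrt t * sqrt t) by (field; lra); apply Rmult_le_compat_r; lra. }
    assert (Es : sqrt (lam ^ 2 * t) = lam * sqrt t).
    { rewrite sqrt_mult by lra; rewrite sqrt_pow2 by lra; reflexivity. }
    assert (h1t : 1 <= lam ^ 2 * t).
    { rewrite <- (sqrt_sqrt t) by lra; replace (lam ^ 2 * (sqrt t * sqrt t)) with ((lam * sqrt t) ^ 2) by ring; nra. }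
    rewrite Rmult_assoc, <- (Rpower_dilation lam t lam0 Hl Ht), dil by assumption.
    destruct (HCund K hK) as [_ HL].
    specialize (HL (lam ^ 2 * t) (lam * x) h1t).
    assert (hx : Rabs (lam * x) <= K * sqrt (lam ^ 2 * t)).
    { rewrite Es, Rabs_mult, (Rabs_pos_eq lam) by lra.
      replace (K * (lam * sqrt t)) with (lam * (K * sqrt t)) by ring; apply Rmult_le_compat_l; lra. }
    specialize (HL hx).
    assert (lam ^ 2 * (Cund K * Rpower (lam ^ 2 * t) (- (/ 2 + lam0)))
      <= lam ^ 2 * (Vinf (lam ^ 2 * t) (lam * x) - V 1 (lam ^ 2 * t) (lam * x)))
      by (apply Rmult_le_compat_l; lra).
    lra.
Qed.
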